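(* Let $A$ be a jointly measurable stationary random field on $\mathbb{R}^d$, let $\tilde\partial=\partial^{\mathrm{fct}}$ or $\partial^{\mathrm{osc}}$, and assume that $A$ satisfies ($\tilde\partial$-MSG) with integrable weight $\pi:\mathbb{R}_+\to\mathbb{R}_+$. Then there exists $C>0$ (depending only on $d,\pi$) such that for all $1\le p<\infty$ and all $\sigma(A)$-measurable random variables $X(A)$: (i) if $\tilde\partial=\partial^{\mathrm{fct}}$, $$\mathbb{E}\big[(X(A)-\mathbb{E}[X(A)])^{2p}\big]\le(Cp^2)^p\,\mathbb{E}\bigg[\Big(\int_0^\infty\int_{\mathbb{R}^d}\big(\partial^{\mathrm{fct}}_{A,B_{\ell+1}(x)}X(A)\big)^2dx\,(\ell+1)^{-d}\pi(\ell)\,d\ell\Big)^p\bigg],$$ where the multiplicative factor $(Cp^2)^p$ can be upgraded to $(Cp)^p$ if $A$ further satisfies ($\partial^{\mathrm{fct}}$-MLSI) with weight $\pi$; (ii) if $\tilde\partial=\partial^{\mathrm{osc}}$, $$\mathbb{E}\big[(X(A)-\mathbb{E}[X(A)])^{2p}\big]\le(Cp^2)^p\,\mathbb{E}\bigg[\int_0^\infty\Big(\int_{\mathbb{R}^d}\big(\partial^{\mathrm{osc}}_{A,B_{2(\ell+1)}(x)}X(A)\big)^2dx\Big)^p(\ell+1)^{-dp}\pi(\ell)\,d\ell\bigg].$$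
   Context: $B_r(x)$ denotes the Euclidean ball of radius $r$ centered at $x\in\mathbb{R}^d$. For real $p\ge1$ and $a\in\mathbb{R}$, $a^{2p}$ stands for $|a|^{2p}$. Random field. $A:\mathbb{R}^d\times\Omega\to\mathbb{R}$ is a jointly measurable random field on a probability space $(\Omega,\mathcal{A},\mathbb{P})$, stationary: for all $z\in\mathbb{R}^d$, $A(\cdot+z,\cdot)$ has the same finite-dimensional distributions as $A$. $X(A),Z(A)$ denote real $\sigma(A)$-measurable random variables. Oscillation. For a Borel set $S\subset\mathbb{R}^d$, $\partial^{\mathrm{osc}}_{A,S}X(A):=\mathcal{M}[X(A)\|A|_{\mathbb{R}^d\setminus S}]+\mathcal{M}[-X(A)\|A|_{\mathbb{R}^d\setminus S}]$, where $\mathcal{M}[Y\|A|_{\mathbb{R}^d\setminus S}]$ is the conditional essential supremum of $Y$ given $\sigma(A|_{\mathbb{R}^d\setminus S})$, i.e. the a.s. smallest $\sigma(A|_{\mathbb{R}^d\setminus S})$-measurable random variable that dominates $Y$ a.s. (Formally: essential supremum minus essential infimum of $X(A')$ over $A'$ coinciding with $A$ outside $S$.) Functional derivative. Fix an open set $M\subset L^\infty(\mathbb{R}^d)$ containing the realizations of $A$ and an extension $\tilde X:M\to\mathbb{R}$ of $X$ (such an extension is always assumed implicitly given). The Gâteaux derivative $\frac{\partial\tilde X(A)}{\partial A}\in L^2(\Omega,L^1_{\mathrm{loc}}(\mathbb{R}^d))$ is defined by $\lim_{t\to0}\frac{\tilde X(A+tB)-\tilde X(A)}{t}=\int_{\mathbb{R}^d}B(x)\frac{\partial\tilde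 X(A)}{\partial A}(x)\,dx$ a.s. for all compactly supported $B\in L^\infty(\mathbb{R}^d)$, if the limit exists, and for bounded Borel $S$, $\partial^{\mathrm{fct}}_{A,S}X(A):=\int_S\big|\frac{\partial\tilde X(A)}{\partial A}(x)\big|\,dx$. Functional inequalities. With $\tilde\partial\in\{\partial^{\mathrm{osc}},\partial^{\mathrm{fct}}\}$ and $\pi$ integrable: - ($\tilde\partial$-MSG) with weight $\pi$: for all $X(A)$, $\mathrm{Var}[X(A)]\le\mathbb{E}\big[\int_0^\infty\int_{\mathbb{R}^d}(\tilde\partial_{A,B_{\ell+1}(x)}X(A))^2dx\,(\ell+1)^{-d}\pi(\ell)\,d\ell\big]$. - ($\tilde\partial$-MLSI) with weight $\pi$: for all $Z(A)$, $\mathrm{Ent}[Z(A)^2]:=\mathbb{E}\big[Z(A)^2\log\frac{Z(A)^2}{\mathbb{E}[Z(A)^2]}\big]\le\mathbb{E}\big[\int_0^\infty\int_{\mathbb{R}^d}(\tilde\partial_{A,B_{\ell+1}(x)}Z(A))^2dx\,(\ell+1)^{-d}\pi(\ell)\,d\ell\big]$. *)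

(* Defs.v *)
From HB Require Import structures.
From mathcomp Require Import all_boot all_order all_algebra.
From mathcomp Require Import all_classical all_reals all_analysis.
From mathcomp Require Import measurable_realfun.

Set Implicit Arguments.
Unset Strict Implicit.
Unset Printing Implicit Defensive.

Import Order.TTheory GRing.Theory Num.Theory.
Import numFieldNormedType.Exports.

Local Open Scope classical_set_scope.
Local Open Scope ring_scope.

Notation Rd R d := (d.-tuple (measurableTypeR R)).

Section lebesgue_cons.
Context {R : realType} (n : nat).
Variable m : {sigma_finite_measure set (Rd R n) -> \bar R}.

Definition cons_pair (p : measurableTypeR R * Rd R n) : Rd R n.+1 :=
  [tuple of p.1 :: p.2].

Lemma measurable_cons_pair : measurable_fun setT cons_pair.
Proof. exact: measurable_cons. Qed.

Definition lebesgue_cons : set (Rd R n.+1) -> \bar R :=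
  pushforward (lebesgue_measure \x m)%E cons_pair.

Let lebesgue_cons0 : lebesgue_cons set0 = 0%E.
Proof. by rewrite /lebesgue_cons /pushforward preimage_set0 measure0. Qed.

Let lebesgue_cons_ge0 A : (0 <= lebesgue_cons A)%E.
Proof. exact: (measure_ge0 (lebesgue_measure \x m)%E). Qed.

Let lebesgue_cons_sigma_additive : semi_sigma_additive lebesgue_cons.
Proof.
move=> F mF tF mUF; rewrite /lebesgue_cons /pushforward preimage_bigcup.
have mc := measurable_cons_pair.
apply: measure_semi_sigma_additive.
- by move=> i; rewrite -[X in measurable X]setTI; exact: mc.
- apply/trivIsetP => /= i j _ _ ij; rewrite -preimage_setI.
  by move/trivIsetP : tF => /(_ _ _ _ _ ij) ->//; rewrite preimage_set0.
- by rewrite -preimage_bigcup -[X in measurable X]setTI; exact: mc.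
Qed.

HB.instance Definition _ := isMeasure.Build _ _ _ lebesgue_cons
  lebesgue_cons0 lebesgue_cons_ge0 lebesgue_cons_sigma_additive.

Let lebesgue_cons_sigma_finite : sigma_finite setT lebesgue_cons.
Proof.
have /sigma_finiteP[F [TF ndF Foo]] := sigma_finiteT (@lebesgue_measure R).
have /sigma_finiteP[G [TG ndG Goo]] := sigma_finiteT m.
pose g (x : Rd R n.+1) : measurableTypeR R * Rd R n :=
  (thead x, [tuple of behead x]).
have gK : cancel cons_pair g.
  by move=> [a x]; congr pair; apply: val_inj.
have mg : measurable_fun setT g.
  apply/measurable_fun_pair; last exact: measurable_behead.
  exact: measurable_tnth.
exists (fun i => g @^-1` (F i `*` G i)).
  rewrite -preimage_bigcup predeqE => x; split=> // _.
  have [i _ Fi] : (\bigcup_i F i) (g x).1 by rewrite -TF.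
  have [j _ Gj] : (\bigcup_j G j) (g x).2 by rewrite -TG.
  exists (maxn i j) => //; split.
    by move: Fi; apply: (subsetPset _ _ (ndF _ _ (leq_maxl i j))).
  by move: Gj; apply: (subsetPset _ _ (ndG _ _ (leq_maxr i j))).
move=> i; have [mFi Fioo] := Foo i; have [mGi Gioo] := Goo i; split.
  by rewrite -[X in measurable X]setTI; apply: mg => //; exact: measurableX.
rewrite /lebesgue_cons /pushforward -comp_preimage.
rewrite (_ : g \o cons_pair = id); last exact/funext.
by rewrite preimage_id product_measure1E// lte_mul_pinfty// ge0_fin_numE.
Qed.

HB.instance Definition _ := Measure_isSigmaFinite.Build _ _ _ lebesgue_cons
  lebesgue_cons_sigma_finite.

End lebesgue_cons.

Fixpoint lebesgue_Rd (R : realType) (n : nat) :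
    {sigma_finite_measure set (Rd R n) -> \bar R} :=
  if n is k.+1 then lebesgue_cons (lebesgue_Rd R k) else \d_([tuple]).

Section euclidean.
Context {R : realType} {d : nat}.
Implicit Types x y z : Rd R d.

Definition shift z x : Rd R d := [tuple (tnth x i : R) + tnth z i | i < d].

Definition edist x y : R :=
  Num.sqrt (\sum_(i < d) ((tnth x i : R) - tnth y i) ^+ 2).

Definition eball x (r : R) : set (Rd R d) := [set y | edist x y < r].

Definition origin : Rd R d := [tuple (0 : R) | i < d].

Definition compactly_supported (B : Rd R d -> R) :=
  exists r : R, forall y, ~ eball origin r y -> B y = 0.

End euclidean.

Section random_field.
Context {R : realType} {d : nat} {disp : measure_display}.
Context {Omega : measurableType disp}.
Variables (P : probability Omega R) (A : Rd R d -> Omega -> R).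

Definition jointly_measurable :=
  measurable_fun [set: Rd R d * Omega] (fun q => A q.1 q.2).

Definition stationary :=
  forall (z : Rd R d) (n : nat) (x : n.-tuple (Rd R d)) (U : set (Rd R n)),
    measurable U ->
    P [set w | U [tuple A (shift z (tnth x i)) w | i < n]] =
    P [set w | U [tuple A (tnth x i) w | i < n]].

(* The probability space equipped with the sigma-algebra of A restricted to
   S, i.e. the one generated by the coordinates A x, x in S. *)
Definition sigma_field (S : set (Rd R d)) := g_sigma_algebraType
  (\bigcup_(x in S) preimage_set_system [set: Omega] (A x) measurable).

Definition field_measurable {d'} {T : measurableType d'} (S : set (Rd R d))
    (Y : Omega -> T) :=
  measurable_fun [set: sigma_field S] (Y : sigma_field S -> T).

(* M is a version of the conditional essential supremum of Y given A
   restricted to S; it may take infinite values. *)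
Definition is_cond_ess_sup (S : set (Rd R d)) (Y : Omega -> R)
    (M : Omega -> \bar R) :=
  [/\ field_measurable S M,
      {ae P, forall w, ((Y w)%:E <= M w)%E} &
      forall M' : Omega -> \bar R, field_measurable S M' ->
        {ae P, forall w, ((Y w)%:E <= M' w)%E} ->
        {ae P, forall w, (M w <= M' w)%E}].

Definition is_osc (S : set (Rd R d)) (X : Omega -> R) (D : Omega -> \bar R) :=
  exists M1 M2 : Omega -> \bar R,
    [/\ is_cond_ess_sup (~` S) X M1,
        is_cond_ess_sup (~` S) (fun w => - X w) M2 &
        {ae P, forall w, D w = (M1 w + M2 w)%E}].

(* For each ball the oscillation is only defined up to a P-null set, while the
   functional inequalities integrate it over centers and radii: D is a jointly
   measurable version of (r, x) |-> oscillation over the ball of radius r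
   centered at x. Versions exist because the oscillation is nondecreasing in
   the ball: the suprema (resp. infima) over rational balls strictly inside
   (resp. outside) the given one are measurable lower and upper bounds, which
   for fixed x and w differ at countably many radii only. By Fubini two
   versions agree almost everywhere on ]0, +oo[ * R^d * Omega, so that no
   integral below depends on the choice of D. *)
Definition is_osc_field (X : Omega -> R) (D : R -> Rd R d -> Omega -> \bar R) :=
  measurable_fun [set: R * Rd R d * Omega] (fun q => D q.1.1 q.1.2 q.2) /\
  {ae lebesgue_measure, forall r : R, 0 < r ->
    {ae lebesgue_Rd R d, forall x, is_osc (eball x r) X (D r x)}}.

(* Open subset of L^oo(R^d), as a set of functions rather than of classes: the
   second condition makes it saturated for almost everywhere equality. *)
Definition open_Linfty (M : set (Rd R d -> R)) :=
  (forall f, M f -> f \in Lfun (lebesgue_Rd R d) +oo%E) /\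
  (forall f, M f -> exists2 e : R, 0 < e &
    forall g, g \in Lfun (lebesgue_Rd R d) +oo%E ->
      ('N[lebesgue_Rd R d]_+oo[EFin \o (g \- f)%R] < e%:E)%E -> M g).

Definition Linfty_functional (M : set (Rd R d -> R)) (X : (Rd R d -> R) -> R) :=
  forall f g, M f -> M g ->
    {ae lebesgue_Rd R d, forall y, f y = g y} -> X f = X g.

Definition is_fct_derivative (X : (Rd R d -> R) -> R) (G : Rd R d -> Omega -> R) :=
  [/\ measurable_fun [set: Rd R d * Omega] (fun q => G q.1 q.2),
      forall r : R, (\int[P]_w
        (\int[lebesgue_Rd R d]_(y in eball origin r) `|G y w|%:E) ^+ 2 < +oo)%E &
      forall B : Rd R d -> R, B \in Lfun (lebesgue_Rd R d) +oo%E ->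
        compactly_supported B ->
        {ae P, forall w,
          (fun t : R => (X (fun y => A y w + t * B y) - X (A ^~ w)) / t) @ 0^' -->
          (\int[lebesgue_Rd R d]_y (B y * G y w))%R}].

(* X is the extension of the random variable w |-> X (A ^~ w), and G is its
   functional derivative. *)
Definition fct_observable (M : set (Rd R d -> R)) (X : (Rd R d -> R) -> R)
    (G : Rd R d -> Omega -> R) :=
  [/\ Linfty_functional M X,
      field_measurable setT (fun w => X (A ^~ w)) &
      is_fct_derivative X G].

Definition fct_field (G : Rd R d -> Omega -> R) (r : R) (x : Rd R d)
    (w : Omega) : \bar R :=
  (\int[lebesgue_Rd R d]_(y in eball x r) `|G y w|%:E)%E.

(* Ent[Y] for Y >= 0 integrable; ln 0 = 0 implements 0 * log 0 = 0. *)
Definition entropy (Y : Omega -> R) : \bar R :=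
  ('E_P[fun w => (Y w * ln (Y w / fine 'E_P[Y]%E))%R])%E.

Definition multiscale (weight : R -> R) (D : R -> Rd R d -> Omega -> \bar R)
    (w : Omega) : \bar R :=
  (\int[lebesgue_measure]_(l in `[0%R, +oo[)
    ((\int[lebesgue_Rd R d]_x (D (l + 1)%R x w) ^+ 2) *
     ((l + 1) ^- d * weight l)%:E))%E.

Definition multiscale_pow (p : R) (weight : R -> R)
    (D : R -> Rd R d -> Omega -> \bar R) (w : Omega) : \bar R :=
  (\int[lebesgue_measure]_(l in `[0%R, +oo[)
    ((\int[lebesgue_Rd R d]_x (D (2 * (l + 1))%R x w) ^+ 2) `^ p *
     ((l + 1) `^ (- (d%:R * p)) * weight l)%:E))%E.

Definition osc_MSG (weight : R -> R) :=
  forall X : Omega -> R, field_measurable setT X ->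
  forall D, is_osc_field X D ->
    ('V_P[X] <= \int[P]_w multiscale weight D w)%E.

Definition fct_MSG (M : set (Rd R d -> R)) (weight : R -> R) :=
  forall X G, fct_observable M X G ->
    ('V_P[fun w => X (A ^~ w)] <=
     \int[P]_w multiscale weight (fct_field G) w)%E.

Definition fct_MLSI (M : set (Rd R d -> R)) (weight : R -> R) :=
  forall Z G, fct_observable M Z G ->
    ('E_P[fun w => (Z (A ^~ w) ^+ 2)%R] < +oo)%E ->
    (entropy (fun w => (Z (A ^~ w) ^+ 2)%R) <=
     \int[P]_w multiscale weight (fct_field G) w)%E.

(* The centered absolute moment E[|X - E[X]|^q]; it is +oo whenever X is not
   integrable, whatever the value of fine 'E_P[X]. *)
Definition centered_moment (q : R) (X : Omega -> R) : \bar R :=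
  ('E_P[fun w => (`|X w - fine 'E_P[X]%E| `^ q)%R])%E.

End random_field.

(* Main.v *)
Require Import Defs.
From HB Require Import structures.
From mathcomp Require Import all_boot all_order all_algebra.
From mathcomp Require Import all_classical all_reals all_analysis.
From mathcomp Require Import measurable_realfun ess_sup_inf.
From mathcomp Require Import ring lra.
(* MathComp-Analysis has its own [edist], which must be shadowed. *)
Import Defs.

Set Implicit Arguments.
Unset Strict Implicit.
Unset Printing Implicit Defensive.

Import Order.TTheory GRing.Theory Num.Theory.
Import numFieldNormedType.Exports.

Local Open Scope classical_set_scope.
Local Open Scope ring_scope.

(** For [e > 0] let [U = sqtrunc e (X - E X)], a bounded smooth truncation of
[(X - E X) ^+ 2]; the functional inequality is applied to [U `^ (p / 2)] and then
[e] tends to [0].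

For the functional derivative, the chain rule turns the right-hand side into
[p ^+ 2 * E (U `^ (p - 1) * S)], where [S] is the square function of [X]; Young's
inequality absorbs [E (U `^ p)], and the remaining term [(E (U `^ (p / 2))) ^+ 2]
is at most [E U * E (U `^ (p - 1))] by Cauchy-Schwarz, hence is again absorbed. Under the
logarithmic Sobolev inequality, the derivative of the [L^s] norm of [U] with
respect to [s] is an entropy, and it is bounded by the [L^p] norm of [S].

The oscillation satisfies no chain rule, but on a set where [X] oscillates by [D]
the power [U `^ (p / 2)] oscillates by at most
[2 * p * (U `^ (1 / 2) + 2 * D) `^ (p - 1) * D]. This creates the additional term
[D `^ (2 * p)]: one factor [D ^+ 2] is kept, and the others are replaced by an
average, because [B(x, l + 1)] is contained in [B(y, 2 (l + 1))] for every [y] in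
[B(x, l + 1)]. This is why the radius doubles. *)

(** * Truncated powers *)

(** Absorbing E (U ^ p) means subtracting it from both sides, which requires it to be finite: hence
    a bounded U. The bound U >= e > 0 makes U ^ (p / 2) differentiable for every real p >= 1, and ln
    U bounded. No induction on the moments is needed: writing U ^ (p / 2) as the square root of U ^
    (p - 1) U leaves only the first moment of U, at most e + Var X, which the spectral gap for X
    itself controls. The factor p ^ 2 is the square of the p produced by the Lipschitz constant of U
    ^ (p / 2). Under the logarithmic Sobolev inequality, the L^s norm of U has slope at most the L^p
    norm of S for 1 <= s <= p, whence p in place of p ^ 2. Two obstacles shape the oscillation part.
    The spectral gap is stated for a jointly measurable version of the oscillation, so one must be
    constructed for the truncated power before the hypothesis applies. Moreover each oscillation is
    known only up to a null set depending on the ball: a comparison is proved almost surely at fixed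
    radius and centre, then Tonelli makes it hold almost surely for almost all radii and centres at
    once. *)

Lemma eq_is_derive {R : realType} (f g : R -> R) (x df dg : R) :
  is_derive x 1 f df -> f =1 g -> df = dg -> is_derive x 1 g dg.
Proof. by move=> + /funext <- <-. Qed.

Section smooth_truncation.
Context {R : realType}.
Implicit Types e p x y : R.

(* A bounded C^1 function, bounded away from 0, tending to x ^+ 2 as e --> 0 and
   whose square root is 1-Lipschitz. *)
Definition sqtrunc e x := e + x ^+ 2 / (1 + e * x ^+ 2).

Definition dsqtrunc e x := 2 * x / (1 + e * x ^+ 2) ^+ 2.

Let den_ge1 e x : 0 < e -> 1 <= 1 + e * x ^+ 2.
Proof. by move=> e0; rewrite lerDl mulr_ge0 ?sqr_ge0// ltW. Qed.

Let den_gt0 e x : 0 < e -> 0 < 1 + e * x ^+ 2.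
Proof. by move=> e0; rewrite (lt_le_trans _ (den_ge1 x e0)). Qed.

Lemma sqtrunc_ge e x : 0 < e -> e <= sqtrunc e x.
Proof. by move=> e0; rewrite lerDl divr_ge0 ?sqr_ge0// ltW ?den_gt0. Qed.

Lemma sqtrunc_gt0 e x : 0 < e -> 0 < sqtrunc e x.
Proof. by move=> e0; rewrite (lt_le_trans e0)// sqtrunc_ge. Qed.

Lemma sqtrunc_le e x : 0 < e -> sqtrunc e x <= e + x ^+ 2.
Proof.
move=> e0; rewrite lerD2l ler_pdivrMr ?den_gt0//.
by rewrite ler_peMr ?sqr_ge0// den_ge1.
Qed.

Lemma sqtrunc_ub e x : 0 < e -> sqtrunc e x <= e + e^-1.
Proof.
move=> e0; rewrite lerD2l ler_pdivrMr ?den_gt0//.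
by rewrite mulrDr mulr1 mulKf ?gt_eqF// lerDr invr_ge0 ltW.
Qed.

Lemma is_derive_sqtrunc e x : 0 < e ->
  is_derive x 1 (sqtrunc e) (dsqtrunc e x).
Proof.
move=> e0; have d0 : 1 + e * x ^+ 2 != 0 by rewrite gt_eqF// den_gt0.
rewrite /sqtrunc /dsqtrunc.
have dX : is_derive x 1 (fun y : R => y ^+ 2) (2 * x).
  apply: eq_is_derive (is_deriveX 2 (is_derive_id x 1)) _ _ => //.
  by rewrite /GRing.scale/= expr1 mulr1.
have dd : is_derive x 1 (fun y => 1 + e * y ^+ 2) (e * (2 * x)).
  apply: eq_is_derive (is_deriveD (is_derive_cst (1 : R) x 1) (is_deriveZ e dX)) _ _ => //.
  by rewrite add0r.
have H1 := @is_deriveV _ (fun y => 1 + e * y ^+ 2) x _ 1 d0 dd.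
have H2 := is_deriveM dX H1.
have H := is_deriveD (is_derive_cst e x 1) H2.
apply: eq_is_derive H _ _ => //.
by rewrite /GRing.scale/=; field.
Qed.

(** This is the 1-Lipschitz bound on the square root of U, in squared form: its derivative is U' /
    (2 sqrt U). With D = 1 + e x ^ 2 >= 1, the square of U' is 4 (x ^ 2 / D) / D ^ 3, and x ^ 2 / D
    <= U. *)
Lemma dsqtrunc_sqr_le e x : 0 < e -> dsqtrunc e x ^+ 2 <= 4 * sqtrunc e x.
Proof.
move=> e0; have d0 := den_gt0 x e0; have d1 := den_ge1 x e0.
set D := 1 + _ in d0 d1 *.
have -> : dsqtrunc e x ^+ 2 = 4 * (x ^+ 2 / D) * D^-1 ^+ 3.
  by rewrite /dsqtrunc -/D; field; rewrite gt_eqF.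
rewrite (@le_trans _ _ (4 * (x ^+ 2 / D)))//.
  apply: ler_piMr; first by rewrite mulr_ge0// divr_ge0 ?sqr_ge0// ltW.
  by apply: exprn_ile1; rewrite ?invr_ge0 ?(ltW d0)// invf_le1.
by rewrite ler_pM2l// lerDr ltW.
Qed.

Lemma le_sqtrunc e x y : 0 < e -> `|x| <= `|y| -> sqtrunc e x <= sqtrunc e y.
Proof.
move=> e0; rewrite -ler_sqr ?nnegrE// !real_normK ?num_real// => xy.
rewrite lerD2l ler_pdivrMr ?den_gt0// mulrAC ler_pdivlMr ?den_gt0//.
by rewrite !mulrDr !mulr1 (mulrCA (y ^+ 2)) (mulrCA (x ^+ 2)) (mulrC (x ^+ 2)) lerD2r.
Qed.

Lemma measurable_sqtrunc e : 0 < e -> measurable_fun setT (sqtrunc e).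
Proof.
move=> e0; apply: continuous_measurable_fun => x.
apply: differentiable_continuous; apply/derivable1_diffP.
exact: (@ex_derive _ _ _ _ _ _ _ (is_derive_sqtrunc x e0)).
Qed.

End smooth_truncation.

Section powers_of_the_truncation.
Context {R : realType}.
Implicit Types e p x y a b : R.

Definition powtrunc e p x := sqtrunc e x `^ (p / 2).

Definition dpowtrunc e p x :=
  p / 2 * sqtrunc e x `^ (p / 2 - 1) * dsqtrunc e x.

Lemma is_derive_powtrunc e p x : 0 < e ->
  is_derive x 1 (powtrunc e p) (dpowtrunc e p x).
Proof.
move=> e0; have g0 := sqtrunc_gt0 x e0.
exact: is_derive1_comp (is_derive1_powR (p / 2) g0) (is_derive_sqtrunc x e0).
Qed.

Lemma powtrunc_ge0 e p x : 0 <= powtrunc e p x.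
Proof. exact: powR_ge0. Qed.

Lemma powtrunc_sqr e p x : powtrunc e p x ^+ 2 = sqtrunc e x `^ p.
Proof. by rewrite -powR_mulrn ?powR_ge0// -powRrM divfK. Qed.

(** The chain rule gives (p / 2) ^ 2 U ^ (p - 2) U' ^ 2; by [dsqtrunc_sqr_le] the last factor is at
    most 4 U, and the 4 cancels. *)
Lemma dpowtrunc_sqr_le e p x : 0 < e ->
  dpowtrunc e p x ^+ 2 <= p ^+ 2 * sqtrunc e x `^ (p - 1).
Proof.
move=> e0; have g0 := sqtrunc_gt0 x e0.
rewrite /dpowtrunc exprMn (exprMn _ (p / 2)) -(powR_mulrn 2 (powR_ge0 _ _)) -powRrM.
have -> : sqtrunc e x `^ ((p / 2 - 1) * 2) =
    sqtrunc e x `^ (p - 1) * (sqtrunc e x)^-1.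
  rewrite -(powR_inv1 (ltW g0)) -powRD ?(gt_eqF g0) ?implybT//.
  by congr (_ `^ _); field.
have := dsqtrunc_sqr_le x e0; rewrite -ler_pdivrMr// => h.
apply: (@le_trans _ _ (p ^+ 2 * sqtrunc e x `^ (p - 1) *
   (4^-1 * (dsqtrunc e x ^+ 2 / sqtrunc e x)))).
  by rewrite le_eqVlt; apply/orP; left; apply/eqP; field; rewrite gt_eqF.
apply: ler_piMr; first by rewrite mulr_ge0 ?sqr_ge0 ?powR_ge0.
by rewrite mulrC ler_pdivrMr// mul1r.
Qed.

(** Mean value theorem. The intermediate point c is no farther from 0 than one of the ends (the
    right one if c >= 0, the left one otherwise), and [sqtrunc] is nondecreasing in the absolute
    value. *)
Lemma powtrunc_lipschitz e p a b : 0 < e -> 1 <= p ->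
  `|powtrunc e p a - powtrunc e p b| <=
  p * Num.max (sqtrunc e a) (sqtrunc e b) `^ ((p - 1) / 2) * `|a - b|.
Proof.
move=> e0 p1; wlog ba : a b / b <= a.
  move=> H; have [/H//|/ltW/H] := leP b a.
  by rewrite distrC maxC (distrC b).
have [c| |c /[!in_itv]/= /andP[bc ca] ->] :=
    @MVT_segment R (powtrunc e p) (dpowtrunc e p) b a ba.
- by move=> _; exact: is_derive_powtrunc.
- apply: continuous_subspaceT => x.
  apply: differentiable_continuous; apply/derivable1_diffP.
  exact: (@ex_derive _ _ _ _ _ _ _ (is_derive_powtrunc p x e0)).
rewrite normrM ler_wpM2r//.
have g0 := sqtrunc_gt0 c e0.
have M0 : 0 <= Num.max (sqtrunc e a) (sqtrunc e b).
  by rewrite le_max ltW// sqtrunc_gt0.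
rewrite -ler_sqr ?nnegrE ?mulr_ge0 ?powR_ge0// ?(le_trans _ p1)//.
rewrite real_normK ?num_real// (le_trans (dpowtrunc_sqr_le p c e0))//.
rewrite exprMn -(powR_mulrn 2 (powR_ge0 _ _)) -powRrM divfK//.
rewrite ler_wpM2l ?sqr_ge0//.
apply: ge0_ler_powR; rewrite ?nnegrE ?subr_ge0// ?(ltW g0)//.
have [|] := leP 0 c => c0.
  by rewrite le_max le_sqtrunc// !ger0_norm// (le_trans c0).
by rewrite le_max [X in _ || X]le_sqtrunc ?orbT// !ltr0_norm ?lerN2// (le_lt_trans bc).
Qed.

Lemma measurable_powtrunc e p : 0 < e -> measurable_fun setT (powtrunc e p).
Proof.
move=> e0; apply: (measurableT_comp (measurable_powR _)).
exact: measurable_sqtrunc.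
Qed.

Lemma measurable_dpowtrunc e p : 0 < e -> measurable_fun setT (dpowtrunc e p).
Proof.
move=> e0; apply: measurable_funM.
  apply: measurable_funM => //.
  apply: (measurableT_comp (measurable_powR _)).
  exact: measurable_sqtrunc.
(* The inverse square is turned into a real power so that [measurable_powR] applies. *)
have -> : dsqtrunc e = fun x => 2 * x * (1 + e * x ^+ 2) `^ (- 2%:R).
  apply/funext => x; rewrite powR_invn// addr_ge0// mulr_ge0 ?sqr_ge0//.
  exact: ltW.
apply: measurable_funM; first exact: measurable_funM.
apply: (measurableT_comp (measurable_powR _)).
by apply: measurable_funD => //; apply: measurable_funM => //; exact: exprn_measurable.
Qed.

Lemma sqtrunc_cvg x :
  sqtrunc (n.+1%:R^-1) x @[n --> \oo] --> x ^+ 2.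
Proof.
have h : n.+1%:R^-1 @[n --> \oo] --> (0 : R) by exact: cvg_harmonic.
rewrite (_ : x ^+ 2 = 0 + x ^+ 2 / (1 + 0 * x ^+ 2)); last first.
  by rewrite mul0r addr0 divr1 add0r.
apply: cvgD => //; apply: cvgM; first exact: cvg_cst.
apply: cvgV; first by rewrite mul0r addr0 oner_eq0.
by apply: cvgD; [exact: cvg_cst|apply: cvgM => //; exact: cvg_cst].
Qed.

End powers_of_the_truncation.

(** * Young's inequality and powers of sums *)

Section pointwise_inequalities.
Context {R : realType}.
Implicit Types p u w b : R.

(** Young's inequality with conjugate exponents p / (p - 1) and p. At p = 1 the first exponent is
    infinite, but both sides reduce to w. *)
Lemma young_powR p u w : 1 <= p -> 0 <= u -> 0 <= w ->
  u `^ (p - 1) * w <= (1 - p^-1) * u `^ p + p^-1 * w `^ p.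
Proof.
move=> p1 u0 w0; have p0 : 0 < p by rewrite (lt_le_trans ltr01).
move: p1; rewrite le_eqVlt => /predU1P[<-|p1].
  by rewrite !subrr powRr0 invr1 subrr mul0r add0r !mul1r powRr1.
have pn0 : p - 1 != 0 by rewrite subr_eq0 gt_eqF.
have q0 : 0 < p / (p - 1) by rewrite divr_gt0// subr_gt0.
have := @conjugate_powR _ (u `^ (p - 1)) w (p / (p - 1)) p
   (powR_ge0 _ _) w0 q0 p0.
rewrite -powRrM mulrCA divff// mulr1 => /(_ _)/le_trans; apply.
  by field; rewrite pn0 gt_eqF.
rewrite le_eqVlt; apply/orP; left; apply/eqP; field.
by rewrite pn0 gt_eqF.
Qed.

Lemma powRD_le p u w : 0 <= p -> 0 <= u -> 0 <= w ->
  (u + w) `^ p <= 2 `^ p * (u `^ p + w `^ p).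
Proof.
move=> p0 u0 w0; wlog uw : u w u0 w0 / u <= w.
  move=> H; have [/H|/ltW/H] := leP u w; first exact.
  by rewrite addrC [X in _ * X]addrC; exact.
rewrite (@le_trans _ _ ((2 * w) `^ p))//.
  by rewrite ge0_ler_powR ?nnegrE ?addr_ge0 ?mulr_ge0//; lra.
by rewrite powRM// ler_wpM2l ?powR_ge0// lerDr powR_ge0.
Qed.

(* Compare u with p b: if u is the larger one then (1 + 2 / p) `^ (2 p - 2) is
   at most e^4, otherwise u + 2 b <= 3 p b. *)
Lemma powRD_split p u b : 1 <= p -> 0 <= u -> 0 <= b ->
  (2 * p * (u + 2 * b) `^ (p - 1) * b) ^+ 2 <=
  4 * expR 4 * p ^+ 2 * (u ^+ 2) `^ (p - 1) * b ^+ 2 +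
  (9 * p ^+ 2) `^ p * (b ^+ 2) `^ p.
Proof.
move=> p1 u0 b0; have p0 : 0 < p by rewrite (lt_le_trans ltr01).
have sqrP x : 0 <= x -> (x `^ (p - 1)) ^+ 2 = (x ^+ 2) `^ (p - 1).
  by move=> x0; rewrite expr2 -powRM// -expr2.
have [ub|bu] := leP (p * b) u.
  apply: ler_wpDr; first by rewrite mulr_ge0 ?powR_ge0.
  have h : u + 2 * b <= u * (1 + 2 / p).
    rewrite mulrDr mulr1 lerD2l mulrCA ler_wpM2l// ler_pdivlMr// mulrC//.
  apply: (@le_trans _ _ ((2 * p * (u * (1 + 2 / p)) `^ (p - 1) * b) ^+ 2)).
    rewrite ler_sqr ?nnegrE ?mulr_ge0 ?powR_ge0 ?(ltW p0)//.
    rewrite ler_wpM2r// ler_wpM2l ?mulr_ge0 ?(ltW p0)//.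
    apply: ge0_ler_powR => //; rewrite ?nnegrE ?subr_ge0//.
      by rewrite addr_ge0// mulr_ge0.
    by rewrite mulr_ge0// addr_ge0// divr_ge0// ltW.
  rewrite !exprMn sqrP ?mulr_ge0 ?addr_ge0 ?divr_ge0 ?(ltW p0)//.
  rewrite exprMn powRM ?sqr_ge0//.
  (* Since 1 + 2 / p <= exp (2 / p), the exponent of the exponential is at most 4 (1 - 1 / p). *)
  have k : ((1 + 2 / p) ^+ 2) `^ (p - 1) <= expR 4.
    apply: (@le_trans _ _ ((expR (2 / p) ^+ 2) `^ (p - 1))).
      apply: ge0_ler_powR; rewrite ?nnegrE ?subr_ge0 ?sqr_ge0//.
      by rewrite ler_sqr ?nnegrE ?expR_ge0 ?expR_ge1Dx// addr_ge0// divr_ge0// ltW.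
    rewrite -expRM_natl -expRM ler_expR.
    have -> : 2%:R * (2 / p) * (p - 1) = 4 * (1 - p^-1).
      by field; rewrite gt_eqF.
    by rewrite ler_piMr// lerBlDr lerDl invr_ge0 ltW.
  set v := (u ^+ 2) `^ (p - 1); set z := ((1 + 2 / p) ^+ 2) `^ (p - 1) in k *.
  rewrite [leRHS](_ : _ = 4 * p ^+ 2 * v * b ^+ 2 * expR 4); last by ring.
  rewrite [leLHS](_ : _ = 4 * p ^+ 2 * v * b ^+ 2 * z); last by ring.
  have v0 : 0 <= v := powR_ge0 _ _.
  by rewrite ler_wpM2l// !mulr_ge0 ?(ltW p0).
apply: ler_wpDl; first by rewrite !mulr_ge0 ?powR_ge0 ?(ltW p0) ?expR_ge0.
(* The leading 2 is enlarged to 3 so that the product is exactly the p-th power of 3 p b, whose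
   square is the last term of the statement. *)
apply: (@le_trans _ _ ((3 * p * b * (3 * p * b) `^ (p - 1)) ^+ 2)).
  rewrite ler_sqr ?nnegrE ?mulr_ge0 ?powR_ge0 ?(ltW p0)//.
  rewrite mulrAC ler_pM ?mulr_ge0 ?powR_ge0 ?(ltW p0)//.
    by rewrite ler_wpM2r// ler_wpM2r ?(ltW p0)// ler_nat.
  apply: ge0_ler_powR; rewrite ?nnegrE ?subr_ge0 ?mulr_ge0 ?addr_ge0 ?(ltW p0)//.
    by rewrite mulr_ge0.
  have : b <= p * b by rewrite ler_peMl.
  nra.
rewrite mulr_powRB1 ?mulr_ge0 ?(ltW p0)// expr2 -powRM ?mulr_ge0 ?(ltW p0)//.
rewrite -powRM ?mulr_ge0 ?(ltW p0)// le_eqVlt; apply/orP; left; apply/eqP.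
by congr (_ `^ _); ring.
Qed.

End pointwise_inequalities.

(** * Almost everywhere statements and Jensen inequalities *)

Section almost_everywhere_on_products.
Local Open Scope ereal_scope.
Context d1 d2 (T1 : measurableType d1) (T2 : measurableType d2) (R : realType).
Variable m1 : {sigma_finite_measure set T1 -> \bar R}.
Variable m2 : {sigma_finite_measure set T2 -> \bar R}.

Lemma ae_indic d (T : measurableType d) (mu : {measure set T -> \bar R})
    (N : set T) : measurable N ->
  {ae mu, forall x, N x} <-> \int[mu]_x (\1_(~` N) x)%:E = 0.
Proof.
move=> mN; rewrite integral_indic ?setIT//; last exact: measurableC.
split=> [[M [mM M0 NM]]|N0].
  by apply: (subset_measure0 _ mM NM) => //; exact: measurableC.
by exists (~` N); split => //; exact: measurableC.
Qed.

Variable N : set (T1 * T2).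
Hypothesis mN : measurable N.

Let f (z : T1 * T2) := (\1_(~` N) z : R)%:E.

Let mf : measurable_fun setT f.
Proof. by apply/measurable_EFinP; apply: measurable_indic; exact: measurableC. Qed.

Let f0 z : 0 <= f z. Proof. by rewrite lee_fin. Qed.

Let ae_section1 : {ae m1, forall x, {ae m2, forall y, N (x, y)}} <->
  \int[m1]_x \int[m2]_y f (x, y) = 0.
Proof.
have h x : {ae m2, forall y, N (x, y)} <-> \int[m2]_y f (x, y) = 0.
  apply: (@ae_indic _ _ m2 (fun y => N (x, y))).
  by have := measurable_xsection x mN; rewrite xsectionE.
have F0 x : 0 <= \int[m2]_y f (x, y) by apply: integral_ge0.
have -> : \int[m1]_x \int[m2]_y f (x, y) =
    \int[m1]_x `|\int[m2]_y f (x, y)|.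
  by apply: eq_integral => x _; rewrite gee0_abs.
rewrite ae_eq_integral_abs//; last exact: measurable_fun_fubini_tonelli_F.
by split; apply: filterS => x; [move/h => + _|move/(_ I)/h].
Qed.

Let ae_section2 : {ae m2, forall y, {ae m1, forall x, N (x, y)}} <->
  \int[m2]_y \int[m1]_x f (x, y) = 0.
Proof.
have h y : {ae m1, forall x, N (x, y)} <-> \int[m1]_x f (x, y) = 0.
  apply: (@ae_indic _ _ m1 (fun x => N (x, y))).
  by have := measurable_ysection y mN; rewrite ysectionE.
have F0 y : 0 <= \int[m1]_x f (x, y) by apply: integral_ge0.
have -> : \int[m2]_y \int[m1]_x f (x, y) =
    \int[m2]_y `|\int[m1]_x f (x, y)|.
  by apply: eq_integral => x _; rewrite gee0_abs.
rewrite ae_eq_integral_abs//; last exact: measurable_fun_fubini_tonelli_G.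
by split; apply: filterS => x; [move/h => + _|move/(_ I)/h].
Qed.

(** Each side says that an iterated integral of the indicator of the complement of N vanishes;
    Tonelli's theorem equates the two integrals. *)
Lemma ae_swap : {ae m1, forall x, {ae m2, forall y, N (x, y)}} <->
  {ae m2, forall y, {ae m1, forall x, N (x, y)}}.
Proof. by rewrite ae_section1 ae_section2 fubini_tonelli. Qed.

(** The set is the zero set of the measure of the section of the complement of N, which is
    measurable in x. *)
Lemma measurable_ae : measurable [set x | {ae m2, forall y, N (x, y)}].
Proof.
have mF : measurable_fun setT (fun x => \int[m2]_y f (x, y)).
  exact: measurable_fun_fubini_tonelli_F.
rewrite (_ : [set x | _] = (fun x => \int[m2]_y f (x, y)) @^-1` [set 0]).
  by rewrite -[X in measurable X]setTI; apply: mF => //; exact: emeasurable_set1.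
apply/seteqP; split=> x /=;
  (have := measurable_xsection x mN; rewrite xsectionE => mNx);
  by move/(@ae_indic _ _ m2 (fun y => N (x, y)) mNx).
Qed.

End almost_everywhere_on_products.

Section almost_everywhere_on_triple_products.
Context d1 d2 d3 (T1 : measurableType d1) (T2 : measurableType d2)
  (T3 : measurableType d3) (R : realType).
Variable m1 : {sigma_finite_measure set T1 -> \bar R}.
Variable m2 : {sigma_finite_measure set T2 -> \bar R}.
Variable m3 : {sigma_finite_measure set T3 -> \bar R}.
Variable N : set (T1 * T2 * T3).
Hypothesis mN : measurable N.

Let measurable_N2 y : measurable [set z : T1 * T3 | N (z.1, y, z.2)].
Proof.
rewrite -[X in measurable X]setTI.
apply: (_ : measurable_fun setT (fun z : T1 * T3 => (z.1, y, z.2))) => //.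
by apply: measurable_fun_pair => //; exact: measurable_fun_pair.
Qed.

(** Two exchanges of quantifiers; the outer one needs [measurable_ae] for the set defined by the
    inner one. It serves both to make exceptional null sets of Omega independent of radius and
    centre, and to make exceptional radii independent of centre and outcome. *)
Lemma ae_rotate : {ae m2, forall y, {ae m3, forall z, {ae m1, forall x, N (x, y, z)}}} <->
  {ae m1, forall x, {ae m2, forall y, {ae m3, forall z, N (x, y, z)}}}.
Proof.
have mE := measurable_ae m3 mN.
have sw y : {ae m3, forall z, {ae m1, forall x, N (x, y, z)}} <->
    {ae m1, forall x, {ae m3, forall z, N (x, y, z)}}.
  by have := ae_swap m1 m3 (measurable_N2 y) => /= h; rewrite h.
have := ae_swap m1 m2 mE => /= h.
by split=> [H|/h H]; [apply/h|]; apply: filterS H => y /sw.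
Qed.

End almost_everywhere_on_triple_products.

Section ereal_power_inequalities.
Local Open Scope ereal_scope.
Context {R : realType}.

Lemma young_poweR (p u : R) (w : \bar R) : (1 <= p)%R -> (0 <= u)%R -> 0 <= w ->
  (u `^ (p - 1))%:E * w <=
  ((1 - p^-1) * u `^ p)%:E + p^-1%:E * w `^ p.
Proof.
move=> p1 u0; have p0 : (0 < p)%R by rewrite (lt_le_trans ltr01).
case: w => [w w0|_|//]; first by rewrite poweR_EFin lee_fin young_powR.
by rewrite poweRyr ?gt_eqF// (@gt0_muley _ p^-1%:E) ?lte_fin ?invr_gt0// addey// leey.
Qed.

Lemma poweRD_le (p : R) (u w : \bar R) : (0 < p)%R -> 0 <= u -> 0 <= w ->
  (u + w) `^ p <= (2 `^ p)%:E * (u `^ p + w `^ p).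
Proof.
move=> p0; have p0' : p != 0%R by rewrite gt_eqF.
have c0 : 0 < (2 `^ p)%R%:E :> \bar R by rewrite lte_fin powR_gt0.
case: u w => [u| |//] [w| |//] u0 w0.
- by rewrite -EFinD !poweR_EFin -EFinD -EFinM lee_fin powRD_le// ltW.
- by rewrite !poweRyr// poweR_EFin addey// gt0_muley// leey.
- by rewrite !poweRyr// poweR_EFin addye// gt0_muley// leey.
- by rewrite !poweRyr// addye// gt0_muley// leey.
Qed.

Lemma le_poweR (p : R) (u w : \bar R) : (0 <= p)%R -> 0 <= u -> u <= w ->
  u `^ p <= w `^ p.
Proof.
move=> p0 u0 uw; apply: gt0_ler_poweR => //; rewrite in_itv/= leey andbT//.
exact: le_trans uw.
Qed.

End ereal_power_inequalities.

Section weighted_jensen.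
Local Open Scope ereal_scope.
Context d (T : measurableType d) (R : realType).
Variables (mu : {measure set T -> \bar R}) (D : set T) (mD : measurable D).
Variables (a : T -> \bar R) (w : T -> R) (p : R).
Hypotheses (p1 : (1 <= p)%R).
Hypotheses (ma : measurable_fun D a) (a0 : forall x, D x -> 0 <= a x).
Hypotheses (mw : measurable_fun D w) (w0 : forall x, D x -> (0 <= w x)%R).
Variable W : R.
Hypothesis intw : \int[mu]_(x in D) (w x)%:E = W%:E.

(** Jensen's inequality for the measure with density [w] and mass W. Let A and J be the integrals of
    a w and a ^ p w. Young's inequality with a free parameter t integrates to t ^ (p - 1) A <= (1 -
    1 / p) t ^ p W + J / p. The choice t = 1 shows that A is finite when J is; then t = A / W, the
    mean of [a], is optimal. If W = 0, the density vanishes almost everywhere. *)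
Lemma weighted_jensen :
  (\int[mu]_(x in D) (a x * (w x)%:E)) `^ p <=
  (W `^ (p - 1))%:E * \int[mu]_(x in D) ((a x) `^ p * (w x)%:E).
Proof.
have p0 : (0 < p)%R by rewrite (lt_le_trans ltr01).
have mwE : measurable_fun D (EFin \o w) by exact/measurable_EFinP.
have mapw : measurable_fun D (fun x => a x `^ p * (w x)%:E).
  by apply: emeasurable_funM => //; exact: (measurableT_comp (measurable_poweR p)).
have apw0 x : D x -> 0 <= a x `^ p * (w x)%:E.
  by move=> Dx; rewrite mule_ge0 ?poweR_ge0// lee_fin w0.
have aw0 x : D x -> 0 <= a x * (w x)%:E.
  by move=> Dx; rewrite mule_ge0 ?a0// lee_fin w0.
have W0 : (0 <= W)%R.
  by rewrite -lee_fin -intw integral_ge0// => x Dx; rewrite lee_fin w0.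
set J := \int[mu]_(x in D) (_ `^ p * _).
have J0 : 0 <= J by apply: integral_ge0.
set A := \int[mu]_(x in D) (a x * _).
have A0 : 0 <= A by apply: integral_ge0.
have young (t : R) : (0 < t)%R ->
    (t `^ (p - 1))%:E * A <= ((1 - p^-1) * t `^ p * W)%:E + p^-1%:E * J.
  move=> t0; rewrite EFinM -intw.
  have c0 : (0 <= (1 - p^-1) * t `^ p)%R.
    by rewrite mulr_ge0 ?powR_ge0// subr_ge0 invf_le1.
  have Z (k : R) g : (0 <= k)%R -> measurable_fun D g ->
      (forall x, D x -> 0 <= g x) ->
      k%:E * \int[mu]_(x in D) g x = \int[mu]_(x in D) (k%:E * g x).
    by move=> k0 mg g0; rewrite ge0_integralZl// lee_fin.
  have pV0 : (0 <= p^-1)%R by rewrite invr_ge0 ltW.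
  have maw : measurable_fun D (fun x => a x * (w x)%:E) by exact: emeasurable_funM.
  have zm (k : R) g : measurable_fun D g ->
    measurable_fun D (fun x => k%:E * g x) by move=> ?; exact: emeasurable_funM.
  have zp (k : R) g : (0 <= k)%R -> (forall x, D x -> 0 <= g x) ->
    forall x, D x -> 0 <= k%:E * g x by move=> k0 g0 x Dx; rewrite mule_ge0// g0.
  have wE0 x : D x -> 0 <= (w x)%:E by move=> /w0; rewrite lee_fin.
  rewrite !Z ?powR_ge0// -ge0_integralD//; last 4 first.
  - exact: zp.
  - exact: zm.
  - exact: zp.
  - exact: zm.
  apply: ge0_le_integral => //.
  - by apply: zp => //; exact: powR_ge0.
  - exact: zm.
  - by apply: emeasurable_funD; exact: zm.
  move=> x Dx; rewrite !muleA -ge0_muleDl ?lee_fin// ?mule_ge0 ?poweR_ge0//.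
  by rewrite lee_wpmul2r ?lee_fin ?w0// young_poweR ?a0// ltW.
have [W_eq0|W_gt0] := eqVneq W 0%R.
  have aw_ae : A = 0.
    have : {ae mu, forall x, D x -> (w x)%:E = 0}.
      have : \int[mu]_(x in D) `|(w x)%:E| = 0.
        rewrite -[RHS]/(0%R%:E) -W_eq0 -intw; apply: eq_integral => x /[!inE] Dx.
        by rewrite gee0_abs// lee_fin w0.
      by move/(ae_eq_integral_abs mu mD mwE).
    move=> h; rewrite /A (ae_eq_integral (cst 0)) ?integral0//.
      exact: emeasurable_funM.
    by apply: filterS h => x + Dx => /(_ Dx) ->; rewrite mule0.
  by rewrite aw_ae poweR0r ?gt_eqF// mule_ge0// lee_fin powR_ge0.
have {}W_gt0 : (0 < W)%R by rewrite lt0r W_gt0.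
have c0 : 0 < (W `^ (p - 1))%:E by rewrite lte_fin powR_gt0.
have [->|] := eqVneq J +oo; first by rewrite gt0_muley// leey.
rewrite -ltey => Joo; have Jfin : J \is a fin_num by rewrite ge0_fin_numE.
have Afin : A \is a fin_num.
  have := young _ ltr01; rewrite powR1 mul1e => /le_lt_trans h.
  by rewrite ge0_fin_numE//; apply: h; rewrite lte_add_pinfty ?ltry// lte_mul_pinfty ?lee_fin ?invr_ge0 ?(ltW p0).
rewrite -(fineK Afin) -(fineK Jfin) poweR_EFin -EFinM lee_fin.
have : (0 <= fine A)%R by rewrite fine_ge0.
rewrite le_eqVlt => /predU1P[<-|A_gt0].
  by rewrite powR0 ?gt_eqF// mulr_ge0 ?powR_ge0 ?fine_ge0.
have t0 : (0 < fine A / W)%R by rewrite divr_gt0.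
have := young _ t0; rewrite -(fineK Afin) -(fineK Jfin) -!EFinM -EFinD lee_fin.
have -> : ((1 - p^-1) * (fine A / W) `^ p * W =
    (1 - p^-1) * ((fine A / W) `^ (p - 1) * fine A))%R.
  by rewrite -(mulr_powRB1 (ltW t0) p0); field; rewrite !gt_eqF.
move: (fine A) (fine J) A_gt0 t0 => {Afin Jfin A0 A} A {Joo young J0 J} J A0 t0.
set c := (_ `^ (p - 1))%R => h.
have {h} : (c * A <= J)%R.
  have pV0 : (0 < p^-1)%R by rewrite invr_gt0.
  by rewrite -(ler_pM2l pV0); lra.
have -> : (A `^ p = W `^ (p - 1) * (c * A))%R.
  rewrite mulrA /c -powRM ?(ltW W_gt0) ?(ltW t0)// mulrC.
  by rewrite (mulrC W) divfK ?gt_eqF// mulr_powRB1// ltW.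
by apply: ler_wpM2l; exact: powR_ge0.
Qed.

End weighted_jensen.

(** * Moments from a spectral gap *)

Section bounded_random_variables.
Local Open Scope ereal_scope.
Context d (T : measurableType d) (R : realType) (P : probability T R).
Implicit Types (f : T -> R) (c p : R).

Lemma bounded_RV_integrable f c : measurable_fun setT f ->
  (forall x, `|f x| <= c)%R -> P.-integrable setT (EFin \o f).
Proof.
move=> mf fc; apply: measurable_bounded_integrable => //.
  by rewrite -ge0_fin_numE// fin_num_measure.
by exists c; split; rewrite ?num_real// => y cy x _; exact: le_trans (fc x) (ltW cy).
Qed.

Lemma varianceE_int f : 'V_P[f] = \int[P]_x (((f x - fine 'E_P[f]) ^+ 2)%R)%:E.
Proof. by rewrite /variance covariance.unlock expectation.unlock; apply: eq_integral. Qed.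

Lemma EFin_Rintegral f : P.-integrable setT (EFin \o f) ->
  \int[P]_x (f x)%:E = (\int[P]_x f x)%R%:E.
Proof. by move=> intf; rewrite fineK//; exact: integrable_fin_num. Qed.

Lemma Rintegral_prob_cst (c : R) : (\int[P]_x c)%R = c.
Proof. by rewrite /Rintegral integral_cst//= probability_setT mule1. Qed.

Lemma variance_bounded f c : measurable_fun setT f ->
  (forall x, `|f x| <= c)%R ->
  'V_P[f] = (\int[P]_x (f x ^+ 2) - (\int[P]_x f x) ^+ 2)%R%:E.
Proof.
move=> mf fc.
have i1 := bounded_RV_integrable mf fc.
have i2 : P.-integrable setT (EFin \o (fun x => (f x ^+ 2)%R)).
  apply: (@bounded_RV_integrable _ (c ^+ 2)%R).
    exact: measurable_funX.
  by move=> x; rewrite normrX lerXn2r// nnegrE (le_trans _ (fc x)).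
rewrite varianceE_int expectation.unlock (EFin_Rintegral i1)/=.
set m := (\int[P]_x f x)%R.
have i3 : P.-integrable setT (EFin \o (fun x => - (2 * m) * f x)%R).
  by apply: eq_integrable (integrableZl measurableT (- (2 * m))%R i1).
have i4 : P.-integrable setT (EFin \o (fun=> (m ^+ 2)%R)).
  exact: (finite_measure_integrable_cst P (m ^+ 2)%R).
have i34 := integrableD measurableT i3 i4.
have i234 := integrableD measurableT i2 i34.
under eq_integral.
  move=> x _.
  rewrite (_ : (f x - m) ^+ 2 = f x ^+ 2 + (- (2 * m) * f x + m ^+ 2))%R; last by ring.
  over.
rewrite (EFin_Rintegral i234) (RintegralD measurableT i2 i34)//.
rewrite (RintegralD measurableT i3 i4)// (RintegralZl _ measurableT i1)//.
rewrite Rintegral_prob_cst -/m; congr EFin; ring.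
Qed.

(* Young's inequality with the optimal weight replaces Cauchy-Schwarz. *)
Lemma Rintegral_sqr_le (f g : T -> R) (c e : R) : (0 < e)%R ->
  measurable_fun setT f -> measurable_fun setT g ->
  (forall x, e <= f x <= c)%R -> (forall x, e <= g x <= c)%R ->
  ((\int[P]_x (Num.sqrt (f x * g x))) ^+ 2 <=
  (\int[P]_x f x) * (\int[P]_x g x))%R.
Proof.
move=> e0 mf mg fc gc.
have bnd (h : T -> R) : (forall x, e <= h x <= c)%R -> (forall x, `|h x| <= c)%R.
  by move=> hc x; have /andP[h0 h1] := hc x; rewrite ger0_norm// (le_trans _ h0)// ltW.
have intf := bounded_RV_integrable mf (bnd _ fc).
have intg := bounded_RV_integrable mg (bnd _ gc).
have int_e : P.-integrable setT (EFin \o (fun=> e)).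
  exact: (finite_measure_integrable_cst P e).
have pos (h : T -> R) : P.-integrable setT (EFin \o h) -> (forall x, e <= h x <= c)%R ->
    (0 < \int[P]_x h x)%R.
  move=> ih hc; apply: (lt_le_trans e0).
  have -> : e = (\int[P]_x e)%R by rewrite Rintegral_prob_cst.
  by apply: le_Rintegral => // x _; have /andP[] := hc x.
have a0 := pos _ intf fc; have b0 := pos _ intg gc.
set a := (\int[P]_x f x)%R in a0 *; set b := (\int[P]_x g x)%R in b0 *.
have fg0 x : (0 <= f x * g x)%R.
  have /andP[f0 _] := fc x; have /andP[g0 _] := gc x.
  by rewrite mulr_ge0// (le_trans (ltW e0)).
have ints : P.-integrable setT (EFin \o (fun x => Num.sqrt (f x * g x))).
  apply: (@bounded_RV_integrable _ c).
    apply: (eq_measurable_fun (fun x => (f x * g x) `^ 2^-1)%R).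
      by move=> x _; rewrite powR12_sqrt.
    apply: (measurableT_comp (measurable_powR _)); exact: measurable_funM.
  move=> x; have /andP[f0 f1] := fc x; have /andP[g0 g1] := gc x.
  have c0 : (0 <= c)%R by rewrite (le_trans _ f1)// (le_trans _ f0)// ltW.
  rewrite ger0_norm ?sqrtr_ge0// -(ger0_norm c0) -sqrtr_sqr ler_wsqrtr//.
  by rewrite expr2 ler_pM// ?(le_trans _ f0) ?(le_trans _ g0)// ltW.
have h (t : R) : (0 < t)%R ->
    (\int[P]_x (Num.sqrt (f x * g x)) <= 2^-1 * t * a + 2^-1 * t^-1 * b)%R.
  move=> t0; rewrite /a /b -!RintegralZl// -RintegralD//; last 2 first.
  - by apply: eq_integrable (integrableZl measurableT (2^-1 * t)%R intf).
  - by apply: eq_integrable (integrableZl measurableT (2^-1 * t^-1)%R intg).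
  apply: le_Rintegral => //.
    apply: eq_integrable (integrableD measurableT (integrableZl measurableT (2^-1 * t)%R intf) (integrableZl measurableT (2^-1 * t^-1)%R intg)) => //.
  move=> x _; have /andP[f0 _] := fc x; have /andP[g0 _] := gc x.
  have f0' := lt_le_trans e0 f0; have g0' := lt_le_trans e0 g0.
  rewrite -ler_sqr ?nnegrE ?sqrtr_ge0//; last first.
    by rewrite addr_ge0// !mulr_ge0 ?invr_ge0// ltW.
  rewrite sqr_sqrtr//.
  rewrite -subr_ge0 (_ : _ - _ = (2^-1 * (t * f x - t^-1 * g x)) ^+ 2)%R.
    by rewrite sqr_ge0.
  by field; rewrite gt_eqF.
(* This t minimizes the right-hand side of [h], where it equals the square root of a b. The lower
   bound e on both functions makes a and b positive. *)
have := h (Num.sqrt (b / a)).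
rewrite sqrtr_gt0 divr_gt0// => /(_ isT).
have a1 : (Num.sqrt a ^+ 2 = a)%R by rewrite sqr_sqrtr// ltW.
have b1 : (Num.sqrt b ^+ 2 = b)%R by rewrite sqr_sqrtr// ltW.
have sa : (Num.sqrt a != 0)%R by rewrite gt_eqF ?sqrtr_gt0.
have sb : (Num.sqrt b != 0)%R by rewrite gt_eqF ?sqrtr_gt0.
rewrite sqrtrM ?(ltW b0)// sqrtrV ?(ltW a0)//.
have E (s u : R) : (s != 0 -> u != 0 ->
    2^-1 * (u / s) * s ^+ 2 + 2^-1 * (u / s)^-1 * u ^+ 2 = s * u)%R.
  by move=> s0 u0; field; rewrite s0 u0.
have := E _ _ sa sb; rewrite a1 b1 => -> {}h.
rewrite -a1 -b1 -exprMn ler_sqr ?nnegrE ?mulr_ge0 ?sqrtr_ge0//.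
by apply: Rintegral_ge0 => x _; exact: sqrtr_ge0.
Qed.

End bounded_random_variables.

Section ge0_integral_linear_combination.
Local Open Scope ereal_scope.
Context d (T : measurableType d) (R : realType) (mu : {measure set T -> \bar R}).
Variables (D : set T) (mD : measurable D).
Implicit Types (f g : T -> \bar R) (a b : R).

Lemma ge0_integral_lin f g a b : (0 <= a)%R -> (0 <= b)%R ->
  measurable_fun D f -> measurable_fun D g ->
  (forall x, D x -> 0 <= f x) -> (forall x, D x -> 0 <= g x) ->
  \int[mu]_(x in D) (a%:E * f x + b%:E * g x) =
  a%:E * \int[mu]_(x in D) f x + b%:E * \int[mu]_(x in D) g x.
Proof.
move=> a0 b0 mf mg f0 g0.
have zm (k : R) h : measurable_fun D h ->
  measurable_fun D (fun x => k%:E * h x) by move=> ?; exact: emeasurable_funM.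
have zp (k : R) h : (0 <= k)%R -> (forall x, D x -> 0 <= h x) ->
  forall x, D x -> 0 <= k%:E * h x by move=> k0 h0 x Dx; rewrite mule_ge0// h0.
rewrite ge0_integralD//; [|exact: zp|exact: zm|exact: zp|exact: zm].
by rewrite !ge0_integralZl// lee_fin.
Qed.

End ge0_integral_linear_combination.

Section spectral_gap_moments.
Local Open Scope ereal_scope.
Context d (T : measurableType d) (R : realType) (P : probability T R).
Variables (U : T -> R) (e c p : R).
Hypotheses (e0 : (0 < e)%R) (mU : measurable_fun setT U).
Hypotheses (Uec : forall x, (e <= U x <= c)%R) (p1 : (1 <= p)%R).

Let p0 : (0 < p)%R. Proof. by rewrite (lt_le_trans ltr01). Qed.

Let U0 x : (0 < U x)%R.
Proof. by have /andP[] := Uec x => /(lt_le_trans e0). Qed.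

Lemma measurable_powRU (a : R) : measurable_fun setT (fun x => U x `^ a)%R.
Proof. exact: (measurableT_comp (measurable_powR _)). Qed.

Lemma powRU_bound (a : R) : (0 <= a)%R ->
  forall x, (e `^ a <= U x `^ a <= c `^ a)%R.
Proof.
move=> a0 x; have /andP[h1 h2] := Uec x.
by rewrite !ge0_ler_powR ?nnegrE// ?(ltW (U0 x)) ?(ltW e0)// (le_trans _ h2)// ltW.
Qed.

Lemma integrable_powRU (a : R) : (0 <= a)%R ->
  P.-integrable setT (EFin \o (fun x => U x `^ a)%R).
Proof.
move=> a0; apply: (@bounded_RV_integrable _ _ _ _ _ (c `^ a)%R).
  exact: measurable_powRU.
by move=> x; rewrite ger0_norm ?powR_ge0//; have /andP[] := powRU_bound a0 x.
Qed.

Lemma moment_le_variance :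
  \int[P]_x (U x `^ p)%:E <= 'V_P[fun x => (U x `^ (p / 2))%R] +
  ((\int[P]_x (U x `^ (p - 1))) * (\int[P]_x U x))%R%:E.
Proof.
rewrite (@variance_bounded _ _ _ P _ (c `^ (p / 2)))%R; last 2 first.
  exact: measurable_powRU.
  move=> x; rewrite ger0_norm ?powR_ge0//.
  by have /andP[] := powRU_bound (ltW (divr_gt0 p0 (ltr0n R 2))) x.
have p1' : (0 <= p - 1)%R by rewrite subr_ge0.
rewrite EFin_Rintegral; last exact/integrable_powRU/ltW.
rewrite -EFinD lee_fin.
have -> : (\int[P]_x (U x `^ (p / 2)) ^+ 2 = \int[P]_x (U x `^ p))%R.
  by apply: eq_Rintegral => x _; rewrite -powR_mulrn ?powR_ge0// -powRrM divfK.
rewrite -addrA lerDl addrC subr_ge0.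
(* [Rintegral_sqr_le] asks for the same two bounds on U ^ (p - 1) and on U. *)
pose e' := Num.min e (e `^ (p - 1))%R; pose c' := Num.max c (c `^ (p - 1))%R.
have e'0 : (0 < e')%R by rewrite lt_min e0 powR_gt0.
have := @Rintegral_sqr_le _ _ _ P (fun x => U x `^ (p - 1))%R U c' e' e'0.
have -> : (\int[P]_x Num.sqrt (U x `^ (p - 1) * U x) =
    \int[P]_x (U x `^ (p / 2)))%R.
  apply: eq_Rintegral => x _; rewrite mulrC mulr_powRB1 ?(ltW (U0 x))//.
  by rewrite -powR12_sqrt ?powR_ge0// -powRrM.
apply => //; first exact: measurable_powRU.
  move=> x; have /andP[h1 h2] := powRU_bound p1' x.
  by rewrite ge_min le_max h1 h2 !orbT.
move=> x; have /andP[h1 h2] := Uec x.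
by rewrite ge_min le_max h1 h2.
Qed.

Variables (S : T -> \bar R) (k b : R) (r : \bar R).
Hypotheses (mS : measurable_fun setT S) (S0 : forall x, 0 <= S x).
Hypotheses (k0 : (0 <= k)%R) (r0 : 0 <= r) (Ub : \int[P]_x (U x)%:E <= b%:E).
Hypothesis HV : 'V_P[fun x => (U x `^ (p / 2))%R] <=
  k%:E * \int[P]_x ((U x `^ (p - 1))%:E * S x) + r.

(** The first-moment term and the square function are merged into E (U ^ (p - 1) (b + k S)) before
    Young's inequality, which then costs exactly (1 - 1 / p) E (U ^ p). Subtracting this finite
    quantity leaves E (U ^ p) / p on the left, hence the factor p in front of r. *)
Lemma moment_le :
  \int[P]_x (U x `^ p)%:E <=
  \int[P]_x ((b%:E + k%:E * S x) `^ p) + p%:E * r.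
Proof.
have p1' : (0 <= p - 1)%R by rewrite subr_ge0.
have pV0 : (0 <= p^-1)%R by rewrite invr_ge0 ltW.
have b0 : (0 <= b)%R.
  by rewrite -lee_fin (le_trans _ Ub)// integral_ge0// => x _; rewrite lee_fin ltW.
have intU : P.-integrable setT (EFin \o U).
  apply: (@bounded_RV_integrable _ _ _ _ _ c) => // x.
  by rewrite ger0_norm ?(ltW (U0 x))//; have /andP[] := Uec x.
have iq : P.-integrable setT (EFin \o _) := integrable_powRU p1'.
have ip : P.-integrable setT (EFin \o _) := integrable_powRU (ltW p0).
pose W x := b%:E + k%:E * S x.
have W0 x : 0 <= W x by rewrite adde_ge0 ?mule_ge0 ?lee_fin.
have mkS : measurable_fun setT (fun x => k%:E * S x) by exact: emeasurable_funM.
have mW : measurable_fun setT W by exact: emeasurable_funD.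
have mq : measurable_fun setT (fun x => (U x `^ (p - 1))%:E).
  by apply/measurable_EFinP; exact: measurable_powRU.
have mp : measurable_fun setT (fun x => (U x `^ p)%:E).
  by apply/measurable_EFinP; exact: measurable_powRU.
have mWp : measurable_fun setT (fun x => W x `^ p).
  exact: (measurableT_comp (measurable_poweR p)).
have q0 x : 0 <= (U x `^ (p - 1))%:E by rewrite lee_fin powR_ge0.
have e1 : \int[P]_x (U x `^ p)%:E <= \int[P]_x ((U x `^ (p - 1))%:E * W x) + r.
  apply: (le_trans moment_le_variance).
  have -> : \int[P]_x ((U x `^ (p - 1))%:E * W x) =
      b%:E * \int[P]_x (U x `^ (p - 1))%:E +
      k%:E * \int[P]_x ((U x `^ (p - 1))%:E * S x).
    rewrite -ge0_integral_lin//; last by move=> x _; rewrite mule_ge0.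
      apply: eq_integral => x _; rewrite ge0_muleDr ?mule_ge0 ?lee_fin//.
      by rewrite muleC muleCA.
    exact: emeasurable_funM.
  rewrite addeC -[leRHS]addeA leeD//.
  rewrite (EFin_Rintegral iq) -EFinM lee_fin mulrC.
  apply: ler_wpM2r; first by apply: Rintegral_ge0 => x _; exact: powR_ge0.
  by rewrite -lee_fin -(EFin_Rintegral intU).
have e2 : \int[P]_x ((U x `^ (p - 1))%:E * W x) <=
    (1 - p^-1)%:E * \int[P]_x (U x `^ p)%:E + p^-1%:E * \int[P]_x (W x `^ p).
  have pV1 : (0 <= 1 - p^-1)%R by rewrite subr_ge0 invf_le1.
  rewrite -ge0_integral_lin//; last 2 first.
  - by move=> x _; rewrite lee_fin powR_ge0.
  - by move=> x _; exact: poweR_ge0.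
  apply: ge0_le_integral => //.
  - by move=> x _; rewrite mule_ge0.
  - exact: emeasurable_funM.
  - by apply: emeasurable_funD; exact: emeasurable_funM.
  by move=> x _; rewrite -EFinM young_poweR// ltW.
have := le_trans e1 (leeD2r r e2).
rewrite (EFin_Rintegral ip); set J := \int[P]_x (W x `^ p).
have J0 : 0 <= J by apply: integral_ge0 => x _; exact: poweR_ge0.
move: (\int[P]_x _)%R J J0 r r0 => u [J| |//] J0 [r'| |//] r'0.
- rewrite -!EFinM -!EFinD !lee_fin => h.
  have {}h : (p^-1 * u <= p^-1 * (J + p * r'))%R.
    by rewrite mulrDr mulKf ?gt_eqF//; lra.
  by rewrite -(ler_pM2l (_ : 0 < p^-1)%R) ?invr_gt0.
- by rewrite gt0_muley ?lte_fin// addey// leey.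
- by move=> _; rewrite -EFinM addye// leey.
- by move=> _; rewrite gt0_muley ?lte_fin// addey// leey.
Qed.

End spectral_gap_moments.

Section removing_the_truncation.
Local Open Scope ereal_scope.
Context d (T : measurableType d) (R : realType) (P : probability T R).
Variables (X : T -> R) (m p : R).
Hypotheses (mX : measurable_fun setT X) (p1 : (1 <= p)%R).

Let p0 : (0 < p)%R. Proof. by rewrite (lt_le_trans ltr01). Qed.

Lemma measurable_sqtruncX e : (0 < e)%R ->
  measurable_fun setT (fun x => sqtrunc e (X x - m)).
Proof.
move=> e0; apply: (measurableT_comp (measurable_sqtrunc e0)).
exact: measurable_funB.
Qed.

Lemma sqr_powR (x : R) : ((x ^+ 2) `^ p = `|x| `^ (2 * p))%R.
Proof. by rewrite powRrM powR_mulrn// real_normK// num_real. Qed.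

(** Fatou's lemma along e = 1 / (n + 1). An error linear in e is allowed, since it vanishes in the
    limit. *)
Lemma centered_moment_le_limit (A : \bar R) (B : R) : 0 <= A ->
  (forall n, \int[P]_x (sqtrunc n.+1%:R^-1 (X x - m) `^ p)%:E <=
     A + (B / n.+1%:R)%:E) ->
  \int[P]_x (`|X x - m| `^ (2 * p))%:E <= A.
Proof.
move=> A_ge0 h; pose f n x := (sqtrunc n.+1%:R^-1 (X x - m) `^ p)%:E.
have mf n : measurable_fun setT (f n).
  apply/measurable_EFinP; apply: (measurableT_comp (measurable_powR p)).
  exact: measurable_sqtruncX.
have f0 n x : setT x -> 0 <= f n x by rewrite lee_fin powR_ge0.
apply: (@le_trans _ _ (\int[P]_x limn_einf (f ^~ x))).
  apply: ge0_le_integral => //.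
  - apply/measurable_EFinP; apply: (measurableT_comp (measurable_powR _)).
    by apply: (measurableT_comp (@normr_measurable R setT)); exact: measurable_funB.
  - apply: (eq_measurable_fun (fun x => - limn_esup (fun n => - f n x))) => //.
    apply: (measurableT_comp (@oppe_measurable R setT)).
    apply: measurable_fun_limn_esup => n.
    exact: (measurableT_comp (@oppe_measurable R setT)).
  move=> x _; rewrite -sqr_powR.
  (* Continuity of the p-th power is derived from its derivative, available at positive points only.
     Where X = m the left-hand side is 0, and nonnegativity of the terms suffices. *)
  have [->|Xm0] := eqVneq (X x - m)%R 0%R.
    rewrite expr0n/= powR0 ?gt_eqF// limn_einf_lim.
    apply: lime_ge; first exact: is_cvg_einfs.
    by apply: nearW => n; apply: le_ereal_inf_tmp => _ [k /= _ <-]; exact: f0.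
  have Xm_gt0 : (0 < (X x - m) ^+ 2)%R by rewrite exprn_even_gt0.
  have [|-> _ //] := @cvg_limn_einf_sup _ (f ^~ x) (((X x - m) ^+ 2) `^ p)%:E.
  apply: cvg_EFin; first exact: nearW.
  suff : {for ((X x - m) ^+ 2)%R, continuous (@powR R ^~ p)}.
    by move/(@continuous_cvg _ _ _ _ _ _ (@powR R ^~ p)); apply; exact: sqtrunc_cvg.
  apply: differentiable_continuous; apply/derivable1_diffP.
  exact: (@ex_derive _ _ _ _ _ _ _ (is_derive1_powR p Xm_gt0)).
apply: (le_trans (fatou P measurableT mf f0)).
have [->|] := eqVneq A +oo; first by rewrite leey.
rewrite -ltey => Aoo.
have A0 : A \is a fin_num by rewrite ge0_fin_numE.
have cA : A + (B / n.+1%:R)%:E @[n --> \oo] --> A.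
  rewrite -[X in _ --> X]adde0; apply: cvgeD => //; first by rewrite fin_num_adde_defl.
    exact: cvg_cst.
  apply: cvg_EFin; first exact: nearW.
  rewrite -[X in _ --> X](mulr0 B); apply: cvgM; first exact: cvg_cst.
  exact: cvg_harmonic.
rewrite limn_einf_lim -(cvg_lim _ cA)//.
apply: lee_lim; [exact: is_cvg_einfs|by apply/cvg_ex; exists A|].
apply: nearW => n; apply: (le_trans _ (h n)).
by apply: ereal_inf_lbound; exists n => /=.
Qed.

Lemma integral_sqtrunc_le (e v : R) : (0 < e)%R ->
  \int[P]_x ((X x - m) ^+ 2)%:E = v%:E ->
  \int[P]_x (sqtrunc e (X x - m))%:E <= (e + v)%:E.
Proof.
move=> e0 hv.
have m2 : measurable_fun setT (fun x => ((X x - m) ^+ 2)%:E).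
  by apply/measurable_EFinP; apply: measurable_funX; exact: measurable_funB.
have -> : (e + v)%:E = \int[P]_x (e%:E + ((X x - m) ^+ 2)%:E).
  rewrite ge0_integralD//.
  - by rewrite integral_cst//= probability_setT mule1 hv.
  - by move=> x _; rewrite lee_fin ltW.
  - by move=> x _; rewrite lee_fin sqr_ge0.
apply: ge0_le_integral => //.
- by move=> x _; rewrite lee_fin ltW// sqtrunc_gt0.
- by apply/measurable_EFinP; exact: measurable_sqtruncX.
- exact: emeasurable_funD.
- by move=> x _; rewrite -EFinD lee_fin sqtrunc_le.
Qed.

(** As e <= 1 <= p, the power e ^ p is at most e: this gives the linear error that
    [centered_moment_le_limit] tolerates. *)
Lemma powRD_le_small (e v : R) : (0 < e)%R -> (e <= 1)%R -> (0 <= v)%R ->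
  ((e + v) `^ p <= 2 `^ p * (v `^ p + e))%R.
Proof.
move=> e0 e1 v0; rewrite addrC; apply: le_trans (powRD_le (ltW p0) v0 (ltW e0)) _.
by rewrite ler_wpM2l ?powR_ge0// lerD2l ge1r_powR// e0.
Qed.

End removing_the_truncation.

Section spectral_gap_to_moments.
Local Open Scope ereal_scope.
Context d (T : measurableType d) (R : realType) (P : probability T R).
Variables (X : T -> R) (S : T -> \bar R) (p k : R) (r : \bar R).
Hypotheses (mX : measurable_fun setT X) (mS : measurable_fun setT S).
Hypotheses (S0 : forall x, 0 <= S x) (p1 : (1 <= p)%R) (k0 : (0 <= k)%R).
Hypothesis r0 : 0 <= r.
Let m := fine 'E_P[X].
Hypothesis HV : forall e : R, (0 < e)%R ->
  'V_P[fun x => powtrunc e p (X x - m)] <=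
  k%:E * \int[P]_x ((sqtrunc e (X x - m) `^ (p - 1))%:E * S x) + r.

(** Common to both derivatives: r is 0 for the functional one, and for the oscillation it collects
    the contribution that does not involve U. The factor 4 ^ p is 2 ^ p from separating b from k S
    in [moment_le], times 2 ^ p from separating e from the variance in b = e + Var X. *)
Lemma spectral_gap_moment :
  centered_moment P (2 * p) X <=
  (4 `^ p)%:E * ('V_P[X] `^ p + (k `^ p)%:E * \int[P]_x (S x) `^ p) + p%:E * r.
Proof.
have p0 : (0 < p)%R by rewrite (lt_le_trans ltr01).
have ISp0 : 0 <= \int[P]_x (S x) `^ p.
  by apply: integral_ge0 => x _; exact: poweR_ge0.
have V0 := variance_ge0 P X.
have four_gt0 : (0 < 4 `^ p :> R)%R by rewrite powR_gt0.
have pr0 : 0 <= p%:E * r by rewrite mule_ge0// lee_fin ltW.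
have kS0 : 0 <= (k `^ p)%:E * \int[P]_x (S x) `^ p.
  by rewrite mule_ge0// lee_fin powR_ge0.
have [->|] := eqVneq 'V_P[X] +oo.
  rewrite poweRyr ?gt_eqF// addye ?gt0_muley ?lte_fin//; last first.
    by rewrite gt_eqF// (lt_le_trans _ kS0).
  by rewrite addye ?leey// gt_eqF// (lt_le_trans _ pr0).
rewrite -ltey => Voo.
have Vfin : 'V_P[X] \is a fin_num by rewrite ge0_fin_numE.
have hv : \int[P]_x ((X x - m) ^+ 2)%:E = (fine 'V_P[X])%:E.
  by rewrite fineK// varianceE_int.
have v0 : (0 <= fine 'V_P[X])%R by rewrite fine_ge0.
rewrite -[in leRHS](fineK Vfin); move: (fine 'V_P[X]) hv v0 => v hv v0.
rewrite /centered_moment -/m expectation.unlock.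
apply: (@centered_moment_le_limit _ _ _ P X m p mX p1 _ (4 `^ p)%R) => [|n].
  by rewrite adde_ge0// mule_ge0 ?adde_ge0 ?poweR_ge0// lee_fin ltW.
pose e : R := (n.+1%:R^-1)%R.
have e0 : (0 < e)%R by rewrite invr_gt0.
have e1 : (e <= 1)%R by rewrite invf_le1// ler1n.
have mU := measurable_sqtruncX m mX e0.
have Uec x : (e <= sqtrunc e (X x - m) <= e + e^-1)%R.
  by rewrite sqtrunc_ge// sqtrunc_ub.
apply: (le_trans (moment_le e0 mU Uec p1 mS S0 k0 r0
  (integral_sqtrunc_le mX e0 hv) (HV e0))).
rewrite [leRHS]addeAC; apply: leeD2r.
have mSp : measurable_fun setT (fun x => S x `^ p).
  exact: (measurableT_comp (measurable_poweR p)).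
apply: (@le_trans _ _ (\int[P]_x
   ((2 `^ p * (e + v) `^ p)%:E * cst 1 x + (2 `^ p * k `^ p)%:E * S x `^ p))).
  apply: ge0_le_integral => //.
  - by move=> x _; exact: poweR_ge0.
  - apply: (measurableT_comp (measurable_poweR p)).
    by apply: emeasurable_funD => //; exact: emeasurable_funM.
  - by apply: emeasurable_funD => //; exact: emeasurable_funM.
  move=> x _; rewrite mule1.
  have ev0 : 0 <= (e + v)%:E by rewrite lee_fin addr_ge0// ltW.
  have kSx : 0 <= k%:E * S x by rewrite mule_ge0// lee_fin.
  apply: (le_trans (poweRD_le p0 ev0 kSx)).
  rewrite ge0_muleDr ?poweR_ge0// poweRM ?lee_fin// !poweR_EFin -EFinM muleA -EFinM//.
rewrite ge0_integral_lin// ?mulr_ge0 ?powR_ge0//; last by move=> x _; exact: poweR_ge0.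
rewrite integral_cst//= probability_setT !mule1.
have -> := @ge0_muleDr _ (4 `^ p)%:E _ _ (poweR_ge0 v%:E p) kS0.
rewrite addeAC; apply: leeD.
  rewrite poweR_EFin -EFinM -EFinD lee_fin -mulrDr.
  have -> : (4 = 2 * 2 :> R)%R by ring.
  rewrite powRM// -mulrA ler_wpM2l ?powR_ge0//.
  exact: powRD_le_small.
rewrite muleA -EFinM lee_wpmul2r// lee_fin ler_wpM2r ?powR_ge0//.
by apply: ge0_ler_powR; rewrite ?nnegrE ?(ltW p0) ?ler_nat.
Qed.

End spectral_gap_to_moments.

(** * Functional derivative *)

Section measurability_of_balls_and_fields.
Context {R : realType} {d : nat}.

Lemma measurable_edist :
  measurable_fun [set: Rd R d * Rd R d] (fun z => edist z.1 z.2).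
Proof.
rewrite /edist.
apply: (eq_measurable_fun (fun z : Rd R d * Rd R d =>
  (\sum_(i < d) ((tnth z.1 i : R) - tnth z.2 i) ^+ 2) `^ 2^-1)).
  by move=> z _; rewrite powR12_sqrt// sumr_ge0// => i _; exact: sqr_ge0.
apply: (measurableT_comp (measurable_powR _)).
apply: measurable_sum => i; apply: measurable_funX; apply: measurable_funB.
  exact: (measurableT_comp (measurable_tnth i) measurable_fst).
exact: (measurableT_comp (measurable_tnth i) measurable_snd).
Qed.

Lemma edistC (x y : Rd R d) : edist x y = edist y x.
Proof.
by rewrite /edist; congr Num.sqrt; apply: eq_bigr => i _; rewrite -sqrrN opprB.
Qed.

Lemma measurable_edist_lt d' (T : measurableType d') (f g : T -> Rd R d)
    (r : T -> R) : measurable_fun setT f -> measurable_fun setT g ->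
  measurable_fun setT r -> measurable [set t | edist (f t) (g t) < r t].
Proof.
move=> mf mg mr; rewrite -[X in measurable X]setTI.
rewrite (_ : [set t | _] = (fun t => edist (f t) (g t) < r t) @^-1` [set true])//.
apply: measurable_fun_ltr => //.
exact: (measurableT_comp measurable_edist (measurable_fun_pair mf mg)).
Qed.

Lemma measurable_eball (x : Rd R d) (r : R) : measurable (eball x r).
Proof. exact: measurable_edist_lt. Qed.

Context {disp : measure_display} {Omega : measurableType disp}.

Lemma ge0_integral_eball (f : Rd R d -> \bar R) (x : Rd R d) (r : R) :
  (\int[lebesgue_Rd R d]_(y in eball x r) f y =
  \int[lebesgue_Rd R d]_y (f y * (\1_(eball x r) y)%:E))%E.
Proof.
rewrite integral_mkcond; apply: eq_integral => y _.
by rewrite patchE indicE; case: ifPn => _; rewrite ?mule1 ?mule0.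
Qed.

Lemma measurable_fct_field (G : Rd R d -> Omega -> R) :
  measurable_fun [set: Rd R d * Omega] (fun q => G q.1 q.2) ->
  measurable_fun [set: R * Rd R d * Omega] (fun q => fct_field G q.1.1 q.1.2 q.2).
Proof.
move=> mG; rewrite /fct_field.
(* The domain of integration moves with the radius and the centre; as an indicator inside the
   integrand, it lets Tonelli's theorem work on a fixed product. *)
under eq_fun do rewrite ge0_integral_eball.
apply: (measurable_fun_fubini_tonelli_F (m2 := lebesgue_Rd R d)
  (fun z : (R * Rd R d * Omega) * Rd R d =>
   (`|G z.2 z.1.2|%:E * (\1_(eball z.1.1.2 z.1.1.1) z.2)%:E)%E)).
  apply: emeasurable_funM.
    apply/measurable_EFinP; apply: measurableT_comp => //.
    apply: (measurableT_comp (g := fun z : (R * Rd R d * Omega) * Rd R d =>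
      (z.2, z.1.2)) mG).
    apply: measurable_fun_pair => //.
    exact: (measurableT_comp measurable_snd measurable_fst).
  apply/measurable_EFinP.
  rewrite (_ : (fun _ => _) = \1_[set z : (R * Rd R d * Omega) * Rd R d |
     edist z.1.1.2 z.2 < z.1.1.1]); last by apply/funext => z; rewrite !indicE.
  apply: measurable_indic; apply: measurable_edist_lt => //.
    apply: (measurableT_comp measurable_snd).
    exact: (measurableT_comp measurable_fst measurable_fst).
  apply: (measurableT_comp measurable_fst).
  exact: (measurableT_comp measurable_fst measurable_fst).
by move=> z; rewrite mule_ge0// lee_fin.
Qed.

Lemma measurable_weighted_radial (h : R -> Omega -> \bar R) (k : R -> R) :
  measurable_fun [set: R * Omega] (fun q => h q.1 q.2) ->
  (forall r w, 0 <= h r w)%E -> measurable_fun (`[0, +oo[ : set R) k ->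
  (forall r, 0 <= r -> 0 <= k r) ->
  measurable_fun setT (fun w => \int[lebesgue_measure]_(l in `[0%R, +oo[)
    (h l w * (k l)%:E))%E.
Proof.
move=> mh h0 mk k0.
(* Since [k] is controlled on the half-line only, it is extended by 0 to the whole line. *)
rewrite (_ : (fun _ => _) = (fun w => \int[lebesgue_measure]_l
    (h l w * ((k \_ `[0%R, +oo[) l)%:E))%E); last first.
  apply/funext => w; rewrite integral_mkcond; apply: eq_integral => l _.
  by rewrite !patchE; case: ifPn => _; rewrite ?mule0.
apply: (measurable_fun_fubini_tonelli_G (m1 := lebesgue_measure)
  (fun z : R * Omega => (h z.1 z.2 * ((k \_ `[0%R, +oo[) z.1)%:E)%E)).
  apply: emeasurable_funM => //; apply/measurable_EFinP.
  apply: measurableT_comp => //.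
  exact: (measurable_restrictT k (measurable_itv _)).1 mk.
move=> z; rewrite mule_ge0// lee_fin patchE; case: ifPn => // /[!inE]/=.
by rewrite in_itv/= andbT => /k0.
Qed.

Lemma measurable_sqre d' (T : measurableType d') (D : set T) (f : T -> \bar R) :
  measurable_fun D f -> measurable_fun D (fun x => f x ^+ 2)%E.
Proof. by move=> mf; under eq_fun do rewrite expe2; exact: emeasurable_funM. Qed.

Lemma measurable_radial_sqr (D : R -> Rd R d -> Omega -> \bar R) (s : R -> R) :
  measurable_fun setT s ->
  measurable_fun [set: R * Rd R d * Omega] (fun q => D q.1.1 q.1.2 q.2) ->
  measurable_fun [set: R * Omega] (fun q =>
    \int[lebesgue_Rd R d]_x (D (s q.1) x q.2) ^+ 2)%E.
Proof.
move=> ms mD.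
apply: (measurable_fun_fubini_tonelli_F (m2 := lebesgue_Rd R d)
  (fun z : (R * Omega) * Rd R d => (D (s z.1.1) z.2 z.1.2 ^+ 2)%E)).
  apply: measurable_sqre.
  apply: (measurableT_comp (f := fun q : R * Rd R d * Omega => D q.1.1 q.1.2 q.2)
    (g := fun z : (R * Omega) * Rd R d => (s z.1.1, z.2, z.1.2))) => //.
  apply: measurable_fun_pair.
    apply: measurable_fun_pair => //.
    apply: (measurableT_comp ms).
    exact: (measurableT_comp measurable_fst measurable_fst).
  exact: (measurableT_comp measurable_snd measurable_fst).
by move=> z; exact: sqre_ge0.
Qed.

Lemma measurable_multiscale (weight : R -> R) (D : R -> Rd R d -> Omega -> \bar R) :
  (forall l, 0 <= l -> 0 <= weight l) -> measurable_fun (`[0, +oo[ : set R) weight ->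
  measurable_fun [set: R * Rd R d * Omega] (fun q => D q.1.1 q.1.2 q.2) ->
  measurable_fun setT (multiscale weight D).
Proof.
move=> w0 mw mD; rewrite /multiscale.
apply: (measurable_weighted_radial (k := fun l => (l + 1) ^- d * weight l)
  (h := fun l w => (\int[lebesgue_Rd R d]_x (D (l + 1)%R x w) ^+ 2)%E)).
- apply: (measurable_radial_sqr (s := fun l => l + 1)) => //.
  exact: measurable_funD.
- by move=> r w; apply: integral_ge0 => x _; exact: sqre_ge0.
- apply: measurable_funM => //.
  apply: (eq_measurable_fun (fun l : R => (l + 1) `^ (- d%:R))).
    move=> l /[!inE]/=; rewrite in_itv/= andbT => l0.
    by rewrite powR_invn// addr_ge0.
  apply: measurable_funTS; apply: (measurableT_comp (measurable_powR _)).
  exact: measurable_funD.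
- by move=> l l0; rewrite mulr_ge0 ?w0// invr_ge0 exprn_ge0// addr_ge0.
Qed.

Lemma multiscale_ge0 (weight : R -> R) (D : R -> Rd R d -> Omega -> \bar R) w :
  (forall l, 0 <= l -> 0 <= weight l) -> (0 <= multiscale weight D w)%E.
Proof.
move=> w0; apply: integral_ge0 => l; rewrite /= in_itv/= andbT => l0.
rewrite mule_ge0//; first by apply: integral_ge0 => x _; exact: sqre_ge0.
by rewrite lee_fin mulr_ge0 ?w0// invr_ge0 exprn_ge0// addr_ge0.
Qed.

End measurability_of_balls_and_fields.

Section field_measurability.
Context {R : realType} {d : nat} {disp : measure_display}.
Context {Omega : measurableType disp}.
Variable A : Rd R d -> Omega -> R.

Lemma sigma_field_sub (S : set (Rd R d)) (C : set (set Omega)) :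
  sigma_algebra setT C ->
  (forall x (B : set R), S x -> measurable B -> C (A x @^-1` B)) ->
  (measurable : set (set (sigma_field A S))) `<=` C.
Proof.
move=> sC h; apply: smallest_sub => // _ [x Sx [B mB <-]].
by rewrite setTI; exact: h.
Qed.

Lemma sigma_field_subset (S S' : set (Rd R d)) : S `<=` S' ->
  (measurable : set (set (sigma_field A S))) `<=`
  (measurable : set (set (sigma_field A S'))).
Proof.
move=> SS'; apply: sigma_field_sub.
  exact: (@sigma_algebra_measurable _ (sigma_field A S')).
move=> x B Sx mB; apply: sub_sigma_algebra.
by exists x; [exact: SS'|exists B => //; rewrite setTI].
Qed.

Lemma field_measurable_subset (S S' : set (Rd R d)) d' (T : measurableType d')
    (Y : Omega -> T) : S `<=` S' ->
  field_measurable A S Y -> field_measurable A S' Y.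
Proof.
move=> SS' mY _ B mB; apply: (sigma_field_subset SS').
by have := mY measurableT B mB.
Qed.

Hypothesis mA : jointly_measurable A.

(** Joint measurability makes every coordinate [A x] measurable on Omega, so the sigma-algebra
    generated by them is contained in the ambient one. *)
Lemma field_measurable_fun (S : set (Rd R d)) d' (T : measurableType d')
    (Y : Omega -> T) : field_measurable A S Y -> measurable_fun setT Y.
Proof.
move=> mY _ B mB.
apply: (@sigma_field_sub S measurable).
- exact: sigma_algebra_measurable.
- move=> x C Sx mC; rewrite -[X in measurable X]setTI.
  have := measurableT_comp mA (pair1_measurable x).
  by move/(_ measurableT _ mC).
by have := mY measurableT B mB.
Qed.

End field_measurability.

Section functional_derivative.
Context {R : realType} {d : nat} {disp : measure_display}.
Context {Omega : measurableType disp}.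
Variables (P : probability Omega R) (A : Rd R d -> Omega -> R).
Hypothesis mA : jointly_measurable A.
Variables (phi dphi : R -> R) (c : R).
Hypotheses (dphiE : forall x : R, is_derive x 1 phi (dphi x)).
Hypotheses (mdphi : measurable_fun setT dphi) (dphi_le : forall x, `|dphi x| <= c).
Variables (M : set (Rd R d -> R)) (X : (Rd R d -> R) -> R) (G : Rd R d -> Omega -> R).
Hypothesis obsX : fct_observable P A M X G.

Let mXA : measurable_fun setT (fun w => X (A ^~ w)).
Proof. by have [_ /(field_measurable_fun mA)] := obsX. Qed.

Let mphi : measurable_fun setT phi.
Proof.
apply: continuous_measurable_fun => x.
apply: differentiable_continuous; apply/derivable1_diffP.
exact: (@ex_derive _ _ _ _ _ _ _ (dphiE x)).
Qed.

Let mdphiX : measurable_fun setT (fun w => dphi (X (A ^~ w))).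
Proof. exact: measurableT_comp. Qed.

Let mG : measurable_fun [set: Rd R d * Omega] (fun q => G q.1 q.2).
Proof. by have [_ _ []] := obsX. Qed.

Lemma fct_field_chain r x w :
  fct_field (fun (y : Rd R d) w => dphi (X (A ^~ w)) * G y w)%R r x w =
  (`|dphi (X (A ^~ w))|%:E * fct_field G r x w)%E.
Proof.
have mB := measurable_eball x r.
have mGw : measurable_fun (eball x r) (fun y => `|G y w|%:E).
  apply/measurable_EFinP; apply: measurable_funTS; apply: measurableT_comp => //.
  exact: (measurableT_comp (g := fun y : Rd R d => (y, w)) mG (pair2_measurable w)).
rewrite /fct_field -ge0_integralZl//.
by apply: eq_integral => y _; rewrite normrM EFinM.
Qed.

Lemma multiscale_fct_chain (weight : R -> R) w :
  (forall l, 0 <= l -> 0 <= weight l) ->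
  measurable_fun (`[0, +oo[ : set R) weight ->
  multiscale weight (fct_field (fun (y : Rd R d) w => dphi (X (A ^~ w)) * G y w)%R) w =
  ((dphi (X (A ^~ w)) ^+ 2)%:E * multiscale weight (fct_field G) w)%E.
Proof.
move=> weight_ge0 mweight; rewrite /multiscale; set k := dphi _.
have mF := measurable_fct_field mG.
have w_section : measurable_fun setT (fun l : R =>
    \int[lebesgue_Rd R d]_x (fct_field G (l + 1) x w) ^+ 2)%E.
  have H := measurable_radial_sqr (s := fun l => l + 1)
    (measurable_funD (@measurable_id _ _ setT) (measurable_cst (1 : R))) mF.
  exact: (measurableT_comp (g := fun l : R => (l, w)) H (pair2_measurable w)).
have inner (l : R) : (\int[lebesgue_Rd R d]_x
    (fct_field (fun (y : Rd R d) w => dphi (X (A ^~ w)) * G y w)%R (l + 1) x w) ^+ 2 =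
    (k ^+ 2)%:E * \int[lebesgue_Rd R d]_x (fct_field G (l + 1) x w) ^+ 2)%E.
  have F0 (x : Rd R d) : [set: Rd R d] x -> (0 <= (fct_field G (l + 1) x w) ^+ 2)%E.
    by move=> _; exact: sqre_ge0.
  have mF2 : measurable_fun setT (fun x => (fct_field G (l + 1) x w) ^+ 2)%E.
    apply: measurable_sqre.
    apply: (measurableT_comp (f := fun q : R * Rd R d * Omega =>
      fct_field G q.1.1 q.1.2 q.2) (g := fun x => (l + 1, x, w))) => //.
    by apply: measurable_fun_pair => //; exact: measurable_fun_pair.
  rewrite -(ge0_integralZl_EFin _ measurableT F0 mF2 (sqr_ge0 k)).
  apply: eq_integral => x _; rewrite fct_field_chain !expe2 muleACA -EFinM.
  by rewrite -normrM ger0_norm -?expr2// sqr_ge0.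
transitivity (\int[lebesgue_measure]_(l in `[0%R, +oo[) ((k ^+ 2)%:E *
    (\int[lebesgue_Rd R d]_x (fct_field G (l + 1) x w) ^+ 2 *
    ((l + 1) ^- d * weight l)%:E)))%E.
  by apply: eq_integral => l _; rewrite inner muleA.
rewrite (@ge0_integralZl_EFin _ _ _ lebesgue_measure _ (measurable_itv _)) ?sqr_ge0//.
- move=> l; rewrite /= in_itv/= andbT => l0.
  rewrite mule_ge0//; first by apply: integral_ge0 => x _; exact: sqre_ge0.
  by rewrite lee_fin mulr_ge0 ?weight_ge0// invr_ge0 exprn_ge0// addr_ge0.
- apply: emeasurable_funM; first exact: measurable_funTS.
  apply/measurable_EFinP; apply: measurable_funM => //.
  apply: (eq_measurable_fun (fun l : R => (l + 1) `^ (- d%:R))).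
    move=> l /[!inE]/=; rewrite in_itv/= andbT => l0.
    by rewrite powR_invn// addr_ge0.
  apply: measurable_funTS; apply: (measurableT_comp (measurable_powR _)).
  exact: measurable_funD.
Qed.

Lemma Lfun_infty_bounded d' (T : measurableType d')
    (mu : {measure set T -> \bar R}) (B : T -> R) :
  B \in Lfun mu +oo%E ->
  exists2 b : R, 0 <= b & {ae mu, forall y, `|B y| <= b}.
Proof.
move=> /andP[_]; rewrite inE/= /finite_norm Lnorm.unlock.
(* For the zero measure the norm is 0 by convention and carries no information on [B], but then any
   bound holds almost everywhere. *)
case: ifPn => [mu0|mu0 _]; last first.
  exists 0 => //; apply: measure0_ae; apply/eqP.
  by rewrite -measure_le0 leNgt.
move=> Boo; have B0 : (0 <= ess_sup mu (abse \o (EFin \o B)))%E.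
  by apply: ess_sup_gee => //; apply: aeW => y; rewrite lee_fin.
exists (fine (ess_sup mu (abse \o (EFin \o B)))); first by rewrite fine_ge0.
have := ess_sup_ge mu (abse \o (EFin \o B)); apply: filterS => y /= h.
by rewrite -lee_fin fineK// ge0_fin_numE.
Qed.

(** At fixed outcome and direction B, the map from t to X (A + t B) is a function of one real
    variable, so the ordinary chain rule applies at t = 0. Boundedness of [dphi] preserves the local
    square integrability demanded of a functional derivative. *)
Lemma fct_observable_chain : fct_observable P A M (phi \o X)
  (fun (y : Rd R d) w => dphi (X (A ^~ w)) * G y w)%R.
Proof.
have [X_Linf X_meas [_ G_int X_der]] := obsX.
have mF (r : R) : measurable_fun setT (fct_field G r origin).
  exact: (measurableT_comp (g := fun w : Omega => (r, origin, w))
    (measurable_fct_field mG) (pair1_measurable (r, origin))).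
have mF2 (r : R) : measurable_fun setT (fun w => fct_field G r origin w ^+ 2)%E.
  exact: measurable_sqre.
split.
- by move=> f g Mf Mg fg; rewrite /= (X_Linf _ _ Mf Mg fg).
- exact: (measurableT_comp mphi X_meas).
split.
- apply: measurable_funM => //.
  exact: (measurableT_comp mdphiX measurable_snd).
- move=> r; apply: le_lt_trans (_ : ((c ^+ 2)%:E * \int[P]_w
      (fct_field G r origin w) ^+ 2 < +oo)%E); last first.
    by rewrite lte_mul_pinfty ?lee_fin ?sqr_ge0//; exact: G_int.
  have F0 (w : Omega) : [set: Omega] w -> (0 <= fct_field G r origin w ^+ 2)%E.
    by move=> _; exact: sqre_ge0.
  rewrite -(ge0_integralZl_EFin _ measurableT F0 (mF2 r) (sqr_ge0 c)).
  apply: ge0_le_integral => //.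
  - by move=> w _; exact: sqre_ge0.
  - apply: measurable_sqre; apply: (eq_measurable_fun (fun w =>
      `|dphi (X (A ^~ w))|%:E * fct_field G r origin w)%E).
      by move=> w _; rewrite -fct_field_chain.
    apply: emeasurable_funM => //; apply/measurable_EFinP.
    exact: measurableT_comp.
  - by apply: emeasurable_funM => //; exact: mF2.
  move=> w _; rewrite [X in (X ^+ 2)%E](fct_field_chain r origin w).
  rewrite !expe2 muleACA -EFinM -expe2 lee_wpmul2r ?sqre_ge0// lee_fin -expr2.
  by rewrite lerXn2r ?nnegrE// (le_trans _ (dphi_le 0)).
- move=> B LB cB; have [r0 Br0] := cB; have [b b0 Bb] := Lfun_infty_bounded LB.
  (* Pulling [dphi] out of the real-valued integral of B G requires integrability. Almost surely G
     is integrable on the ball carrying B, because the square of that integral has finite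
     expectation. *)
  have Gloc : {ae P, forall w, (fct_field G r0 origin w < +oo)%E}.
    have /integrable_ae : P.-integrable setT (fun w => fct_field G r0 origin w ^+ 2)%E.
      apply/integrableP; split; first exact: mF2.
      under eq_integral do rewrite gee0_abs ?sqre_ge0//.
      exact: G_int.
    move=> /(_ measurableT); apply: filterS => w /(_ I).
    have : (0 <= fct_field G r0 origin w)%E by apply: integral_ge0.
    by case: (fct_field G r0 origin w) => [x| |]; rewrite ?ltry// expe2 mulyy.
  move: (X_der B LB cB) Gloc; apply: filterS2 => w hw Gw.
  set l := (\int[_]_y _)%R in hw.
  pose h t := X (fun y => A y w + t * B y).
  have h0 : h 0 = X (A ^~ w).
    by congr X; apply/funext => y; rewrite mul0r addr0.
  have dh : is_derive (0 : R) 1 h l.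
    have hl : (fun t => t^-1 *: (h (t *: 1 + 0) - h 0)) t @[t --> 0^'] --> l.
      rewrite (_ : (fun t => _) = (fun t => (h t - X (A ^~ w)) / t))//.
      by apply/funext => t; rewrite h0 addr0 [_ *: 1]mulr1 [_ *: _]mulrC.
    by split; [apply/cvg_ex; exists l|exact: cvg_lim hl].
  have dphih : is_derive (h 0) 1 phi (dphi (h 0)) := dphiE (h 0).
  have [/cvg_ex[l' cl'] dl'] := is_derive1_comp dphih dh.
  have {dl'}l'E : l' = dphi (h 0) * l by rewrite -dl'; apply/esym; exact: cvg_lim cl'.
  have -> : (\int[lebesgue_Rd R d]_y (B y * (dphi (X (A ^~ w)) * G y w)) = l')%R.
    have intBG : (lebesgue_Rd R d).-integrable setT (EFin \o (fun y => B y * G y w)).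
      have mB : measurable_fun setT B by have /andP[/[!inE]] := LB.
      have mGw : measurable_fun setT (G ^~ w).
        exact: (measurableT_comp (g := fun y : Rd R d => (y, w)) mG (pair2_measurable w)).
      apply/integrableP; split; first by apply/measurable_EFinP; exact: measurable_funM.
      apply: le_lt_trans (_ : (b%:E * fct_field G r0 origin w < +oo)%E); last first.
        by rewrite lte_mul_pinfty ?lee_fin.
      have mE := measurable_eball (origin : Rd R d) r0.
      have F0 (y : Rd R d) : eball origin r0 y -> (0 <= `|G y w|%:E)%E by [].
      have mF0 : measurable_fun (eball (origin : Rd R d) r0) (fun y => `|G y w|%:E).
        by apply/measurable_EFinP; apply: measurable_funTS; exact: measurableT_comp.
      rewrite -(ge0_integralZl_EFin _ mE F0 mF0 b0) ge0_integral_eball.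
      apply: ae_ge0_le_integral => //.
      - by apply/measurable_EFinP; apply: measurableT_comp => //; exact: measurable_funM.
      - by move=> y _; rewrite !mule_ge0// lee_fin.
      - apply: emeasurable_funM.
          by apply: emeasurable_funM => //; apply/measurable_EFinP; exact: measurableT_comp.
        by apply/measurable_EFinP; exact: measurable_indic.
      apply: filterS Bb => y By _; rewrite -!EFinM lee_fin normrM indicE.
      have [yB|yB] := boolP (y \in eball origin r0); first by rewrite mulr1 ler_wpM2r.
      by rewrite Br0 ?normr0 ?mul0r ?mulr0// => h1; move: yB; rewrite notin_setE.
    rewrite l'E h0 /l -RintegralZl//.
    by apply: eq_Rintegral => y _; rewrite mulrCA.
  move: cl'; rewrite (_ : (fun t => _) = (fun t => (phi (h t) - phi (X (A ^~ w))) / t))//.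
  by apply/funext => t; rewrite /= h0 addr0 [_ *: 1]mulr1 [_ *: _]mulrC.
Qed.

End functional_derivative.

Section functional_spectral_gap.
Local Open Scope ereal_scope.
Context {R : realType}.

Lemma probability_jensen_poweR d (T : measurableType d) (P : probability T R)
    (f : T -> \bar R) (p : R) : (1 <= p)%R ->
  measurable_fun setT f -> (forall x, 0 <= f x) ->
  (\int[P]_x f x) `^ p <= \int[P]_x (f x) `^ p.
Proof.
move=> p1 mf f0.
have W : \int[P]_x (cst (1%R : R) x)%:E = 1%R%:E.
  by rewrite (@integral_cst _ _ _ P _ measurableT 1)/= probability_setT mule1.
have := @weighted_jensen _ _ _ P setT measurableT f (cst (1%R : R)) p p1 mf
  (fun x _ => f0 x) (measurable_cst _) (fun _ _ => ler01) _ W.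
rewrite powR1 mul1e; under eq_integral do rewrite mule1.
by under [in X in _ <= X]eq_integral do rewrite mule1.
Qed.

(** Here 8 = 4 * 2, where the 4 comes from [spectral_gap_moment] and the 2 from 1 + (p ^ 2) ^ p <= 2
    ^ p (p ^ 2) ^ p. *)
Lemma spectral_gap_constant (p : R) (V I : \bar R) : (1 <= p)%R -> 0 <= I ->
  V `^ p <= I ->
  (4 `^ p)%:E * (V `^ p + ((p ^+ 2) `^ p)%:E * I) <= ((8 * p ^+ 2) `^ p)%:E * I.
Proof.
move=> p1 I0 VI; have p0 : (0 < p)%R by rewrite (lt_le_trans ltr01).
apply: (@le_trans _ _ ((4 `^ p)%:E * ((1 + (p ^+ 2) `^ p)%:E * I))).
  rewrite lee_wpmul2l ?lee_fin ?powR_ge0// EFinD ge0_muleDl ?lee_fin ?powR_ge0//.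
  by rewrite mul1e leeD2r.
rewrite muleA -EFinM lee_wpmul2r// lee_fin.
have -> : (8 * p ^+ 2 = 4 * 2 * p ^+ 2 :> R)%R by ring.
rewrite !powRM ?mulr_ge0// ?(ltW p0)// -mulrA ler_wpM2l ?powR_ge0//.
have h2 : (2 <= 2 `^ p :> R)%R by rewrite le1r_powR// ler1n.
have hp : (1 <= p `^ p * p `^ p :> R)%R.
  have h : (1 <= p `^ p :> R)%R.
    by rewrite -[leLHS](powRr0 p) ler_powR// ltW.
  by rewrite -[leLHS]mulr1 ler_pM.
nra.
Qed.

Context {d : nat} {disp : measure_display} {Omega : measurableType disp}.
Variables (P : probability Omega R) (A : Rd R d -> Omega -> R).
Hypothesis mA : jointly_measurable A.
Variable weight : R -> R.
Hypothesis weight_ge0 : (forall l : R, 0 <= l -> 0 <= weight l)%R.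
Hypothesis mweight : measurable_fun (`[0%R, +oo[ : set R) weight.
Variables (M : set (Rd R d -> R)) (X : (Rd R d -> R) -> R) (G : Rd R d -> Omega -> R).
Hypothesis obsX : fct_observable P A M X G.

Let S := multiscale weight (fct_field G).

Let mXA : measurable_fun setT (fun w => X (A ^~ w)).
Proof. by have [_ /(field_measurable_fun mA)] := obsX. Qed.

Lemma measurable_fct_multiscale : measurable_fun setT S.
Proof.
apply: measurable_multiscale => //; apply: measurable_fct_field.
by have [_ _ []] := obsX.
Qed.

Section powers.
Variables (m e p : R).
Hypotheses (e0 : (0 < e)%R) (p1 : (1 <= p)%R).

(** This bound degenerates as e tends to 0; it only serves to make the truncated power an admissible
    observable and never enters the final estimate. *)
Lemma dpowtrunc_le x :
  (`|dpowtrunc e p (x - m)| <= p * (e + e^-1) `^ ((p - 1) / 2))%R.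
Proof.
have p0 : (0 <= p)%R by rewrite (le_trans ler01).
have g0 := sqtrunc_gt0 (x - m) e0.
rewrite -ler_sqr ?nnegrE ?mulr_ge0 ?powR_ge0//.
rewrite real_normK ?num_real// (le_trans (dpowtrunc_sqr_le p _ e0))//.
rewrite exprMn -(powR_mulrn 2 (powR_ge0 _ _)) -powRrM divfK//.
rewrite ler_wpM2l ?sqr_ge0//; apply: ge0_ler_powR; rewrite ?subr_ge0//.
- by rewrite nnegrE ltW.
- by rewrite nnegrE addr_ge0 ?invr_ge0 ?ltW.
- exact: sqtrunc_ub.
Qed.

Lemma is_derive_powtrunc_shift (x : R) :
  is_derive x 1%R (fun x => powtrunc e p (x - m)) (dpowtrunc e p (x - m)).
Proof.
have h := is_derive_powtrunc p (x - m) e0.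
have h1 : is_derive x 1%R (fun x : R => x - m)%R (1 : R)%R.
  apply: eq_is_derive (is_deriveB (is_derive_id x 1%R) (is_derive_cst m x 1%R)) _ _ => //.
  by rewrite subr0.
have h2 := @is_derive1_comp R (powtrunc e p) (fun x : R => x - m)%R x _ _ h h1.
by apply: eq_is_derive h2 _ _ => //; rewrite mulr1.
Qed.

Lemma measurable_dpowtrunc_shift :
  measurable_fun setT (fun x : R => dpowtrunc e p (x - m))%R.
Proof.
apply: (measurableT_comp (measurable_dpowtrunc p e0)).
exact: measurable_funB.
Qed.

Lemma fct_observable_powtrunc :
  fct_observable P A M (fun f => powtrunc e p (X f - m))
    (fun (y : Rd R d) w => dpowtrunc e p (X (A ^~ w) - m) * G y w)%R.
Proof.
exact: (@fct_observable_chain _ _ _ _ P A mA (fun x => powtrunc e p (x - m))%R _ _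
  is_derive_powtrunc_shift measurable_dpowtrunc_shift dpowtrunc_le).
Qed.

(** Shared by the spectral gap and the logarithmic Sobolev inequality, as both are applied to a
    truncated power and have the same right-hand side. *)
Lemma integral_multiscale_powtrunc_le :
  \int[P]_w multiscale weight (fct_field
    (fun (y : Rd R d) w => dpowtrunc e p (X (A ^~ w) - m) * G y w)%R) w <=
  (p ^+ 2)%:E * \int[P]_w ((sqtrunc e (X (A ^~ w) - m) `^ (p - 1))%:E * S w).
Proof.
have mS := measurable_fct_multiscale.
have S0 w : 0 <= S w by exact: multiscale_ge0.
have mU : measurable_fun setT (fun w => (sqtrunc e (X (A ^~ w) - m) `^ (p - 1))%:E).
  apply/measurable_EFinP; apply: (measurableT_comp (measurable_powR _)).
  exact: measurable_sqtruncX.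
have h w : multiscale weight (fct_field
    (fun (y : Rd R d) w => dpowtrunc e p (X (A ^~ w) - m) * G y w)%R) w =
    (dpowtrunc e p (X (A ^~ w) - m) ^+ 2)%:E * S w.
  exact: (multiscale_fct_chain (fun x => dpowtrunc e p (x - m))%R obsX).
under eq_integral do rewrite h.
have F0 w : [set: Omega] w -> 0 <= (sqtrunc e (X (A ^~ w) - m) `^ (p - 1))%:E * S w.
  by move=> _; rewrite mule_ge0// lee_fin powR_ge0.
have mF : measurable_fun setT (fun w => (sqtrunc e (X (A ^~ w) - m) `^ (p - 1))%:E * S w).
  exact: emeasurable_funM.
rewrite -(ge0_integralZl_EFin _ measurableT F0 mF (sqr_ge0 p)).
apply: ge0_le_integral => //.
- by move=> w _; rewrite mule_ge0// lee_fin sqr_ge0.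
- apply: emeasurable_funM => //; apply/measurable_EFinP; apply: measurable_funX.
  exact: (measurableT_comp measurable_dpowtrunc_shift mXA).
- exact: emeasurable_funM.
by move=> w _; rewrite muleA -EFinM lee_wpmul2r// lee_fin dpowtrunc_sqr_le.
Qed.

End powers.

Hypothesis MSG : fct_MSG P A M weight.

(** The variance of X left by [spectral_gap_moment] is estimated by the spectral gap for X itself,
    followed by Jensen's inequality. *)
Lemma fct_MSG_moment (p : R) : (1 <= p)%R ->
  centered_moment P (2 * p) (fun w => X (A ^~ w)) <=
  ((8 * p ^+ 2) `^ p)%:E * \int[P]_w (S w) `^ p.
Proof.
move=> p1; have p0 : (0 < p)%R by rewrite (lt_le_trans ltr01).
have mS := measurable_fct_multiscale.
have S0 w : 0 <= S w by exact: multiscale_ge0.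
apply: (le_trans (@spectral_gap_moment _ _ _ P _ S p (p ^+ 2)%R 0 mXA mS S0 p1
   (sqr_ge0 p) (lexx 0) _)).
  move=> e e0; rewrite adde0.
  have h := integral_multiscale_powtrunc_le (fine 'E_P[fun w => X (A ^~ w)]) p e0.
  apply: (le_trans _ h).
  exact: MSG (fct_observable_powtrunc _ e0 p1).
rewrite mule0 adde0; apply: spectral_gap_constant => //.
  by apply: integral_ge0 => w _; exact: poweR_ge0.
apply: (le_trans _ (probability_jensen_poweR P p1 mS S0)).
by apply: le_poweR; [exact: ltW|exact: variance_ge0|exact: MSG obsX].
Qed.

End functional_spectral_gap.

(** * Moments from a logarithmic Sobolev inequality *)

Section log_sobolev_moments.
Local Open Scope ereal_scope.
Context d (T : measurableType d) (R : realType) (P : probability T R).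
Variables (U : T -> R) (e c : R).
Hypotheses (e0 : (0 < e)%R) (mU : measurable_fun setT U).
Hypotheses (Uec : forall x, (e <= U x <= c)%R).

Let U0 x : (0 < U x)%R.
Proof. by have /andP[] := Uec x => /(lt_le_trans e0). Qed.

Let mlnU : measurable_fun setT (fun x => ln (U x)).
Proof. by apply: measurableT_comp => //; exact: measurable_ln. Qed.

Let L := (`|ln e| + `|ln c|)%R.

Let lnU_le x : (`|ln (U x)| <= L)%R.
Proof.
have /andP[h1 h2] := Uec x.
have {}h1 : (ln e <= ln (U x))%R by rewrite ler_ln ?posrE.
have {}h2 : (ln (U x) <= ln c)%R by rewrite ler_ln ?posrE// (lt_le_trans (U0 x)).
rewrite /L ler_norml; apply/andP; split.
  rewrite lerNl (le_trans _ (_ : `|ln e| <= _))%R ?lerDl//.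
  by rewrite -normrN (le_trans _ (ler_norm _))// lerN2.
by rewrite (le_trans h2)// (le_trans (ler_norm _))// lerDr.
Qed.

Let N (s : R) : R := (\int[P]_x (U x `^ s))%R.

Let N1 (s : R) : R := (\int[P]_x (ln (U x) * U x `^ s))%R.

Let derU x (s : R) : is_derive s 1%R (fun s => U x `^ s)%R (ln (U x) * U x `^ s)%R.
Proof.
have -> : (fun s => U x `^ s)%R = (fun s => expR (s * ln (U x)))%R.
  by apply/funext => t; rewrite /powR gt_eqF.
have h : is_derive s 1%R (fun s : R => s * ln (U x))%R (ln (U x)).
  apply: eq_is_derive (is_deriveM (is_derive_id s 1%R) (is_derive_cst (ln (U x)) s 1%R)) _ _ => //.
  by rewrite /GRing.scale/= mulr0 add0r mulr1.
have := @is_derive1_comp R expR (fun s : R => s * ln (U x))%R s _ _ (is_derive_expR _) h.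
move=> h2; apply: eq_is_derive h2 _ _ => //.
by rewrite /powR gt_eqF// mulrC.
Qed.

Let c_gt0 (x : T) : (0 < c)%R.
Proof. by have /andP[h1 h2] := Uec x; rewrite (lt_le_trans e0)// (le_trans h1). Qed.

Let N_gt0 (s : R) : (0 <= s)%R -> (0 < N s)%R.
Proof.
move=> s0; apply: (lt_le_trans (powR_gt0 s e0)).
rewrite -[leLHS](@Rintegral_prob_cst _ _ _ P).
apply: le_Rintegral => //.
- exact: (finite_measure_integrable_cst P (e `^ s)%R).
- exact: (integrable_powRU P e0 mU Uec).
by move=> x _; have /andP[] := powRU_bound e0 Uec s0 x.
Qed.

Let is_derive_N (s : R) : (0 < s)%R -> is_derive s 1%R N (N1 s).
Proof.
(* A dominating constant for the s-derivative on ]0, s + 1[. The base is 1 + c rather than c because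
   a power is nondecreasing in its exponent only for a base at least 1. *)
move=> s0; pose G := (L * (1 + c) `^ (s + 1))%R.
have dE (t : R) x : partial1of2 (fun s x => U x `^ s)%R t x = (ln (U x) * U x `^ t)%R.
  by rewrite partial1of2E; have [_ h] := derU x t; exact: h.
have Is : (`]0%R, (s + 1)%R[%classic : set R) s.
  by rewrite /= in_itv/= s0 ltrDl ltr01.
have intf (t : R) : (`]0%R, (s + 1)%R[%classic : set R) t ->
    P.-integrable setT (EFin \o (fun x => U x `^ t)%R).
  by rewrite /= in_itv/= => /andP[t0 _]; exact: (integrable_powRU P e0 mU Uec (ltW t0)).
have derf (t : R) x : (`]0%R, (s + 1)%R[%classic : set R) t -> setT x ->
    derivable (fun s => U x `^ s)%R t 1%R.
  by move=> _ _; have [] := derU x t.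
have G0 (x : T) : (0 <= cst G x)%R by rewrite mulr_ge0 ?powR_ge0 ?addr_ge0.
have intG : P.-integrable setT (EFin \o cst G) by exact: finite_measure_integrable_cst.
have Gub (t : R) x : (`]0%R, (s + 1)%R[%classic : set R) t -> setT x ->
    (`|partial1of2 (fun s x => U x `^ s) t x| <= cst G x)%R.
  rewrite /= in_itv/= => /andP[t0 t1] _; rewrite dE normrM ler_pM//.
  have /andP[h1 h2] := Uec x; have cx := c_gt0 x.
  rewrite ger0_norm ?powR_ge0// (@le_trans _ _ ((1 + c) `^ t))%R//.
    apply: ge0_ler_powR; rewrite ?nnegrE ?(ltW t0) ?(ltW (U0 x)) ?addr_ge0 ?(ltW cx)//.
    by rewrite (le_trans h2)// lerDr.
  by rewrite ler_powR ?lerDl ?(ltW cx) ?(ltW t1).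
split.
  exact: (derivable_under_integral measurableT Is intf derf G0 intG Gub).
rewrite -derive1E (differentiation_under_integral measurableT Is intf derf G0 intG Gub).
by apply: eq_Rintegral => x _; rewrite dE.
Qed.

(** The L^s norm of U, written as an exponential so as to be differentiated in s. *)
Let v (s : R) : R := expR (s^-1 * ln (N s)).

Let v_powR (s : R) : (0 < s)%R -> (v s `^ s = N s)%R.
Proof.
move=> s0; rewrite /v -expRM mulrAC mulVf ?gt_eqF// mul1r lnK// posrE.
exact: N_gt0 (ltW s0).
Qed.

(** The derivative of ln (N s) / s, multiplied by [v s]. The numerator s N1 - N ln N is the entropy
    of U ^ s, see [entropy_powRU]. *)
Let dv (s : R) := (v s * (s * N1 s - N s * ln (N s)) / (s ^+ 2 * N s))%R.

Let is_derive_v (s : R) : (0 < s)%R -> is_derive s 1%R v (dv s).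
Proof.
move=> s0; have N0 := N_gt0 (ltW s0); have dN := is_derive_N s0.
have dln : is_derive s 1%R (fun t => ln (N t)) ((N s)^-1 * N1 s)%R.
  exact: (@is_derive1_comp R (@ln R) N s _ _ (is_derive1_ln N0) dN).
have s_neq0 : (s != 0)%R by rewrite gt_eqF.
have dV : is_derive s 1%R (fun t : R => t^-1)%R (- s ^- 2)%R.
  have h := @is_deriveV _ (id : R -> R) s _ 1%R s_neq0 (is_derive_id s 1%R).
  by apply: eq_is_derive h _ _ => //; rewrite /GRing.scale/= mulr1.
have dM := is_deriveM dV dln.
have := @is_derive1_comp R expR _ s _ _ (is_derive_expR _) dM.
move=> h; apply: eq_is_derive h _ _ => //.
rewrite /dv /v /GRing.scale/=; field.
by rewrite s_neq0 gt_eqF.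
Qed.

Let entropy_powRU (s : R) : (0 <= s)%R ->
  entropy P (fun x => U x `^ s)%R = (s * N1 s - N s * ln (N s))%R%:E.
Proof.
move=> s0; have N0 := N_gt0 s0.
have iU := integrable_powRU P e0 mU Uec s0.
have iUln : P.-integrable setT (EFin \o (fun x => ln (U x) * U x `^ s)%R).
  apply: (@bounded_RV_integrable _ _ _ _ _ (L * c `^ s)%R).
    by apply: measurable_funM => //; exact: measurable_powRU.
  move=> x; rewrite normrM ler_pM// ger0_norm ?powR_ge0//.
  by have /andP[] := powRU_bound e0 Uec s0 x.
rewrite /entropy expectation.unlock (EFin_Rintegral iU)/= -/(N s).
have h x : (U x `^ s * ln (U x `^ s / N s) =
    s * (ln (U x) * U x `^ s) - ln (N s) * U x `^ s)%R.
  by rewrite ln_div ?posrE ?powR_gt0// ln_powR; ring.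
under eq_integral do rewrite h.
have i1 : P.-integrable setT (EFin \o (fun x => s * (ln (U x) * U x `^ s))%R).
  by apply: eq_integrable (integrableZl measurableT s iUln).
have i2 : P.-integrable setT (EFin \o (fun x => ln (N s) * U x `^ s)%R).
  by apply: eq_integrable (integrableZl measurableT (ln (N s)) iU).
rewrite (EFin_Rintegral (integrableB measurableT i1 i2)).
by rewrite (RintegralB measurableT i1 i2) !RintegralZl// (mulrC (ln _)).
Qed.

Variables (S : T -> \bar R) (K p : R).
Hypotheses (mS : measurable_fun setT S) (S0 : forall x, 0 <= S x).
Hypotheses (K0 : (0 < K)%R) (p1 : (1 <= p)%R).
Hypothesis SK : \int[P]_x (S x) `^ p <= (K `^ p)%:E.
Hypothesis Hent : forall s : R, (1 < s)%R ->
  entropy P (fun x => U x `^ s)%R <=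
  (s ^+ 2)%:E * \int[P]_x ((U x `^ (s - 1))%:E * S x).

Let p0 : (0 < p)%R. Proof. by rewrite (lt_le_trans ltr01). Qed.

(* Lyapunov's inequality, with norms scaled to 1 *)
Let norm_le (s : R) : (1 <= s <= p)%R ->
  \int[P]_x (S x * K^-1%:E) `^ s <= 1.
Proof.
move=> /andP[s1 sp]; have s0 : (0 < s)%R by rewrite (lt_le_trans ltr01).
have KV0 : (0 <= K^-1)%R by rewrite invr_ge0 ltW.
have w0 x : 0 <= S x * K^-1%:E by rewrite mule_ge0 ?lee_fin.
have mw : measurable_fun setT (fun x => S x * K^-1%:E) by exact: emeasurable_funM.
have mwp (r : R) : measurable_fun setT (fun x => (S x * K^-1%:E) `^ r).
  exact: (measurableT_comp (measurable_poweR r)).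
have h x : (S x * K^-1%:E) `^ s <=
    (1 - s / p)%:E * 1 + (s / p)%:E * (S x * K^-1%:E) `^ p.
  have q1 : (1 <= p / s)%R by rewrite ler_pdivlMr// mul1r.
  (* Comparing the s-th and p-th powers is Young's inequality with exponent p / s and first variable
     1. *)
  have := @young_poweR _ (p / s)%R 1%R ((S x * K^-1%:E) `^ s) q1 ler01 (poweR_ge0 _ _).
  rewrite !powR1 mul1e mulr1 invf_div -poweRrM mulrCA divff ?gt_eqF// mulr1.
  by rewrite mule1.
have sp0 : (0 <= s / p)%R by rewrite divr_ge0 ?ltW.
have sp1 : (0 <= 1 - s / p)%R by rewrite subr_ge0 ler_pdivrMr// mul1r.
apply: (@le_trans _ _ (\int[P]_x ((1 - s / p)%:E * cst 1 x + (s / p)%:E * (S x * K^-1%:E) `^ p))).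
  apply: ge0_le_integral => //.
  - by move=> x _; exact: poweR_ge0.
  - by apply: emeasurable_funD; [|exact: emeasurable_funM].
rewrite ge0_integral_lin//; last by move=> x _; exact: poweR_ge0.
rewrite integral_cst//= probability_setT !mule1.
have : \int[P]_x (S x * K^-1%:E) `^ p <= 1.
  under eq_integral do rewrite poweRM ?lee_fin// poweR_EFin muleC.
  have mSp : measurable_fun setT (fun x => S x `^ p).
    exact: (measurableT_comp (measurable_poweR p)).
  have Sp0 x : setT x -> 0 <= S x `^ p by move=> _; exact: poweR_ge0.
  rewrite (ge0_integralZl_EFin _ measurableT Sp0 mSp (powR_ge0 _ _)).
  apply: (@le_trans _ _ ((K^-1 `^ p)%:E * (K `^ p)%:E)).
    by rewrite lee_wpmul2l// lee_fin powR_ge0.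
  by rewrite -EFinM -powRM ?(ltW K0)// mulVf ?gt_eqF// powR1.
move=> hK; apply: (@le_trans _ _ ((1 - s / p)%:E + (s / p)%:E * 1)).
  by rewrite leeD2l// lee_wpmul2l// lee_fin.
by rewrite mule1 -EFinD subrK.
Qed.

(** Hölder's inequality with exponents s / (s - 1) and s, obtained from Young's inequality for U / v
    s and S / K: the first has L^s norm 1, the second at most 1 by [norm_le]. The factor [c1] undoes
    the normalization. *)
Let weighted_le (s : R) : (1 <= s <= p)%R ->
  \int[P]_x ((U x `^ (s - 1))%:E * S x) <= (v s `^ (s - 1) * K)%R%:E.
Proof.
move=> /andP[s1 sp]; have s0 : (0 < s)%R by rewrite (lt_le_trans ltr01).
have KV0 : (0 <= K^-1)%R by rewrite invr_ge0 ltW.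
have v0 : (0 < v s)%R by exact: expR_gt0.
have sV0 : (0 <= s^-1)%R by rewrite invr_ge0 ltW.
have sV1 : (0 <= 1 - s^-1)%R by rewrite subr_ge0 invf_le1.
have w0 x : 0 <= S x * K^-1%:E by rewrite mule_ge0 ?lee_fin.
have mw : measurable_fun setT (fun x => S x * K^-1%:E) by exact: emeasurable_funM.
have mws : measurable_fun setT (fun x => (S x * K^-1%:E) `^ s).
  exact: (measurableT_comp (measurable_poweR s)).
have mUs (r : R) : measurable_fun setT (fun x => (U x `^ r)%:E).
  by apply/measurable_EFinP; exact: measurable_powRU.
pose c1 := (v s `^ (s - 1) * K)%R.
have c10 : (0 <= c1)%R by rewrite mulr_ge0 ?powR_ge0 ?(ltW K0).
have h x : (U x `^ (s - 1))%:E * S x <=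
    (c1 * ((1 - s^-1) / N s))%:E * (U x `^ s)%:E +
    (c1 * s^-1)%:E * (S x * K^-1%:E) `^ s.
  have uv0 : (0 <= U x / v s)%R by rewrite divr_ge0 ?ltW.
  have := young_poweR s1 uv0 (w0 x).
  have c1E : 0 <= c1%:E by rewrite lee_fin.
  move=> /(lee_wpmul2l c1E); rewrite ge0_muleDr; last 2 first.
  - by rewrite lee_fin mulr_ge0 ?powR_ge0.
  - by rewrite mule_ge0 ?poweR_ge0// lee_fin.
  rewrite !powRM ?invr_ge0 ?(ltW (U0 x)) ?(ltW v0)//.
  rewrite -!EFinM !muleA -!EFinM.
  have vV r : ((v s)^-1 `^ r = (v s `^ r)^-1)%R.
    by rewrite -powR_inv1 ?(ltW v0)// -powRrM mulN1r powRN.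
  rewrite !vV v_powR//.
  have -> : (c1 * (U x `^ (s - 1) / v s `^ (s - 1)) = U x `^ (s - 1) * K)%R.
    by rewrite /c1; field; rewrite gt_eqF// powR_gt0.
  have -> : (c1 * ((1 - s^-1) * (U x `^ s / N s)) =
     c1 * ((1 - s^-1) / N s) * U x `^ s)%R by ring.
  by apply: le_trans; rewrite muleAC -EFinM mulfK ?gt_eqF.
have N0 := N_gt0 (ltW s0).
have a0 : (0 <= c1 * ((1 - s^-1) / N s))%R by rewrite mulr_ge0// divr_ge0// ltW.
have b0 : (0 <= c1 * s^-1)%R by rewrite mulr_ge0.
apply: (@le_trans _ _ (\int[P]_x ((c1 * ((1 - s^-1) / N s))%:E * (U x `^ s)%:E +
    (c1 * s^-1)%:E * (S x * K^-1%:E) `^ s))).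
  apply: ge0_le_integral => //.
  - by move=> x _; rewrite mule_ge0// lee_fin powR_ge0.
  - exact: emeasurable_funM.
  - by apply: emeasurable_funD; exact: emeasurable_funM.
rewrite ge0_integral_lin//; last 2 first.
- by move=> x _; rewrite lee_fin powR_ge0.
- by move=> x _; exact: poweR_ge0.
rewrite (EFin_Rintegral (integrable_powRU P e0 mU Uec (ltW s0))) -EFinM -/(N s).
have s1p : (1 <= s <= p)%R by rewrite s1.
apply: (@le_trans _ _ ((c1 * ((1 - s^-1) / N s) * N s)%:E + (c1 * s^-1)%:E * 1)).
  by rewrite leeD2l// lee_wpmul2l ?lee_fin// norm_le.
rewrite mule1 -EFinD lee_fin le_eqVlt; apply/orP; left; apply/eqP.
by rewrite -/c1; field; rewrite !gt_eqF.
Qed.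

(** The slope of [v] is at most K: it is v / (s ^ 2 N) times the entropy of U ^ s, which [Hent] and
    [weighted_le] bound by s ^ 2 v ^ (s - 1) K, and v ^ s = N. The two factors s ^ 2 cancel, so the
    mean value theorem between 1 and p gives growth linear in p. *)
Lemma log_sobolev_moment :
  ((\int[P]_x (U x `^ p)) <= ((\int[P]_x U x) + (p - 1) * K) `^ p)%R.
Proof.
have -> : (\int[P]_x U x = v 1)%R.
  have := v_powR ltr01; rewrite powRr1 ?expR_ge0// => ->.
  by apply: eq_Rintegral => x _; rewrite powRr1// ltW.
rewrite -/(N p) -v_powR//; apply: ge0_ler_powR; rewrite ?nnegrE ?expR_ge0 ?(ltW p0)//.
  by rewrite addr_ge0 ?expR_ge0// mulr_ge0 ?subr_ge0 ?(ltW K0).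
move: p1; rewrite le_eqVlt => /predU1P[<-|p_gt1].
  by rewrite subrr mul0r addr0.
have [| |s] := @MVT R v dv 1%R p p_gt1.
- by move=> s; rewrite in_itv/= => /andP[s1 _]; apply: is_derive_v; rewrite (lt_trans ltr01).
- apply: derivable_within_continuous => s; rewrite in_itv/= => /andP[s1 _].
  exact: (@ex_derive _ _ _ _ _ _ _ (is_derive_v (lt_le_trans ltr01 s1))).
rewrite in_itv/= => /andP[s1 sp] h.
have s0 : (0 < s)%R by rewrite (lt_trans ltr01).
have N0 := N_gt0 (ltW s0).
rewrite -lerBlDl h mulrC ler_wpM2l ?subr_ge0 ?(ltW p_gt1)//.
have s1p : (1 <= s <= p)%R by rewrite !ltW.
have : (s * N1 s - N s * ln (N s) <= s ^+ 2 * (v s `^ (s - 1) * K))%R.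
  rewrite -lee_fin -(entropy_powRU (ltW s0)); apply: (le_trans (Hent s1)).
  rewrite [X in _ <= X]EFinM; apply: lee_wpmul2l; last exact: weighted_le.
  by rewrite lee_fin sqr_ge0.
rewrite /dv ler_pdivrMr ?mulr_gt0 ?exprn_gt0// => hN.
apply: (@le_trans _ _ (v s * (s ^+ 2 * (v s `^ (s - 1) * K))))%R.
  by rewrite ler_wpM2l ?expR_ge0.
have -> : (v s * (s ^+ 2 * (v s `^ (s - 1) * K)) = s ^+ 2 * (v s * v s `^ (s - 1)) * K)%R.
  by ring.
by rewrite mulr_powRB1 ?expR_ge0// v_powR// mulrC.
Qed.

End log_sobolev_moments.

Section functional_log_sobolev.
Local Open Scope ereal_scope.
Context {R : realType} {d : nat} {disp : measure_display} {Omega : measurableType disp}.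
Variables (P : probability Omega R) (A : Rd R d -> Omega -> R).
Hypothesis mA : jointly_measurable A.
Variable weight : R -> R.
Hypothesis weight_ge0 : (forall l : R, 0 <= l -> 0 <= weight l)%R.
Hypothesis mweight : measurable_fun (`[0%R, +oo[ : set R) weight.
Variables (M : set (Rd R d -> R)) (X : (Rd R d -> R) -> R) (G : Rd R d -> Omega -> R).
Hypothesis obsX : fct_observable P A M X G.
Hypotheses (MSG : fct_MSG P A M weight) (MLSI : fct_MLSI P A M weight).

Let S := multiscale weight (fct_field G).

Let mXA : measurable_fun setT (fun w => X (A ^~ w)).
Proof. by have [_ /(field_measurable_fun mA)] := obsX. Qed.

Lemma fct_MLSI_entropy (m e s : R) : (0 < e)%R -> (1 < s)%R ->
  entropy P (fun w => sqtrunc e (X (A ^~ w) - m) `^ s)%R <=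
  (s ^+ 2)%:E * \int[P]_w ((sqtrunc e (X (A ^~ w) - m) `^ (s - 1))%:E * S w).
Proof.
move=> e0 s1; have obs := fct_observable_powtrunc mA obsX m e0 (ltW s1).
have sq w : (powtrunc e s (X (A ^~ w) - m) ^+ 2 = sqtrunc e (X (A ^~ w) - m) `^ s)%R.
  exact: powtrunc_sqr.
have Uec w : (e <= sqtrunc e (X (A ^~ w) - m) <= e + e^-1)%R.
  by rewrite sqtrunc_ge// sqtrunc_ub.
have mU := measurable_sqtruncX m mXA e0.
have s0 : (0 <= s)%R by rewrite (le_trans _ (ltW s1)).
have sqE : (fun w => powtrunc e s (X (A ^~ w) - m) ^+ 2)%R =
    (fun w => sqtrunc e (X (A ^~ w) - m) `^ s)%R by apply/funext => w; exact: sq.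
have Eoo : 'E_P[fun w => (powtrunc e s (X (A ^~ w) - m) ^+ 2)%R] < +oo.
  rewrite sqE expectation.unlock.
  by rewrite (EFin_Rintegral (integrable_powRU P e0 mU Uec s0)) ltry.
have := MLSI obs Eoo; rewrite sqE.
move/le_trans; apply.
exact: (integral_multiscale_powtrunc_le mA weight_ge0 mweight obsX m s e0).
Qed.

Lemma fct_MLSI_moment (p : R) : (1 <= p)%R ->
  centered_moment P (2 * p) (fun w => X (A ^~ w)) <=
  ((2 * p) `^ p)%:E * \int[P]_w (S w) `^ p.
Proof.
move=> p1; have p0 : (0 < p)%R by rewrite (lt_le_trans ltr01).
have mS : measurable_fun setT S := measurable_fct_multiscale weight_ge0 mweight obsX.
have S0 w : 0 <= S w by exact: multiscale_ge0.
have mSp : measurable_fun setT (fun w => S w `^ p).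
  exact: (measurableT_comp (measurable_poweR p)).
set J := \int[P]_w _.
have J0 : 0 <= J by apply: integral_ge0 => w _; exact: poweR_ge0.
have c0 : (0 < (2 * p) `^ p)%R by rewrite powR_gt0 ?mulr_gt0.
have [->|] := eqVneq J +oo; first by rewrite gt0_muley ?leey// lte_fin.
rewrite -ltey => Joo; have Jfin : J \is a fin_num by rewrite ge0_fin_numE.
set m := fine 'E_P[fun w => X (A ^~ w)].
apply/lee_addgt0Pr => eta eta0.
(* [log_sobolev_moment] divides by K, which must be positive even if J = 0. The added term becomes
   exactly eta after multiplication by (2 p) ^ p. *)
pose K := ((fine J + eta / (2 * p) `^ p) `^ p^-1)%R.
have J'0 : (0 < fine J + eta / (2 * p) `^ p)%R.
  by rewrite ltr_wpDl ?fine_ge0// divr_gt0.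
have K0 : (0 < K)%R by rewrite powR_gt0.
have KE : (K `^ p = fine J + eta / (2 * p) `^ p)%R.
  by rewrite /K -powRrM mulVf ?gt_eqF// powRr1// ltW.
have SK : \int[P]_w (S w) `^ p <= (K `^ p)%:E.
  by rewrite KE -/J -{1}(fineK Jfin) lee_fin lerDl divr_ge0// ltW.
have -> : ((2 * p) `^ p)%:E * J + eta%:E = ((2 * p) `^ p * K `^ p)%R%:E.
  rewrite -(fineK Jfin) -EFinM -EFinD KE; congr EFin; field; rewrite gt_eqF//.
have VS := MSG obsX.
have VK : 'V_P[fun w => X (A ^~ w)] <= K%:E.
  have SKp : (\int[P]_w S w) `^ p <= K%:E `^ p.
    by rewrite poweR_EFin (le_trans (probability_jensen_poweR P p1 mS S0)).
  apply: (le_trans VS); rewrite leNgt; apply/negP => KS.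
  have IS0 : 0 <= \int[P]_w S w by apply: integral_ge0.
  move: SKp KS IS0; case: (\int[P]_w S w) => [x| |//]; last first.
    by rewrite poweRyr ?gt_eqF// poweR_EFin leye_eq.
  rewrite !poweR_EFin !lee_fin lte_fin => xK Kx x0.
  by have := gt0_ltr_powR p0 (ltW K0) x0 Kx; rewrite ltNge xK.
have V0 := variance_ge0 P (fun w => X (A ^~ w)).
have Vfin : 'V_P[fun w => X (A ^~ w)] \is a fin_num.
  by rewrite ge0_fin_numE// (le_lt_trans VK)// ltry.
have hv : \int[P]_w ((X (A ^~ w) - m) ^+ 2)%:E = (fine 'V_P[fun w => X (A ^~ w)])%:E.
  by rewrite fineK// varianceE_int.
have vK : (fine 'V_P[fun w => X (A ^~ w)] <= K)%R by rewrite -lee_fin fineK.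
move: (fine 'V_P[_]) hv vK => v hv vK.
rewrite /centered_moment -/m expectation.unlock.
apply: (@centered_moment_le_limit _ _ _ P (fun w => X (A ^~ w)) m p mXA p1 _ (2 `^ p)%R).
  by rewrite lee_fin mulr_ge0 ?powR_ge0.
move=> n; pose e : R := (n.+1%:R^-1)%R.
have e0 : (0 < e)%R by rewrite invr_gt0.
have e1 : (e <= 1)%R by rewrite invf_le1// ler1n.
have mU := measurable_sqtruncX m mXA e0.
have Uec w : (e <= sqtrunc e (X (A ^~ w) - m) <= e + e^-1)%R.
  by rewrite sqtrunc_ge// sqtrunc_ub.
have iU := integrable_powRU P e0 mU Uec.
have := log_sobolev_moment e0 mU Uec mS S0 K0 p1 SK
  (fun s s1 => fct_MLSI_entropy m e0 s1).
rewrite (EFin_Rintegral (iU _ (ltW p0))) -EFinD lee_fin => /le_trans; apply.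
have IU1 : (\int[P]_w sqtrunc e (X (A ^~ w) - m) <= e + v)%R.
  rewrite -lee_fin -EFin_Rintegral; last first.
    apply: (@bounded_RV_integrable _ _ _ _ _ (e + e^-1)%R) => // w.
    by rewrite ger0_norm ?(ltW (sqtrunc_gt0 _ e0))//; have /andP[] := Uec w.
  exact: integral_sqtrunc_le.
have pK0 : (0 <= p * K)%R by rewrite mulr_ge0 ?(ltW p0) ?(ltW K0).
(* The mean of U is at most e + Var X <= e + K, so that adding (p - 1) K gives e + p K. *)
apply: (@le_trans _ _ ((e + p * K) `^ p))%R.
  apply: ge0_ler_powR; rewrite ?nnegrE ?(ltW p0) ?addr_ge0 ?(ltW e0)//.
  - by apply: Rintegral_ge0 => w _; rewrite ltW// sqtrunc_gt0.
  - by rewrite mulr_ge0 ?subr_ge0 ?(ltW K0).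
  - by rewrite mulrBl mul1r; lra.
apply: (le_trans (powRD_le_small p1 e0 e1 pK0)).
have p_ge0 := ltW p0; have K_ge0 := ltW K0.
by rewrite mulrDr -powRM// -powRM ?mulr_ge0// mulrA.
Qed.

End functional_log_sobolev.

(** * Oscillation *)

Section conditional_essential_supremum.
Context {R : realType} {d : nat} {disp : measure_display} {Omega : measurableType disp}.
Variables (P : probability Omega R) (A : Rd R d -> Omega -> R).
Hypothesis mA : jointly_measurable A.
Implicit Types (S : set (Rd R d)) (Y : Omega -> R).

(** A dominating variable measurable for the smaller sigma-algebra also competes in the minimality
    for the larger one. *)
Lemma cond_ess_sup_subset S S' Y M M' : S `<=` S' ->
  is_cond_ess_sup P A S Y M -> is_cond_ess_sup P A S' Y M' ->
  {ae P, forall w, (M' w <= M w)%E}.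
Proof.
move=> SS' [mM YM _] [_ _ minM']; apply: minM' YM.
exact: field_measurable_subset SS' mM.
Qed.

(* Minimize the expectation among the dominating conditioning-measurable random
   variables: the infimum of a minimizing sequence is a minimizer, and it lies
   almost surely below its minimum with any other competitor. *)
Lemma cond_ess_sup_exists S Y c : 0 <= c -> measurable_fun setT Y ->
  (forall w, `|Y w| <= c) ->
  exists N : Omega -> R, is_cond_ess_sup P A S Y (EFin \o N).
Proof.
move=> c0 mY Yc.
pose F := [set N : Omega -> R | [/\ field_measurable A S N,
  (forall w, `|N w| <= c) & {ae P, forall w, Y w <= N w}]].
have mF N : F N -> measurable_fun setT N.
  by move=> [/(field_measurable_fun mA)].
have intF N : F N -> P.-integrable setT (EFin \o N).
  by move=> FN; apply: (@bounded_RV_integrable _ _ _ _ _ c); [exact: mF|by have [_ ?] := FN].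
have Fc : F (cst c).
  split=> [|v|]; [exact: measurable_cst|by rewrite ger0_norm|].
  by apply: aeW => v; rewrite (le_trans (ler_norm _)).
pose E := [set (\int[P]_w N w)%R | N in F].
have lbE : lbound E (- c).
  move=> _ [N FN <-]; rewrite -[leLHS](@Rintegral_prob_cst _ _ _ P).
  apply: le_Rintegral => //; first exact: (finite_measure_integrable_cst P (- c)).
    exact: intF.
  by move=> w _; have [_ /(_ w)] := FN; rewrite ler_norml => /andP[].
have infE : has_inf E by split; [exists (\int[P]_w c)%R, (cst c)|exists (- c)].
have /choice[N_ FN_] (k : nat) : exists N, F N /\ (\int[P]_w N w)%R < inf E + k.+1%:R^-1.
  have k0 : 0 < k.+1%:R^-1 :> R by rewrite invr_gt0.
  by have [_ [N FN <-] h] := inf_adherent k0 infE; exists N.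
have FNk k : F (N_ k) by have [] := FN_ k.
(* At index 0, [einfs] is the infimum of the whole sequence. *)
pose EN w := einfs (fun k => (N_ k w)%:E) 0.
have EN_le k w : (EN w <= (N_ k w)%:E)%E.
  by apply: ereal_inf_lbound; exists k.
have EN_ge w : ((- c)%:E <= EN w)%E.
  apply: le_ereal_inf_tmp => _ [k _ <-]; rewrite lee_fin.
  by have [_ /(_ w)] := FNk k; rewrite ler_norml => /andP[].
have EN_fin w : EN w \is a fin_num.
  rewrite fin_numElt (lt_le_trans _ (EN_ge w)) ?ltNyr//.
  by rewrite (le_lt_trans (EN_le 0%N w)) ?ltry.
pose N w := fine (EN w).
have NE w : (N w)%:E = EN w by rewrite fineK.
have NN k w : N w <= N_ k w by rewrite -lee_fin NE.
have FN : F N.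
  split.
  - apply: (measurableT_comp (f := fine)) => //.
    apply: (@measurable_fun_einfs _ (sigma_field A S) R setT (fun k w => (N_ k w)%:E)) => k.
    by apply/measurable_EFinP; have [] := FNk k.
  - move=> w; rewrite ler_norml -!lee_fin NE EN_ge (le_trans (EN_le 0%N w))// lee_fin.
    by have [_ /(_ w)] := FNk 0%N; rewrite ler_norml => /andP[].
  - have : {ae P, forall w, forall k, Y w <= N_ k w}.
      by apply: ae_foralln => k; have [] := FNk k.
    apply: filterS => w h; rewrite -lee_fin NE.
    by apply: le_ereal_inf_tmp => _ [k _ <-]; rewrite lee_fin.
have RN_min N' : F N' -> (\int[P]_w N w <= \int[P]_w N' w)%R.
  move=> FN'; have h : inf E <= (\int[P]_w N' w)%R.
    by apply: ge_inf; [by case: infE|exists N'].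
  apply: le_trans h; apply/ler_addgt0Pr => eta eta0.
  have [k hk] : exists k : nat, k.+1%:R^-1 < eta.
    have [k _ /(_ k (leqnn k)) hk] := near_infty_natSinv_lt (PosNum eta0).
    by exists k.
  have [_ /ltW hN] := FN_ k.
  apply: (@le_trans _ _ (\int[P]_w N_ k w)%R).
    by apply: le_Rintegral => //; exact: intF.
  by rewrite (le_trans hN)// lerD2l ltW.
exists N; split.
- by apply/measurable_EFinP; have [] := FN.
- by have [_ _] := FN; apply: filterS => w; rewrite lee_fin.
move=> M' mM' YM'.
(* The competitor [M'] may be infinite. Clipped to [-c, c] it still dominates Y almost surely,
   because |Y| <= c, and its minimum with N belongs to [F]. *)
pose K w := fine (maxe (- c)%:E (mine c%:E (M' w))).
have KE w : (K w)%:E = maxe (- c)%:E (mine c%:E (M' w)).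
  rewrite fineK// fin_numElt; apply/andP; split.
    by rewrite lt_max ltNyr.
  by rewrite gt_max ltry gt_min ltry.
have K_le w : K w <= c.
  by rewrite -lee_fin KE ge_max lee_fin ge0_cp// ge_min lexx.
have K_ge w : - c <= K w by rewrite -lee_fin KE le_max lexx.
pose N' w := Num.min (N w) (K w).
have FN' : F N'.
  split.
  - apply: (@measurable_minr _ (sigma_field A S)); first by have [] := FN.
    apply: (measurableT_comp (f := fine)) => //.
    apply: (@measurable_maxe _ (sigma_field A S)); first exact: measurable_cst.
    by apply: (@measurable_mine _ (sigma_field A S)); first exact: measurable_cst.
  - move=> w; rewrite ler_norml le_min ge_min K_ge K_le orbT !andbT.
    by have [_ /(_ w)] := FN; rewrite ler_norml => /andP[].
  - have [_ _ YN] := FN; move: YN YM'; apply: filterS2 => w YN YM'.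
    rewrite le_min YN/= -lee_fin KE le_max le_min YM' !lee_fin.
    by rewrite (le_trans (ler_norm _) (Yc w)) orbT.
have NN' w : N' w <= N w by rewrite ge_min lexx.
have iN := intF _ FN; have iN' := intF _ FN'.
have intB : (\int[P]_w (N w - N' w)%R%:E = 0)%E.
  rewrite (EFin_Rintegral (integrableB measurableT iN iN')); congr EFin.
  rewrite (RintegralB measurableT iN iN'); apply/eqP; rewrite subr_eq0 eq_le RN_min//=.
  exact: le_Rintegral.
have {}intB : (\int[P]_w `|(N w - N' w)%R%:E| = 0)%E.
  by rewrite -[RHS]intB; apply: eq_integral => w _; rewrite gee0_abs// lee_fin subr_ge0.
have mB : measurable_fun setT (fun w => (N w - N' w)%R%:E).
  by apply/measurable_EFinP; apply: measurable_funB; exact: mF.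
have /(ae_eq_integral_abs _ measurableT mB) := intB.
move=> h; move: h YM'; apply: filterS2 => w /(_ I)[/eqP]; rewrite subr_eq0 => /eqP NN'w YM'.
have : N w <= K w by rewrite NN'w ge_min lexx orbT.
rewrite -lee_fin KE => /le_trans; apply.
rewrite ge_max (le_trans _ YM'); last first.
  by rewrite lee_fin; have := Yc w; rewrite ler_norml => /andP[].
by rewrite ge_min lexx orbT.
Qed.

End conditional_essential_supremum.

Section oscillation.
Context {R : realType} {d : nat} {disp : measure_display} {Omega : measurableType disp}.
Variables (P : probability Omega R) (A : Rd R d -> Omega -> R).
Hypothesis mA : jointly_measurable A.
Implicit Types (S : set (Rd R d)) (X : Omega -> R).

Lemma osc_subset S S' X D D' : S `<=` S' ->
  is_osc P A S X D -> is_osc P A S' X D' -> {ae P, forall w, (D w <= D' w)%E}.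
Proof.
move=> SS' [M1 [M2 [h1 h2 hD]]] [M1' [M2' [h1' h2' hD']]].
have CS : ~` S' `<=` ~` S by exact: subsetC.
near=> w.
have -> : D w = (M1 w + M2 w)%E by near: w.
have -> : D' w = (M1' w + M2' w)%E by near: w.
by apply: leeD; near: w; [exact: cond_ess_sup_subset CS h1' h1|
  exact: cond_ess_sup_subset CS h2' h2].
Unshelve. all: by end_near. Qed.

Lemma osc_ge0 S X D : is_osc P A S X D -> {ae P, forall w, (0 <= D w)%E}.
Proof.
move=> [M1 [M2 [[_ h1 _] [_ h2 _] hD]]].
near=> w.
have -> : D w = (M1 w + M2 w)%E by near: w.
have -> : 0%E = ((X w)%:E + (- X w)%:E)%E by rewrite -EFinD subrr.
by apply: leeD; near: w.
Unshelve. all: by end_near. Qed.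

Lemma osc_eq_ae S X D D' : is_osc P A S X D -> {ae P, forall w, D' w = D w} ->
  is_osc P A S X D'.
Proof.
move=> [M1 [M2 [h1 h2 hD]]] h; exists M1, M2; split => //.
by near=> w; transitivity (D w); near: w.
Unshelve. all: by end_near. Qed.

Lemma osc_exists S X c : 0 <= c -> measurable_fun setT X -> (forall w, `|X w| <= c) ->
  exists2 D : Omega -> \bar R, is_osc P A S X D &
    measurable_fun setT D /\ forall w, (0 <= D w)%E.
Proof.
move=> c0 mX Xc.
have [N1 h1] := cond_ess_sup_exists P mA (~` S) c0 mX Xc.
have mXN : measurable_fun setT (fun w => - X w) by exact: measurable_funN.
have [|N2 h2] := cond_ess_sup_exists P mA (~` S) c0 mXN.
  by move=> w; rewrite normrN.
have mN (N : Omega -> R) Y : is_cond_ess_sup P A (~` S) Y (EFin \o N) -> measurable_fun setT (EFin \o N).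
  by move=> [/(field_measurable_fun mA)].
pose D0 w := ((N1 w)%:E + (N2 w)%:E)%E.
have oD0 : is_osc P A S X D0.
  by exists (EFin \o N1), (EFin \o N2); split => //; exact: aeW.
(* [osc_ge0] holds almost surely only; the maximum with 0 is a version that is nonnegative
   everywhere. *)
exists (fun w => maxe 0%E (D0 w)).
  have ge0 := osc_ge0 oD0; apply: osc_eq_ae oD0 _; move: ge0.
  by apply: filterS => w h; exact/max_idPr.
split; last by move=> w; rewrite le_max lexx.
apply: measurable_maxe => //.
by apply: emeasurable_funD; [exact: mN h1|exact: mN h2].
Qed.

(* Compare phi (X) with phi (c) where c is the conditional essential infimum of X. *)
Lemma osc_lipschitz S X (phi h : R -> R) (k q : R) D D' :
  measurable_fun setT phi -> measurable_fun setT h ->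
  (forall a, 0 <= h a) -> (forall a b, `|h a - h b| <= `|a - b|) ->
  0 < k -> 0 <= q ->
  (forall a b, `|phi a - phi b| <= k * Num.max (h a) (h b) `^ q * `|a - b|) ->
  is_osc P A S X D -> is_osc P A S (phi \o X) D' ->
  {ae P, forall w, (D' w <= (2 * k)%:E * ((h (X w))%:E + 2%:E * D w) `^ q * D w)%E}.
Proof.
move=> mphi mh h0 hlip k0 q0 philip [M1 [M2 [[mM1 XM1 _] [mM2 XM2 _] hD]]].
move=> [M1' [M2' [[_ _ min1] [_ _ min2] hD']]].
pose b w := (M1 w \is a fin_num) && (M2 w \is a fin_num).
pose c w := - fine (M2 w).
(* Since h (X) is not measurable for the conditioning sigma-algebra, Q is built from h (c) and the
   oscillation D = M1 + M2. Then phi (c) + Q and - phi (c) + Q are competitors for the conditional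
   suprema of phi (X) and - phi (X); in their sum phi (c) cancels and 2 Q remains. Only at the end
   is h (c) + D replaced by h (X) + 2 D. *)
pose Q w := (if b w then (k * (h (c w) + (fine (M1 w) + fine (M2 w))) `^ q *
  (fine (M1 w) + fine (M2 w)))%:E else +oo)%E.
pose F := sigma_field A (~` S).
have mf1 : measurable_fun [set: F] (fun w : F => fine (M1 w)).
  exact: (measurableT_comp (f := fine)).
have mf2 : measurable_fun [set: F] (fun w : F => fine (M2 w)).
  exact: (measurableT_comp (f := fine)).
have mc : measurable_fun [set: F] (c : F -> R) by exact: measurable_funN.
have mb : measurable_fun [set: F] (b : F -> bool).
  apply: measurable_and.
    apply: (measurable_fun_bool true); rewrite setTI -[X in measurable X]setTI.
    exact: (emeasurable_fin_num measurableT mM1).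
  apply: (measurable_fun_bool true); rewrite setTI -[X in measurable X]setTI.
  exact: (emeasurable_fin_num measurableT mM2).
have mQ : measurable_fun [set: F] (Q : F -> \bar R).
  apply: measurable_fun_ifT => //.
  apply/measurable_EFinP; apply: measurable_funM; last exact: measurable_funD.
  apply: measurable_funM => //; apply: (measurableT_comp (measurable_powR q)).
  apply: measurable_funD; last exact: measurable_funD.
  exact: measurableT_comp.
have mphic : measurable_fun [set: F] (fun w : F => (phi (c w))%:E).
  by apply/measurable_EFinP; exact: measurableT_comp.
have bnd : {ae P, forall w, b w -> [/\ 0 <= fine (M1 w) + fine (M2 w),
    h (c w) <= h (X w) + (fine (M1 w) + fine (M2 w)) &
    `|phi (X w) - phi (c w)| <= k * (h (c w) + (fine (M1 w) + fine (M2 w))) `^ q *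
      (fine (M1 w) + fine (M2 w))]}.
  near=> w => /andP[f1 f2].
  have l1 : X w <= fine (M1 w) by rewrite -lee_fin fineK//; near: w.
  have l2 : - X w <= fine (M2 w) by rewrite -lee_fin fineK//; near: w.
  have Xc : `|X w - c w| <= fine (M1 w) + fine (M2 w).
    by rewrite /c opprK ger0_norm ?lerD2r// -lerBlDl sub0r.
  have D0 : 0 <= fine (M1 w) + fine (M2 w) by rewrite (le_trans _ Xc).
  have hXc := le_trans (hlip (X w) (c w)) Xc.
  split => //.
    by rewrite -lerBlDl (le_trans _ hXc)// distrC ler_norm.
  apply: (le_trans (philip _ _)); rewrite ler_pM ?mulr_ge0 ?powR_ge0 ?(ltW k0)//.
  rewrite ler_wpM2l ?(ltW k0)//; apply: ge0_ler_powR; rewrite ?nnegrE//.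
  - by rewrite le_max h0.
  - by rewrite addr_ge0.
  rewrite ge_max lerDl D0 andbT -lerBlDl.
  by rewrite (le_trans _ hXc)// ler_norm.
have bnd1 : {ae P, forall w, (M1' w <= (phi (c w))%:E + Q w)%E}.
  apply: min1; first exact: emeasurable_funD.
  move: bnd; apply: filterS => w; rewrite /Q; case: ifPn => [_ /(_ isT)[_ _ h1]|_ _].
    by rewrite -EFinD lee_fin -lerBlDl (le_trans _ h1)// ler_norm.
  by rewrite addey// leey.
have bnd2 : {ae P, forall w, (M2' w <= (- phi (c w))%:E + Q w)%E}.
  apply: min2.
    apply: emeasurable_funD => //.
    by apply/measurable_EFinP; apply: measurable_funN; exact: measurableT_comp.
  move: bnd; apply: filterS => w; rewrite /Q; case: ifPn => [_ /(_ isT)[_ _ h1]|_ _].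
    by rewrite -EFinD lee_fin -lerBlDl opprK (le_trans _ h1)// addrC distrC ler_norm.
  by rewrite addey// leey.
near=> w.
have -> : D w = (M1 w + M2 w)%E by near: w.
have -> : D' w = (M1' w + M2' w)%E by near: w.
have l1 : ((X w)%:E <= M1 w)%E by near: w.
have l2 : ((- X w)%:E <= M2 w)%E by near: w.
apply: (@le_trans _ _ ((phi (c w))%:E + Q w + ((- phi (c w))%:E + Q w))%E).
  by apply: leeD; near: w.
have : b w -> [/\ 0 <= fine (M1 w) + fine (M2 w),
    h (c w) <= h (X w) + (fine (M1 w) + fine (M2 w)) &
    `|phi (X w) - phi (c w)| <= k * (h (c w) + (fine (M1 w) + fine (M2 w))) `^ q *
      (fine (M1 w) + fine (M2 w))] by near: w.
rewrite /Q; case: ifPn => [bw /(_ isT)[D0 hc _]|].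
  move: bw; rewrite /b => /andP[f1 f2].
  have -> : (M1 w + M2 w = (fine (M1 w) + fine (M2 w))%:E)%E by rewrite EFinD !fineK.
  rewrite -(EFinM 2) -(EFinD (h _)) poweR_EFin -!EFinM -!EFinD lee_fin.
  move: (fine (M1 w) + fine (M2 w)) D0 hc => D0 D0_ge0 hc.
  rewrite [leLHS](_ : _ = 2 * k * (h (c w) + D0) `^ q * D0); last by ring.
  rewrite ler_wpM2r// ler_wpM2l ?mulr_ge0 ?(ltW k0)//; apply: ge0_ler_powR; rewrite ?nnegrE//.
  - by rewrite addr_ge0.
  - by rewrite addr_ge0// mulr_ge0.
  by rewrite mulr2n mulrDl mul1r addrA lerD2r.
rewrite negb_and => nb _.
(* Both suprema dominate finite values, so neither is -oo and no indeterminate sum arises. *)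
have -> : (M1 w + M2 w = +oo)%E.
  by move: l1 l2 nb; case: (M1 w) => [x| |]; case: (M2 w) => [y| |].
rewrite [leRHS](_ : _ = +oo%E) ?leey//.
have k20 : (0 < (2 * k)%:E)%E by rewrite lte_fin mulr_gt0.
have -> : ((h (X w))%:E + 2%:E * +oo = +oo)%E by rewrite gt0_muley ?lte_fin// addey.
(* For q = 0 the power of +oo is 1, and the remaining factor D makes the product infinite. *)
have [->|qn0] := eqVneq q 0; first by rewrite poweRe0 mule1 gt0_muley.
by rewrite poweRyr// !gt0_muley.
Unshelve. all: by end_near. Qed.

End oscillation.

(** * Geometry and volume of Euclidean balls *)

Section euclidean_balls.
Context {R : realType} {d : nat}.
Implicit Types (x y z : Rd R d) (r s : R).

(** With the notation of the proof, B (A B - C ^ 2) is the sum of the squares of B a_i - C b_i. If B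
    = 0, all the b_i vanish. *)
Lemma sum_cauchy_schwarz (a b : 'I_d -> R) :
  (\sum_i a i * b i) ^+ 2 <= (\sum_i a i ^+ 2) * (\sum_i b i ^+ 2).
Proof.
set A := \sum_i a i ^+ 2; set B := \sum_i b i ^+ 2; set C := \sum_i a i * b i.
have B0 : 0 <= B by apply: sumr_ge0 => i _; exact: sqr_ge0.
have h : 0 <= B * (A * B - C ^+ 2).
  have -> : B * (A * B - C ^+ 2) = \sum_i (B * a i - C * b i) ^+ 2.
    transitivity (\sum_i (B ^+ 2 * a i ^+ 2 - 2 * B * C * (a i * b i) + C ^+ 2 * b i ^+ 2)).
      by rewrite big_split/= sumrB -!mulr_sumr -/A -/B -/C; ring.
    by apply: eq_bigr => i _; ring.
  by apply: sumr_ge0 => i _; exact: sqr_ge0.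
move: B0; rewrite le_eqVlt => /predU1P[B0|B0]; last first.
  by move: h; rewrite pmulr_rge0// subr_ge0.
have b0 i : b i = 0.
  apply/eqP; rewrite -sqrf_eq0; apply/eqP.
  by move/esym/psumr_eq0P : B0; apply => // j _; exact: sqr_ge0.
have -> : C = 0 by rewrite /C big1// => i _; rewrite b0 mulr0.
by rewrite -B0 mulr0 expr0n.
Qed.

Lemma edist_triangle x y z : edist x z <= edist x y + edist y z.
Proof.
pose a i : R := tnth x i - tnth y i; pose b i : R := tnth y i - tnth z i.
have Sge0 (f : 'I_d -> R) : 0 <= \sum_i f i ^+ 2.
  by apply: sumr_ge0 => i _; exact: sqr_ge0.
rewrite /edist -[X in _ <= X + _]/(Num.sqrt (\sum_i a i ^+ 2)).
rewrite -[X in _ <= _ + X]/(Num.sqrt (\sum_i b i ^+ 2)).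
rewrite (_ : \sum_i _ = \sum_i (a i + b i) ^+ 2); last first.
  by apply: eq_bigr => i _; rewrite /a /b addrA subrK.
rewrite -ler_sqr ?nnegrE ?sqrtr_ge0 ?addr_ge0 ?sqrtr_ge0//.
rewrite sqr_sqrtr// sqrrD !sqr_sqrtr//.
have -> : \sum_i (a i + b i) ^+ 2 =
    \sum_i a i ^+ 2 + (\sum_i a i * b i) *+ 2 + \sum_i b i ^+ 2.
  by rewrite -sumrMnl -!big_split; apply: eq_bigr => i _; rewrite sqrrD.
rewrite lerD2r lerD2l lerMn2r/= -sqrtrM//.
rewrite (le_trans (ler_norm _))// -sqrtr_sqr ler_wsqrtr//.
exact: sum_cauchy_schwarz.
Qed.

Lemma eball_subset x y r s : edist x y + s <= r -> eball y s `<=` eball x r.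
Proof.
move=> h z; rewrite /eball /= => yz; apply: le_lt_trans (edist_triangle x y z) _.
by apply: lt_le_trans h; rewrite ltrD2l.
Qed.

Definition ebox x s : set (Rd R d) :=
  [set y | forall i, (tnth y i : R) \in `](tnth x i : R) - s, (tnth x i : R) + s[].

Hypothesis d0 : (0 < d)%N.

(** Each coordinate differs by less than r / d, and d (r / d) ^ 2 <= r ^ 2. The cube serves twice:
    to approximate points by rational ones and to bound the volume of a ball from below. *)
Lemma ebox_subset_eball x r : 0 < r -> ebox x (r / d%:R) `<=` eball x r.
Proof.
move=> r0 y xy; rewrite /eball/= /edist.
have dR : 0 < d%:R :> R by rewrite ltr0n.
rewrite -[ltRHS](ger0_norm (ltW r0)) -sqrtr_sqr ltr_sqrt ?exprn_gt0//.
apply: (@lt_le_trans _ _ (\sum_(i < d) (r / d%:R) ^+ 2)).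
  apply: ltr_sum; first by apply/hasP; exists (Ordinal d0) => //; exact: mem_index_enum.
  move=> i _; rewrite -real_normK ?num_real// ltrXn2r ?nnegrE ?divr_ge0 ?(ltW r0)//.
  have := xy i; rewrite in_itv/= => /andP[h1 h2].
  by rewrite distrC ltr_distl h1.
rewrite sumr_const card_ord -[leLHS]mulr_natr exprMn -mulrA ler_piMr ?sqr_ge0//.
by rewrite exprVn expr2 invfM -mulrA mulVf ?gt_eqF// mulr1 invf_le1// ler1n.
Qed.

Lemma rat_dense_Rd x r : 0 < r ->
  exists q : d.-tuple rat, edist x [tuple (ratr (tnth q i) : R) | i < d] < r.
Proof.
move=> r0; have dR : 0 < d%:R :> R by rewrite ltr0n.
have rd : 0 < r / d%:R by rewrite divr_gt0.
have /choice[q qx] (i : 'I_d) : exists q : rat,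
    (ratr q : R) \in `](tnth x i : R) - r / d%:R, (tnth x i : R) + r / d%:R[.
  have [|q] := @rat_in_itvoo R (tnth x i - r / d%:R) (tnth x i + r / d%:R).
    by rewrite ltrD2l gtrN.
  by exists q.
exists [tuple q i | i < d]; apply: ebox_subset_eball => // i.
by rewrite !tnth_mktuple.
Qed.

End euclidean_balls.

Section volume_of_balls.
Context {R : realType}.

Lemma measurable_ebox n (x : Rd R n) (s : R) : measurable (ebox x s).
Proof.
rewrite (_ : ebox x s = \bigcap_(i in [set: 'I_n]) ((fun y : Rd R n => tnth y i) @^-1`
    `](tnth x i : R) - s, (tnth x i : R) + s[%classic)); last first.
  by apply/seteqP; split=> y /= h i; [move=> _|]; have := h i; rewrite /= ?inE; [|apply].
apply: fin_bigcap_measurable; first exact: finite_finset.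
move=> i _; rewrite -[X in measurable X]setTI.
exact: (measurable_tnth i measurableT).
Qed.

(** Induction along the construction of [lebesgue_Rd]: the preimage of a cube under [cons_pair] is
    an interval times a cube of one dimension less. *)
Lemma lebesgue_ebox n (x : Rd R n) (s : R) : 0 <= s ->
  lebesgue_Rd R n (ebox x s) = ((2 * s) ^+ n)%:E.
Proof.
move=> s0; elim: n x => [|n IH] x.
  rewrite (_ : ebox x s = setT); last by apply/seteqP; split=> // y _ [].
  by rewrite /= diracT expr0.
case/tupleP: x => a x.
have pre : (@cons_pair R n) @^-1` (ebox [tuple of a :: x] s) =
    `](a : R) - s, (a : R) + s[%classic `*` ebox x s.
  apply/seteqP; split=> -[b y]; rewrite /ebox/=.
    move=> h; split; first by have := h ord0; rewrite !tnth0.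
    by move=> i; have := h (lift ord0 i); rewrite !tnthS.
  move=> [h0 h1] i; have [j ->|->] := unliftP ord0 i; last by rewrite !tnth0.
  by rewrite !tnthS.
have := measurable_ebox x s => mB.
have lv : lebesgue_measure (`](a : R) - s, (a : R) + s[%classic : set R) = (2 * s)%:E.
  rewrite lebesgue_measure_itv/= lte_fin.
  have [->|sn0] := eqVneq s 0; first by rewrite subr0 addr0 ltxx mulr0.
  have s_gt0 : 0 < s by rewrite lt0r sn0.
  rewrite ltrBlDr ltr_wpDr ?addr_gt0//; last by rewrite ltrDl.
  by rewrite -EFinD; congr EFin; ring.
rewrite /= /lebesgue_cons /pushforward pre product_measure1E//.
rewrite exprS EFinM; congr (_ * _)%E; [exact: lv|exact: IH].
Qed.

(** Only the order r ^ n matters, so the volume of an inscribed cube is enough. This is the origin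
    of (2 / d) ^ d in the constant for the oscillation. *)
Lemma lebesgue_eball_ge n (x : Rd R n) (r : R) : (0 < n)%N -> 0 < r ->
  (((2 / n%:R) ^+ n * r ^+ n)%:E <= lebesgue_Rd R n (eball x r))%E.
Proof.
move=> n0 r0; have nR : 0 < n%:R :> R by rewrite ltr0n.
have rn : 0 <= r / n%:R by rewrite divr_ge0// ltW.
apply: (@le_trans _ _ (lebesgue_Rd R n (ebox x (r / n%:R)))).
  by rewrite lebesgue_ebox// -exprMn mulrAC mulrA.
apply: le_measure; rewrite ?inE; [exact: measurable_ebox|exact: measurable_eball|].
exact: ebox_subset_eball.
Qed.

End volume_of_balls.

(** * A jointly measurable version of the oscillation *)

Section jointly_measurable_oscillation.
Context {R : realType} {d : nat} {disp : measure_display} {Omega : measurableType disp}.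
Variables (P : probability Omega R) (A : Rd R d -> Omega -> R).
Hypotheses (mA : jointly_measurable A) (d0 : (0 < d)%N).
Variables (X : Omega -> R) (c : R).
Hypotheses (c0 : 0 <= c) (mX : measurable_fun setT X) (Xc : forall w, `|X w| <= c).

(** With [rad], an enumeration of the balls with rational centre and radius. Integers that code
    nothing yield the empty ball of radius 0. *)
Let ctr (n : nat) : Rd R d :=
  if @unpickle (d.-tuple rat * rat)%type n is Some i
  then [tuple (ratr (tnth i.1 j) : R) | j < d] else origin.

Let rad (n : nat) : R :=
  if @unpickle (d.-tuple rat * rat)%type n is Some i then ratr i.2 else 0.

(* The supremum of the oscillations over the rational balls strictly inside
   eball x r is jointly measurable and nondecreasing in r; it is squeezed by
   the oscillation between its values and its right limits in r, which differ
   at most countably often. *)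
Lemma osc_field_exists : exists D, is_osc_field P A X D.
Proof.
have /choice[osc oscP] (n : nat) : exists D : Omega -> \bar R,
    [/\ is_osc P A (eball (ctr n) (rad n)) X D, measurable_fun setT D &
    forall w, (0 <= D w)%E].
  have [D oD [mD D0]] := osc_exists P mA (eball (ctr n) (rad n)) c0 mX Xc.
  by exists D.
(* By the triangle inequality the test implies inclusion in eball x r, and unlike inclusion it is
   visibly measurable in (r, x). Balls failing it contribute 0, harmless below a nonnegative
   oscillation. *)
pose f n (r : R) x w := if edist x (ctr n) + rad n < r then osc n w else 0%E.
pose L r x w := esups (fun n => f n r x w) 0.
have mf n : measurable_fun [set: R * Rd R d * Omega] (fun z => f n z.1.1 z.1.2 z.2).
  apply: measurable_fun_ifT => //; last first.
    by have [_ mO _] := oscP n; exact: (measurableT_comp mO measurable_snd).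
  apply: measurable_fun_ltr.
    apply: measurable_funD => //.
    apply: (measurableT_comp (f := fun z : Rd R d * Rd R d => edist z.1 z.2)
      (g := fun z : R * Rd R d * Omega => (z.1.2, ctr n))).
      exact: measurable_edist.
    apply: measurable_fun_pair => //.
    exact: (measurableT_comp measurable_snd measurable_fst).
  exact: (measurableT_comp measurable_fst measurable_fst).
have mL : measurable_fun [set: R * Rd R d * Omega] (fun z => L z.1.1 z.1.2 z.2).
  exact: measurable_fun_esups.
have L_nd (r t : R) x w : r <= t -> (L r x w <= L t x w)%E.
  move=> rt; apply: ge_ereal_sup => _ [n _ <-].
  apply: (@le_trans _ _ (f n t x w)); last by apply: ereal_sup_ubound; exists n.
  rewrite /f; have [_ _ On0] := oscP n.
  have [h|_] := ltP _ r; last by case: ifP.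
  by rewrite (lt_le_trans h rt).
have L_le (r : R) x D : is_osc P A (eball x r) X D -> {ae P, forall w, (L r x w <= D w)%E}.
  move=> oD; have h : {ae P, forall w, forall n, (f n r x w <= D w)%E}.
    apply: ae_foralln => n; rewrite /f; have [oO _ _] := oscP n.
    have [h|_] := ltP _ r; last exact: osc_ge0 oD.
    by apply: osc_subset oO oD; apply: eball_subset; exact: ltW.
  by move: h; apply: filterS => w h; apply: ge_ereal_sup => _ [n _ <-].
have L_ge (r t : R) x D : r < t -> is_osc P A (eball x r) X D ->
    {ae P, forall w, (D w <= L t x w)%E}.
  (* A rational centre within eta of x and a rational radius between r + eta and r + 2 eta give a
     ball that contains eball x r and passes the test for t = r + 3 eta. *)
  move=> rt oD; pose eta := (t - r) / 3.
  have eta0 : 0 < eta by rewrite divr_gt0// subr_gt0.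
  have [q xq] := rat_dense_Rd d0 x eta0.
  have [|s] := @rat_in_itvoo R (r + eta) (r + 2 * eta); first by rewrite ltrD2l; lra.
  rewrite in_itv/= => /andP[s1 s2].
  pose n := pickle (q, s).
  have nq : ctr n = [tuple (ratr (tnth q i) : R) | i < d] by rewrite /ctr pickleK.
  have ns : rad n = ratr s by rewrite /rad pickleK.
  have [oO _ _] := oscP n.
  have fn w : f n t x w = osc n w.
    by rewrite /f nq ns ifT//; move: xq s2; rewrite /eta; lra.
  have sub : eball x r `<=` eball (ctr n) (rad n).
    by apply: eball_subset; rewrite edistC nq ns; move: xq s1; lra.
  move: (osc_subset sub oD oO).
  apply: filterS => w /le_trans; apply; rewrite -(fn w).
  by apply: ereal_sup_ubound; exists n.
pose Lr (r : R) x w := einfs (fun k => L (r + k.+1%:R^-1) x w) 0.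
have L0 r x w : (0 <= L r x w)%E.
  apply: (@le_trans _ _ (f 0%N r x w)); last by apply: ereal_sup_ubound; exists 0%N.
  by rewrite /f; have [_ _ On0] := oscP 0%N; case: ifP.
have shiftP (r t : R) : r < t -> exists k : nat, r + k.+1%:R^-1 < t.
  rewrite -subr_gt0 => tr0.
  have [k _ /(_ k (leqnn k)) hk] := near_infty_natSinv_lt (PosNum tr0).
  by exists k; rewrite -ltrBrDl.
have Lr_L x w : {ae lebesgue_measure, forall r : R, (Lr r x w <= L r x w)%E}.
  pose q n : R := if @unpickle rat n is Some a then ratr a else 0.
  (* Where L is below its right limit, some rational lies strictly between the two. By monotonicity
     in r, two such radii cannot share a rational, so each [B n] has at most one point. *)
  pose B n := [set r : R | (L r x w < (q n)%:E)%E /\ ((q n)%:E < Lr r x w)%E].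
  suff : lebesgue_measure.-negligible (~` [set r : R | (Lr r x w <= L r x w)%E]) by [].
  apply: (@negligibleS _ _ _ lebesgue_measure (\bigcup_n B n : set (measurableTypeR R))).
    move=> r /= /negP; rewrite -ltNge => h.
    have [a La] : exists a, L r x w = a%:E.
      move: (L0 r x w) h; case: (L r x w) => [a| |]//; first by exists a.
      by move=> _; rewrite ltNge leey.
    rewrite La in h.
    have [t at_ tL] : exists2 t, a < t & (t%:E <= Lr r x w)%E.
      move: h; case: (Lr r x w) => [t| |]// h; first by exists t.
      by exists (a + 1); rewrite ?ltrDl ?leey.
    have [b] := rat_in_itvoo at_; rewrite in_itv/= => /andP[ab bt].
    have qb : q (pickle b) = ratr b by rewrite /q pickleK.
    exists (pickle b); [exact: I|split; rewrite qb].
      by rewrite La lte_fin.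
    by apply: lt_le_trans tL; rewrite lte_fin.
  apply: negligible_bigcup => n.
  have uniq_B (r t : R) : B n r -> B n t -> r < t -> False.
    move=> [_ h1] [h2 _] /shiftP[k hk].
    have : ((q n)%:E < (q n)%:E)%E; last by rewrite ltxx.
    apply: (lt_le_trans h1); apply: le_trans (ltW h2).
    apply: (@le_trans _ _ (L (r + k.+1%:R^-1) x w)); last exact/L_nd/ltW.
    by apply: ereal_inf_lbound; exists k.
  have [[r Br]|nB] := pselect (exists r, B n r); last first.
    apply: (negligibleS _ (negligible_set0 _)) => r Br.
    by apply: nB; exists r.
  apply: (@negligibleS _ _ _ lebesgue_measure ([set r] : set (measurableTypeR R))); last first.
    by exists [set r]; split => //; exact: lebesgue_measure_set1.
  move=> t Bt /=; apply/eqP; rewrite eq_le; apply/andP; split; rewrite leNgt; apply/negP.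
    exact: uniq_B.
  exact: uniq_B.
have mLr : measurable_fun [set: R * Rd R d * Omega] (fun z => Lr z.1.1 z.1.2 z.2).
  apply: measurable_fun_einfs => k.
  apply: (measurableT_comp (f := fun z : R * Rd R d * Omega => L z.1.1 z.1.2 z.2)
    (g := fun z : R * Rd R d * Omega => (z.1.1 + k.+1%:R^-1, z.1.2, z.2))) => //.
  apply: measurable_fun_pair => //; apply: measurable_fun_pair.
    apply: measurable_funD => //.
    exact: (measurableT_comp measurable_fst measurable_fst).
  exact: (measurableT_comp measurable_snd measurable_fst).
pose N := [set z : R * Rd R d * Omega | (Lr z.1.1 z.1.2 z.2 <= L z.1.1 z.1.2 z.2)%E].
have mN : measurable N by rewrite /N -[X in measurable X]setTI; exact: measurable_lee.
(* The exceptional radii depend on x and w; the exchange gives, for almost every radius, almost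
   every centre and almost every outcome. *)
have aeN := (ae_rotate (@lebesgue_measure R) (lebesgue_Rd R d) P mN).1
  (aeW _ (fun x => aeW _ (Lr_L x))).
exists L; split => //; move: aeN; apply: filterS => r' hr _; move: hr; set r : R := r'.
apply: filterS => x hx.
have [D oD _] := osc_exists P mA (eball x r) c0 mX Xc.
apply: (osc_eq_ae oD).
have D_le : {ae P, forall w, forall k : nat, (D w <= L (r + k.+1%:R^-1)%R x w)%E}.
  by apply: ae_foralln => k; apply: L_ge oD; rewrite ltrDl invr_gt0.
have LD := L_le _ _ _ oD.
near=> w; apply/eqP; rewrite eq_le; apply/andP; split; first by near: w.
apply: (@le_trans _ _ (Lr r x w)); last by near: w.
by apply: le_ereal_inf_tmp => _ [k _ <-]; move: k; near: w.
Unshelve. all: by end_near. Qed.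

End jointly_measurable_oscillation.

(** Scaled by a, the image of Lebesgue measure under l -> a l + b agrees with Lebesgue measure on
    half-open intervals, hence everywhere; so preimages of null sets are null. *)
Lemma ae_affine (R : realType) (a b : R) (N : set R) : 0 < a ->
  {ae lebesgue_measure, forall r : R, N r} ->
  {ae lebesgue_measure, forall l : R, N (a * l + b)}.
Proof.
move=> a0 [M [mM M0 NM]].
pose f (l : measurableTypeR R) : measurableTypeR R := a * l + b.
have mf : measurable_fun setT f.
  by apply: measurable_funD => //; exact: measurable_funM.
exists (f @^-1` M); split.
- by rewrite -[X in measurable X]setTI; exact: mf.
- pose nu : {measure set (measurableTypeR R) -> \bar R} :=
    measure_function_pushforward__canonical__measure_function_Measure lebesgue_measure mf.
  have h : lebesgue_measure M = mscale (NngNum (ltW a0)) nu M.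
    apply: (@lebesgue_measure_unique R (mscale (NngNum (ltW a0)) nu)) => //= _ [[x y]] _ <-.
    rewrite /mscale/= /pushforward.
    have -> : f @^-1` `]x, y] = `](x - b) / a, (y - b) / a]%classic.
      apply/seteqP; split=> l /=; rewrite !in_itv/= ltr_pdivrMr// ler_pdivlMr// ltrBlDr lerBrDr mulrC//.
    rewrite !lebesgue_measure_itv/= !lte_fin ltr_pM2r ?invr_gt0// ltrD2r.
    case: ifPn => _; last by rewrite mule0.
    by rewrite -!EFinB -EFinM; congr EFin; field; rewrite gt_eqF.
  apply/eqP; move/eqP: M0; rewrite h /mscale/= mule_eq0 eqe gt_eqF//=.
- by move=> l /= h; apply: NM => /=.
Qed.

(** * Moments from the oscillation *)

#[global] Instance ae_lebesgue_filter (R : realType) :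
  Filter (almost_everywhere (@lebesgue_measure R)).
Proof. exact: ae_filter_ringOfSetsType. Qed.

Section comparison_of_oscillations.
Local Open Scope ereal_scope.
Context {R : realType} {d : nat} {disp : measure_display} {Omega : measurableType disp}.
Variables (P : probability Omega R) (A : Rd R d -> Omega -> R).

(** An oscillation field is controlled at almost every radius, whereas the multiscale integrals
    evaluate it at l + 1 and 2 (l + 1). *)
Lemma ae_radius (Q : set R) : {ae lebesgue_measure, forall r : R, (0 < r)%R -> Q r} ->
  {ae lebesgue_measure, forall l : R, (0 <= l)%R -> Q (l + 1)%R /\ Q (2 * (l + 1))%R}.
Proof.
move=> h.
have h1 := @ae_affine R 1 1 _ ltr01 h.
have h2 := @ae_affine R 2 2 _ (ltr0Sn R 1) h.
apply: filterS2 h1 h2 => l; rewrite !mul1r => h1 h2 l0; split.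
  by apply: h1; rewrite ltr_wpDl.
by rewrite mulrDr mulr1; apply: h2; rewrite ltr_wpDl// mulr_ge0.
Qed.

(** Passes from a null set depending on scale and centre to a single null set of Omega. The
    restriction to l >= 0 is encoded by adding the half-space l < 0 to [Q], as [ae_rotate] takes a
    plain measurable set. *)
Lemma ae_scale_rotate (Q : set (Omega * R * Rd R d)) : measurable Q ->
  {ae lebesgue_measure, forall l : R, (0 <= l)%R ->
    {ae lebesgue_Rd R d, forall x, {ae P, forall w, Q (w, l, x)}}} ->
  {ae P, forall w, {ae lebesgue_measure, forall l : R, (0 <= l)%R ->
    {ae lebesgue_Rd R d, forall x, Q (w, l, x)}}}.
Proof.
move=> mQ h.
pose N : set (Omega * R * Rd R d) := [set z | (z.1.2 < 0)%R] `|` Q.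
have mN : measurable N.
  apply: measurableU => //; rewrite -[X in measurable X]setTI.
  rewrite (_ : [set z | _] = (fun z : Omega * R * Rd R d => (z.1.2 < 0)%R) @^-1` [set true])//.
  apply: measurable_fun_ltr => //.
  exact: (measurableT_comp measurable_snd measurable_fst).
have hN : {ae lebesgue_measure, forall l : R, {ae lebesgue_Rd R d, forall x,
    {ae P, forall w, N (w, l, x)}}}.
  apply: filterS h => l Ql; have [l0|l0] := ltP l 0%R.
    by apply: aeW => x; apply: aeW => w; left.
  by apply: filterS (Ql l0) => x; apply: filterS => w; right.
have := (ae_rotate P (@lebesgue_measure R) (lebesgue_Rd R d) mN).1 hN.
apply: filterS => w; apply: filterS => l + l0.
by apply: filterS => x -[/=|//]; rewrite ltNge l0.
Qed.

Variables (X : Omega -> R) (D : R -> Rd R d -> Omega -> \bar R).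
Hypothesis oD : is_osc_field P A X D.

Let mD : measurable_fun [set: R * Rd R d * Omega] (fun q => D q.1.1 q.1.2 q.2) := oD.1.

Let DS (s : R) (x : Rd R d) w := (D s x w) ^+ 2.

Let mDs (s : R -> R) : measurable_fun setT s ->
  measurable_fun [set: Omega * R * Rd R d] (fun z => DS (s z.1.2) z.2 z.1.1).
Proof.
move=> ms; apply: measurable_sqre.
apply: (measurableT_comp (f := fun q : R * Rd R d * Omega => D q.1.1 q.1.2 q.2)
    (g := fun z : Omega * R * Rd R d => (s z.1.2, z.2, z.1.1))) => //.
apply: measurable_fun_pair.
  apply: measurable_fun_pair => //.
  apply: (measurableT_comp ms).
  exact: (measurableT_comp measurable_snd measurable_fst).
exact: (measurableT_comp measurable_fst measurable_fst).
Qed.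

Let ms1 : measurable_fun setT (fun l : R => l + 1)%R.
Proof. exact: measurable_funD. Qed.

Let ms2 : measurable_fun setT (fun l : R => 2 * (l + 1))%R.
Proof. by apply: measurable_funM => //; exact: ms1. Qed.

Let osc_le (x y : Rd R d) (r s : R) w : 0 <= D r x w -> D r x w <= D s y w ->
  DS r x w <= DS s y w.
Proof.
by move=> D0 DD; rewrite /DS !expe2; apply: lee_pmul.
Qed.

Lemma osc_le_double : {ae P, forall w, {ae lebesgue_measure, forall l : R, (0 <= l)%R ->
  {ae lebesgue_Rd R d, forall x, (D (l + 1) x w) ^+ 2 <= (D (2 * (l + 1)) x w) ^+ 2}}}.
Proof.
apply: (@ae_scale_rotate [set z | DS (z.1.2 + 1) z.2 z.1.1 <= DS (2 * (z.1.2 + 1)) z.2 z.1.1]).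
  by rewrite -[X in measurable X]setTI; apply: measurable_lee; [|exact: (mDs ms1)|exact: (mDs ms2)].
have := ae_radius oD.2; apply: filterS => l + l0 => /(_ l0)[h1 h2].
near=> x.
have o1 : is_osc P A (eball x (l + 1)%R) X (D (l + 1) x) by near: x.
have o2 : is_osc P A (eball x (2 * (l + 1))%R) X (D (2 * (l + 1)) x) by near: x.
have ge0 := osc_ge0 o1.
have le12 : {ae P, forall w, D (l + 1) x w <= D (2 * (l + 1)) x w}.
  apply: osc_subset o1 o2; apply: eball_subset.
  have -> : edist x x = 0%R.
    by rewrite /edist big1 ?sqrtr0// => i _; rewrite subrr expr0n.
  by rewrite add0r mulrDr; lra.
near=> w; apply: osc_le; near: w => //.
Unshelve. all: by end_near. Qed.

Hypothesis d0 : (0 < d)%N.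

(* B(x, l+1) is contained in B(y, 2(l+1)) for every y in B(x, l+1); average over y. *)
Lemma osc_le_average : {ae P, forall w, {ae lebesgue_measure, forall l : R, (0 <= l)%R ->
  {ae lebesgue_Rd R d, forall x, (D (l + 1) x w) ^+ 2 * ((2 / d%:R * (l + 1)) ^+ d)%:E <=
    \int[lebesgue_Rd R d]_y (D (2 * (l + 1)) y w) ^+ 2}}}.
Proof.
apply: (@ae_scale_rotate [set z | DS (z.1.2 + 1) z.2 z.1.1 * ((2 / d%:R * (z.1.2 + 1)) ^+ d)%:E
    <= \int[lebesgue_Rd R d]_y DS (2 * (z.1.2 + 1)) y z.1.1]).
  rewrite -[X in measurable X]setTI; apply: measurable_lee => //.
    apply: emeasurable_funM; first exact: (mDs ms1).
    apply/measurable_EFinP; apply: measurable_funX; apply: measurable_funM => //.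
    apply: (measurableT_comp ms1).
    exact: (measurableT_comp measurable_snd measurable_fst).
  apply: (measurableT_comp (f := fun z : Omega * R =>
    \int[lebesgue_Rd R d]_y DS (2 * (z.2 + 1)) y z.1) (g := fst)) => //.
  apply: (measurable_fun_fubini_tonelli_F (m2 := lebesgue_Rd R d)
    (fun z : Omega * R * Rd R d => DS (2 * (z.1.2 + 1)) z.2 z.1.1)); first exact: (mDs ms2).
  by move=> z; exact: sqre_ge0.
have := ae_radius oD.2; apply: filterS => l + l0 => /(_ l0)[h1 h2].
have l1 : (0 < l + 1)%R by rewrite ltr_wpDl.
near=> x.
have o1 : is_osc P A (eball x (l + 1)%R) X (D (l + 1) x) by near: x.
have D0 := osc_ge0 o1.
have mDx (r : R) : measurable_fun setT (fun z : Rd R d * Omega => D r z.1 z.2).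
  apply: (measurableT_comp (f := fun q : R * Rd R d * Omega => D q.1.1 q.1.2 q.2)
    (g := fun z : Rd R d * Omega => (r, z.1, z.2))) => //.
  by apply: measurable_fun_pair => //; exact: measurable_fun_pair.
pose N := [set z : Rd R d * Omega | ~ (edist x z.1 < l + 1)%R \/
  D (l + 1) x z.2 <= D (2 * (l + 1)) z.1 z.2].
have mN : measurable N.
  rewrite (_ : N = ~` [set z | (edist x z.1 < l + 1)%R] `|`
    [set z | D (l + 1) x z.2 <= D (2 * (l + 1)) z.1 z.2]); last by [].
  apply: measurableU.
    by apply: measurableC; exact: measurable_edist_lt.
  rewrite -[X in measurable X]setTI; apply: measurable_lee => //.
  apply: (measurableT_comp (f := fun z : Rd R d * Omega => D (l + 1) z.1 z.2)
    (g := fun z : Rd R d * Omega => (x, z.2))) => //.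
  exact: measurable_fun_pair.
have aeN : {ae lebesgue_Rd R d, forall y, {ae P, forall w, N (y, w)}}.
  apply: filterS h2 => y o2.
  have [xy|xy] := ltP (edist x y) (l + 1)%R; last first.
    by apply: aeW => w; left => /=; rewrite ltNge xy.
  have : {ae P, forall w, D (l + 1) x w <= D (2 * (l + 1)) y w}.
    apply: osc_subset o1 o2; apply: eball_subset.
    by rewrite edistC mulrDr; move: xy; lra.
  by apply: filterS => w; right.
(* So far the null set of outcomes depends on y; averaging over y requires, at a fixed outcome, the
   comparison for almost every y. *)
have {}aeN := (ae_swap (lebesgue_Rd R d) P mN).1 aeN.
near=> w.
have Nw : {ae lebesgue_Rd R d, forall y, N (y, w)} by near: w.
have D0w : 0 <= D (l + 1) x w by near: w.
have mDy : measurable_fun setT (fun y => DS (2 * (l + 1)) y w).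
  apply: measurable_sqre.
  apply: (measurableT_comp (g := fun y : Rd R d => (y, w)) (mDx (2 * (l + 1))%R)).
  exact: measurable_fun_pair.
rewrite /=.
apply: (@le_trans _ _ (\int[lebesgue_Rd R d]_(y in eball x (l + 1)) cst (DS (l + 1) x w) y)).
  rewrite integral_cst; last exact: measurable_eball.
  rewrite lee_wpmul2l//; first exact: sqre_ge0.
  by rewrite exprMn; exact: lebesgue_eball_ge.
apply: (@le_trans _ _ (\int[lebesgue_Rd R d]_(y in eball x (l + 1)) DS (2 * (l + 1)) y w)).
  apply: ae_ge0_le_integral => //.
  - exact: measurable_eball.
  - by move=> y _; exact: sqre_ge0.
  - by move=> y _; exact: sqre_ge0.
  - exact: measurable_funTS.
  apply: filterS Nw => y Ny xy; apply: osc_le => //.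
  by case: Ny.
apply: ge0_subset_integral => //.
- exact: measurable_eball.
- by move=> y _; exact: sqre_ge0.
Unshelve. all: by end_near. Qed.

End comparison_of_oscillations.

Section averaged_power.
Local Open Scope ereal_scope.
Context dT (T : measurableType dT) (R : realType) (mu : {measure set T -> \bar R}).

(** Let F be the integral of [b]. In a ^ p = a ^ (p - 1) a, the first factor is at most (F / v) ^ (p
    - 1) by the last hypothesis, and the second integrates to at most F. In this way the power p
    leaves the spatial integral. *)
Lemma integral_poweR_le_sup (a b : T -> \bar R) (v p : R) : (0 < v)%R -> (1 <= p)%R ->
  measurable_fun setT a -> measurable_fun setT b ->
  (forall x, 0 <= a x) -> (forall x, 0 <= b x) ->
  {ae mu, forall x, a x <= b x} ->
  {ae mu, forall x, a x * v%:E <= \int[mu]_y b y} ->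
  \int[mu]_x (a x) `^ p <= (v `^ (1 - p))%:E * (\int[mu]_y b y) `^ p.
Proof.
move=> v0 p1 ma mb a0 b0 ab av.
have p0 : (0 < p)%R by rewrite (lt_le_trans ltr01).
have c0 : 0 < (v `^ (1 - p))%:E by rewrite lte_fin powR_gt0.
have F0 : 0 <= \int[mu]_y b y by apply: integral_ge0.
have Fab : \int[mu]_x a x <= \int[mu]_x b x.
  by apply: ae_ge0_le_integral => //; apply: filterS ab => x + _.
have [Foo|] := eqVneq (\int[mu]_y b y) +oo.
  by rewrite Foo poweRyr ?gt_eqF// gt0_muley// leey.
rewrite -ltey => Foo; have Ffin : \int[mu]_y b y \is a fin_num by rewrite ge0_fin_numE.
move: F0 av Fab; rewrite -(fineK Ffin); move: (fine _) => F; rewrite lee_fin => F0 av Fab.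
have Fv : (0 <= F / v)%R by rewrite divr_ge0// ltW.
have k0 : (0 <= (F / v) `^ (p - 1))%R by exact: powR_ge0.
apply: (@le_trans _ _ (\int[mu]_x (((F / v) `^ (p - 1))%:E * a x))).
  apply: ae_ge0_le_integral => //.
  - by move=> x _; exact: poweR_ge0.
  - exact: (measurableT_comp (measurable_poweR p)).
  - by move=> x _; rewrite mule_ge0.
  - exact: emeasurable_funM.
  apply: filterS av => x + _; move: (a0 x); case: (a x) => [y| |//].
    rewrite lee_fin -EFinM lee_fin poweR_EFin -EFinM lee_fin => y0 yF.
    rewrite -(mulr_powRB1 y0 p0) mulrC ler_wpM2r//.
    have yv : (y <= F / v)%R by rewrite ler_pdivlMr.
    by apply: ge0_ler_powR; rewrite ?subr_ge0// nnegrE.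
  by move=> _; rewrite gt0_mulye ?lte_fin// leye_eq.
rewrite ge0_integralZl_EFin//.
apply: (@le_trans _ _ (((F / v) `^ (p - 1))%:E * F%:E)); first by rewrite lee_wpmul2l ?lee_fin.
rewrite -EFinM poweR_EFin -EFinM lee_fin.
rewrite powRM ?invr_ge0 ?(ltW v0)// -powR_inv1 ?(ltW v0)// -powRrM mulN1r opprB.
by rewrite mulrAC -(mulr_powRB1 F0 p0) mulrC (mulrC F).
Qed.

End averaged_power.

Lemma poweRD_split (R : realType) (p u : R) (b c : \bar R) : 1 <= p -> 0 <= u ->
  (0 <= b)%E -> (0 <= c)%E ->
  (c <= (2 * p)%:E * (u%:E + 2%:E * b) `^ (p - 1) * b)%E ->
  (c ^+ 2 <= (4 * expR 4 * p ^+ 2 * (u ^+ 2) `^ (p - 1))%:E * b ^+ 2 +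
    ((9 * p ^+ 2) `^ p)%:E * (b ^+ 2) `^ p)%E.
Proof.
move=> p1 u0; have p0 : 0 < p by rewrite (lt_le_trans ltr01).
case: b => [b| |//]; last first.
  move=> _ _ _; rewrite !expe2 mulyy poweRyr ?gt_eqF//.
  rewrite [X in (_ + X)%E]gt0_muley ?addey ?leey//.
    rewrite -ltNye; apply: (@lt_le_trans _ _ 0%E); first exact: ltNy0.
    by rewrite mule_ge0// lee_fin !mulr_ge0 ?powR_ge0 ?expR_ge0 ?(ltW p0).
  by rewrite lte_fin powR_gt0// mulr_gt0// exprn_gt0.
rewrite lee_fin => b0; 
have -> : ((2 * p)%:E * (u%:E + 2%:E * b%:E) `^ (p - 1) * b%:E =
    (2 * p * (u + 2 * b) `^ (p - 1) * b)%R%:E)%E.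
  by rewrite -(EFinM 2 b) -EFinD poweR_EFin -!EFinM.
case: c => [c| |//]; last by rewrite leye_eq.
move=> c0 cb; rewrite lee_fin in c0; rewrite lee_fin in cb.
have sq (x : R) : (x%:E ^+ 2 = (x ^+ 2)%:E)%E by rewrite expe2 -EFinM expr2.
rewrite !sq poweR_EFin -(EFinM _ (b ^+ 2)) -(EFinM _ ((b ^+ 2) `^ p)) -EFinD lee_fin.
apply: le_trans (powRD_split p1 u0 b0).
by rewrite ler_sqr// ?nnegrE// (le_trans c0).
Qed.

Section oscillation_moments.
Local Open Scope ereal_scope.
Context {R : realType} {d : nat} {disp : measure_display} {Omega : measurableType disp}.
Variables (P : probability Omega R) (A : Rd R d -> Omega -> R).
Hypotheses (mA : jointly_measurable A) (d0 : (0 < d)%N).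
Variable weight : R -> R.
Hypothesis weight_ge0 : (forall l : R, 0 <= l -> 0 <= weight l)%R.
Hypothesis mweight : measurable_fun (`[0%R, +oo[ : set R) weight.
Variables (X : Omega -> R) (D : R -> Rd R d -> Omega -> \bar R).
Hypotheses (mX : measurable_fun setT X) (oD : is_osc_field P A X D).

Let mD : measurable_fun [set: R * Rd R d * Omega] (fun q => D q.1.1 q.1.2 q.2) := oD.1.

Let S := multiscale weight D.

Let F (l : R) w := \int[lebesgue_Rd R d]_y (D (2 * (l + 1)) y w) ^+ 2.

Let kappa (l : R) := ((l + 1) ^- d * weight l)%R.

Let F0 l w : 0 <= F l w.
Proof. by apply: integral_ge0 => y _; exact: sqre_ge0. Qed.

Let kappa0 l : (0 <= l)%R -> (0 <= kappa l)%R.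
Proof.
by move=> l0; rewrite mulr_ge0 ?weight_ge0// invr_ge0 exprn_ge0// addr_ge0.
Qed.

Let measurable_powl (q : R) : measurable_fun (`[0%R, +oo[ : set R) (fun l : R => (l + 1) `^ q)%R.
Proof.
apply: measurable_funTS; apply: (measurableT_comp (measurable_powR q)).
exact: measurable_funD.
Qed.

Let mkappa : measurable_fun (`[0%R, +oo[ : set R) kappa.
Proof.
apply: measurable_funM => //.
apply: (eq_measurable_fun (fun l : R => (l + 1) `^ (- d%:R)))%R.
  move=> l /[!inE]/=; rewrite in_itv/= andbT => l0.
  by rewrite powR_invn// addr_ge0.
exact: measurable_powl.
Qed.

Let ms1 : measurable_fun setT (fun l : R => l + 1)%R.
Proof. exact: measurable_funD. Qed.

Let ms2 : measurable_fun setT (fun l : R => 2 * (l + 1))%R.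
Proof. by apply: measurable_funM => //; exact: ms1. Qed.

Let mF : measurable_fun [set: R * Omega] (fun q => F q.1 q.2).
Proof. exact: (measurable_radial_sqr ms2 mD). Qed.

Let measurable_section (h : R * Omega -> \bar R) w : measurable_fun setT h ->
  measurable_fun (`[0%R, +oo[ : set R) (fun l : R => h (l, w)).
Proof.
move=> mh; apply: measurable_funTS; apply: (measurableT_comp mh).
exact: measurable_fun_pair.
Qed.

Let mDx (D' : R -> Rd R d -> Omega -> \bar R) (s : R) w :
  measurable_fun [set: R * Rd R d * Omega] (fun q => D' q.1.1 q.1.2 q.2) ->
  measurable_fun setT (fun x : Rd R d => (D' s x w) ^+ 2).
Proof.
move=> mD'; apply: measurable_sqre.
apply: (measurableT_comp (g := fun x : Rd R d => (s, x, w)) mD').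
by apply: measurable_fun_pair => //; exact: measurable_fun_pair.
Qed.

Lemma multiscale_osc_le : {ae P, forall w,
  S w <= \int[lebesgue_measure]_(l in `[0%R, +oo[) (F l w * (kappa l)%:E)}.
Proof.
apply: filterS (osc_le_double oD) => w hw.
apply: ae_ge0_le_integral => //.
- move=> l /=; rewrite in_itv/= andbT => l0; rewrite mule_ge0 ?lee_fin ?kappa0//.
  by apply: integral_ge0 => x _; exact: sqre_ge0.
- apply: emeasurable_funM; last exact/measurable_EFinP.
  exact: (measurable_section w (measurable_radial_sqr ms1 mD)).
- by move=> l /=; rewrite in_itv/= andbT => l0; rewrite mule_ge0 ?lee_fin ?kappa0.
- apply: emeasurable_funM; last exact/measurable_EFinP.
  exact: (measurable_section w mF).
apply: filterS hw => l hl /=; rewrite in_itv/= andbT => l0.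
rewrite lee_wpmul2r ?lee_fin ?kappa0//.
apply: ae_ge0_le_integral => //.
- by move=> x _; exact: sqre_ge0.
- exact: mDx.
- by move=> x _; exact: sqre_ge0.
- exact: mDx.
by apply: filterS (hl l0) => x + _.
Qed.

Variable p : R.
Hypothesis p1 : (1 <= p)%R.

Let p0 : (0 < p)%R. Proof. by rewrite (lt_le_trans ltr01). Qed.

Let MP := multiscale_pow p weight D.

Let MP0 w : 0 <= MP w.
Proof.
apply: integral_ge0 => l /=; rewrite in_itv/= andbT => l0.
by rewrite mule_ge0 ?poweR_ge0// lee_fin mulr_ge0 ?powR_ge0 ?weight_ge0.
Qed.

Lemma measurable_multiscale_pow : measurable_fun setT MP.
Proof.
apply: (measurable_weighted_radial (k := fun l => ((l + 1) `^ (- (d%:R * p)) * weight l)%R)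
  (h := fun l w => F l w `^ p)).
- exact: (measurableT_comp (measurable_poweR p) mF).
- by move=> r w; exact: poweR_ge0.
- by apply: measurable_funM => //; exact: measurable_powl.
- by move=> l l0; rewrite mulr_ge0 ?powR_ge0 ?weight_ge0.
Qed.

Let kappaE (l : R) : (0 <= l)%R -> ((l + 1) ^- d = (l + 1) `^ (- d%:R) :> R)%R.
Proof. by move=> l0; rewrite powR_invn// addr_ge0. Qed.

(** Jensen's inequality for the measure of density [weight] and mass W in the scale variable; the
    spatial integral remains inside the power. This brings the dependence on the weight into the
    constant. *)
Lemma multiscale_osc_powR_le (W : R) :
  \int[lebesgue_measure]_(l in `[0%R, +oo[) (weight l)%:E = W%:E ->
  {ae P, forall w, S w `^ p <= (W `^ (p - 1))%:E * MP w}.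
Proof.
move=> intW; apply: filterS multiscale_osc_le => w hw.
have S0 : 0 <= S w by exact: multiscale_ge0.
apply: (le_trans (le_poweR (ltW p0) S0 hw)).
have ma : measurable_fun (`[0%R, +oo[ : set R) (fun l => F l w * ((l + 1) `^ (- d%:R))%:E).
  apply: emeasurable_funM; first exact: (measurable_section w mF).
  by apply/measurable_EFinP; exact: measurable_powl.
have a0 (l : R) : `[0%R, +oo[%classic l -> 0 <= F l w * ((l + 1) `^ (- d%:R))%:E.
  by move=> _; rewrite mule_ge0// lee_fin powR_ge0.
have w0 (l : R) : `[0%R, +oo[%classic l -> (0 <= weight l)%R.
  by rewrite /= in_itv/= andbT => /weight_ge0.
have J := @weighted_jensen _ _ _ (@lebesgue_measure R) _ (measurable_itv `[0%R, +oo[) _ weight p p1 ma a0 mweight w0 W intW.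
rewrite [X in X `^ p <= _](_ : _ = \int[lebesgue_measure]_(l in `[0%R, +oo[)
   (F l w * ((l + 1) `^ (- d%:R))%:E * (weight l)%:E)); last first.
  apply: eq_integral => l /[!inE]/=; rewrite in_itv/= andbT => l0.
  by rewrite /kappa kappaE// EFinM muleA.
apply: (le_trans J); rewrite lee_wpmul2l ?lee_fin ?powR_ge0//.
rewrite le_eqVlt; apply/orP; left; apply/eqP.
apply: eq_integral => l /[!inE]/=; rewrite in_itv/= andbT => l0.
rewrite poweRM// ?lee_fin ?powR_ge0// poweR_EFin -powRrM mulNr EFinM muleA//.
Qed.

Let c : R := ((2 / d%:R) ^+ d)%R.

Let c0 : (0 < c)%R.
Proof. by rewrite exprn_gt0// divr_gt0// ltr0n. Qed.

Section truncated_power.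
Variables (e m : R) (D' : R -> Rd R d -> Omega -> \bar R).
Hypotheses (e0 : (0 < e)%R)
  (oD' : is_osc_field P A (fun w => powtrunc e p (X w - m)) D').

Let mD' : measurable_fun [set: R * Rd R d * Omega] (fun q => D' q.1.1 q.1.2 q.2) := oD'.1.

Let U w := sqtrunc e (X w - m).

Let mU : measurable_fun setT U. Proof. exact: measurable_sqtruncX. Qed.

Let K : R := (4 * expR 4 * p ^+ 2)%R.

Let rho : R := ((9 * p ^+ 2) `^ p)%R.

Let half_powtrunc a : powtrunc e 1 a = (sqtrunc e a `^ 2^-1)%R.
Proof. by rewrite /powtrunc div1r. Qed.

(** [osc_lipschitz] with phi the truncated power and h the square root of U, that is [powtrunc] at
    exponent 1, whose 1-Lipschitz property is [powtrunc_lipschitz] there. Squaring is done by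
    [poweRD_split], with h (X) ^ 2 = U. *)
Lemma osc_powtrunc_le : {ae P, forall w, {ae lebesgue_measure, forall l : R, (0 <= l)%R ->
  {ae lebesgue_Rd R d, forall x, (D' (l + 1) x w) ^+ 2 <=
    (K * U w `^ (p - 1))%:E * (D (l + 1) x w) ^+ 2 +
    rho%:E * ((D (l + 1) x w) ^+ 2) `^ p}}}.
Proof.
have mDs (E : R -> Rd R d -> Omega -> \bar R) :
    measurable_fun [set: R * Rd R d * Omega] (fun q => E q.1.1 q.1.2 q.2) ->
    measurable_fun [set: Omega * R * Rd R d] (fun z => (E (z.1.2 + 1)%R z.2 z.1.1) ^+ 2).
  move=> mE; apply: measurable_sqre.
  apply: (measurableT_comp (g := fun z : Omega * R * Rd R d => (z.1.2 + 1, z.2, z.1.1)%R) mE).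
  apply: measurable_fun_pair.
    apply: measurable_fun_pair => //; apply: (measurableT_comp ms1).
    exact: (measurableT_comp measurable_snd measurable_fst).
  exact: (measurableT_comp measurable_fst measurable_fst).
apply: (@ae_scale_rotate _ _ _ _ _ [set z | (D' (z.1.2 + 1)%R z.2 z.1.1) ^+ 2 <=
    (K * U z.1.1 `^ (p - 1))%:E * (D (z.1.2 + 1)%R z.2 z.1.1) ^+ 2 +
    rho%:E * ((D (z.1.2 + 1)%R z.2 z.1.1) ^+ 2) `^ p]).
  rewrite -[X in measurable X]setTI; apply: measurable_lee => //; first exact: mDs.
  apply: emeasurable_funD; apply: emeasurable_funM.
  - apply/measurable_EFinP; apply: measurable_funM => //.
    apply: (measurableT_comp (measurable_powR _)); apply: (measurableT_comp mU).
    exact: (measurableT_comp measurable_fst measurable_fst).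
  - exact: mDs.
  - by [].
  - by apply: (measurableT_comp (measurable_poweR p)); exact: mDs.
have h1 := ae_radius oD.2; have h2 := ae_radius oD'.2.
apply: filterS2 h1 h2 => l + + l0 => /(_ l0)[+ _] /(_ l0)[+ _].
apply: filterS2 => x o1 o2.
have o1_ge0 := osc_ge0 o1; have o2_ge0 := osc_ge0 o2.
pose phi a := powtrunc e p (a - m); pose h a := powtrunc e 1 (a - m).
have mh (q : R) : measurable_fun setT (fun a : R => powtrunc e q (a - m)%R).
  by apply: (measurableT_comp (measurable_powtrunc q e0)); exact: measurable_funB.
have h0 a : (0 <= h a)%R by exact: powtrunc_ge0.
have h_lip a b : (`|h a - h b| <= `|a - b|)%R.
  have := powtrunc_lipschitz (a - m) (b - m) e0 (lexx 1%R).
  rewrite subrr mul0r powRr0 !mul1r (_ : a - m - (b - m) = a - b)%R//; ring.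
have q0 : (0 <= p - 1)%R by rewrite subr_ge0.
have phi_lip a b : (`|phi a - phi b| <= p * Num.max (h a) (h b) `^ (p - 1) * `|a - b|)%R.
  have := powtrunc_lipschitz (a - m) (b - m) e0 p1.
  rewrite (_ : a - m - (b - m) = a - b)%R; last by ring.
  move/le_trans; apply; rewrite ler_wpM2r// ler_wpM2l ?(ltW p0)//.
  rewrite mulrC powRrM; apply: ge0_ler_powR => //; rewrite ?nnegrE ?powR_ge0//.
    by rewrite le_max h0.
  rewrite /h !half_powtrunc le_max !maxEle.
  by case: ifP => _; rewrite lexx ?orbT.
have osc_le := osc_lipschitz (mh p) (mh 1%R) h0 h_lip p0 q0 phi_lip o1 o2.
near=> w => /=.
have -> : U w = (h (X w) ^+ 2)%R by rewrite /h powtrunc_sqr powRr1// ltW// sqtrunc_gt0.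
apply: poweRD_split => //; near: w => //.
Unshelve. all: by end_near. Qed.

(** The pointwise bound is integrated over centres and scales. Its first term reproduces S; in its
    second, [integral_poweR_le_sup] is used with the squared oscillations at radii l + 1 and 2 (l +
    1) for a and b, and the lower bound on the volume of the ball for v. *)
Lemma multiscale_osc_powtrunc_le : {ae P, forall w,
  multiscale weight D' w <=
    K%:E * ((U w `^ (p - 1))%:E * S w) + (rho * c `^ (1 - p))%:E * MP w}.
Proof.
apply: filterS3 osc_powtrunc_le (osc_le_double oD) (osc_le_average oD d0) => w h1 h2 h3.
have K0 : (0 <= K)%R by rewrite !mulr_ge0 ?expR_ge0 ?(ltW p0).
have KU0 : (0 <= K * U w `^ (p - 1))%R by rewrite mulr_ge0 ?powR_ge0.
have rho0 : (0 <= rho)%R by exact: powR_ge0.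
have rc0 : (0 <= rho * c `^ (1 - p))%R by rewrite mulr_ge0 ?powR_ge0.
have mI : measurable_fun (`[0%R, +oo[ : set R) (fun l => \int[lebesgue_Rd R d]_x (D (l + 1) x w) ^+ 2).
  exact: (measurable_section w (measurable_radial_sqr ms1 mD)).
have I0 (l : R) : 0 <= \int[lebesgue_Rd R d]_x (D (l + 1) x w) ^+ 2.
  by apply: integral_ge0 => x _; exact: sqre_ge0.
have mSl : measurable_fun (`[0%R, +oo[ : set R)
    (fun l => (\int[lebesgue_Rd R d]_x (D (l + 1) x w) ^+ 2) * (kappa l)%:E).
  by apply: emeasurable_funM => //; exact/measurable_EFinP.
have Sl0 (l : R) : `[0%R, +oo[%classic l ->
    0 <= (\int[lebesgue_Rd R d]_x (D (l + 1) x w) ^+ 2) * (kappa l)%:E.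
  by rewrite /= in_itv/= andbT => l0; rewrite mule_ge0 ?lee_fin ?kappa0 ?I0.
have mMl : measurable_fun (`[0%R, +oo[ : set R)
    (fun l => F l w `^ p * ((l + 1) `^ (- (d%:R * p)) * weight l)%:E).
  apply: emeasurable_funM; first exact: (measurableT_comp (measurable_poweR p) (measurable_section w mF)).
  by apply/measurable_EFinP; apply: measurable_funM => //; exact: measurable_powl.
have Ml0 (l : R) : `[0%R, +oo[%classic l ->
    0 <= F l w `^ p * ((l + 1) `^ (- (d%:R * p)) * weight l)%:E.
  rewrite /= in_itv/= andbT => l0; rewrite mule_ge0 ?poweR_ge0// lee_fin.
  by rewrite mulr_ge0 ?powR_ge0 ?weight_ge0.
rewrite muleA -EFinM.
have mitv : measurable (`[0%R, +oo[%classic : set (measurableTypeR R)) := measurable_itv _.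
rewrite -(@ge0_integralZl_EFin _ _ _ (@lebesgue_measure R) _ mitv _ Sl0 mSl _ KU0).
rewrite -(@ge0_integralZl_EFin _ _ _ (@lebesgue_measure R) _ mitv _ Ml0 mMl _ rc0).
rewrite -ge0_integralD//; last 4 first.
- by move=> l /Sl0 ?; rewrite mule_ge0 ?lee_fin.
- exact: emeasurable_funM.
- by move=> l /Ml0 ?; rewrite mule_ge0 ?lee_fin.
- exact: emeasurable_funM.
apply: ae_ge0_le_integral => //.
- move=> l /=; rewrite in_itv/= andbT => l0; rewrite mule_ge0 ?lee_fin ?kappa0//.
  by apply: integral_ge0 => x _; exact: sqre_ge0.
- apply: emeasurable_funM; last exact/measurable_EFinP.
  exact: (measurable_section w (measurable_radial_sqr ms1 mD')).
- by move=> l l0; rewrite adde_ge0// mule_ge0 ?lee_fin ?Sl0 ?Ml0.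
- by apply: emeasurable_funD; exact: emeasurable_funM.
apply: filterS3 h1 h2 h3 => l h1 h2 h3 /=; rewrite in_itv/= andbT => l0.
move: h1 h2 h3 => /(_ l0) h1 /(_ l0) h2 /(_ l0) h3.
have l1 : (0 < l + 1)%R by rewrite ltr_wpDl.
pose v := ((2 / d%:R * (l + 1)) ^+ d)%R.
have v0 : (0 < v)%R by rewrite exprn_gt0// mulr_gt0// divr_gt0// ltr0n.
have mD1 : measurable_fun setT (fun x => (D (l + 1) x w) ^+ 2) by exact: mDx.
have mDp : measurable_fun setT (fun x => ((D (l + 1) x w) ^+ 2) `^ p).
  exact: (measurableT_comp (measurable_poweR p)).
have := integral_poweR_le_sup v0 p1 mD1 (mDx (2 * (l + 1))%R w mD)
  (fun x => sqre_ge0 _) (fun x => sqre_ge0 _) h2 h3.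
rewrite -/(F l w) => hp.
have hI : \int[lebesgue_Rd R d]_x (D' (l + 1) x w) ^+ 2 <=
    (K * U w `^ (p - 1))%:E * \int[lebesgue_Rd R d]_x (D (l + 1) x w) ^+ 2 +
    (rho * v `^ (1 - p))%:E * F l w `^ p.
  apply: (@le_trans _ _ ((K * U w `^ (p - 1))%:E * \int[lebesgue_Rd R d]_x (D (l + 1) x w) ^+ 2 +
      rho%:E * \int[lebesgue_Rd R d]_x ((D (l + 1) x w) ^+ 2) `^ p)); last first.
    by rewrite leeD2l// EFinM -muleA lee_wpmul2l ?lee_fin.
  rewrite -ge0_integralZl_EFin// => [|x _]; last exact: sqre_ge0.
  rewrite -ge0_integralZl_EFin// => [|x _]; last exact: poweR_ge0.
  have z1 x : 0 <= (K * U w `^ (p - 1))%:E * (D (l + 1) x w) ^+ 2.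
    by rewrite mule_ge0 ?lee_fin// sqre_ge0.
  have z2 x : 0 <= rho%:E * ((D (l + 1) x w) ^+ 2) `^ p.
    by rewrite mule_ge0 ?lee_fin// poweR_ge0.
  rewrite -ge0_integralD//; last 2 first.
  - exact: emeasurable_funM.
  - exact: emeasurable_funM.
  apply: ae_ge0_le_integral => //.
  - by move=> x _; exact: sqre_ge0.
  - exact: mDx.
  - by move=> x _; rewrite adde_ge0.
  - by apply: emeasurable_funD; exact: emeasurable_funM.
  by apply: filterS h1 => x + _.
apply: (@le_trans _ _ (((K * U w `^ (p - 1))%:E * (\int[lebesgue_Rd R d]_x (D (l + 1) x w) ^+ 2) +
    (rho * v `^ (1 - p))%:E * F l w `^ p) * (kappa l)%:E)).
  by rewrite lee_wpmul2r ?lee_fin ?kappa0.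
rewrite ge0_muleDl; last 2 first.
- by rewrite mule_ge0 ?lee_fin.
- by rewrite mule_ge0 ?poweR_ge0// lee_fin mulr_ge0 ?powR_ge0.
rewrite -muleA leeD2l// -muleA (muleC _ (kappa l)%:E) muleA -EFinM [leRHS]muleA.
rewrite [X in _ <= X](_ : _ = (rho * c `^ (1 - p) * ((l + 1) `^ (- (d%:R * p)) * weight l))%:E * F l w `^ p); last first.
  by rewrite [in RHS]EFinM -!muleA (muleC (F l w `^ p)).
rewrite lee_wpmul2r ?poweR_ge0// lee_fin le_eqVlt; apply/orP; left; apply/eqP.
(* The volume contributes (l + 1) ^ (d (1 - p)), which times (l + 1) ^ (- d) is the weight (l + 1) ^
   (- d p) of [multiscale_pow]. *)
have -> : (v `^ (1 - p) = c `^ (1 - p) * (l + 1) `^ (d%:R * (1 - p)))%R.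
  rewrite /v exprMn powRM ?exprn_ge0 ?(ltW l1) ?divr_ge0//.
  by rewrite -(powR_mulrn d (ltW l1)) -powRrM.
rewrite /kappa kappaE//.
have -> : (- (d%:R * p) = d%:R * (1 - p) + - d%:R)%R by ring.
rewrite [((l + 1) `^ (_ + _))%R]powRD; first by ring.
by rewrite (gt_eqF l1) implybT.
Qed.

End truncated_power.

End oscillation_moments.

Lemma powRD_ge (R : realType) (p x y : R) : 1 <= p -> 0 <= x -> 0 <= y ->
  x `^ p + y `^ p <= (x + y) `^ p.
Proof.
move=> p1 x0 y0; have p0 : 0 < p by rewrite (lt_le_trans ltr01).
have xy0 : 0 <= x + y by rewrite addr_ge0.
rewrite -(mulr_powRB1 xy0 p0) -(mulr_powRB1 x0 p0) -(mulr_powRB1 y0 p0) mulrDl.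
by rewrite lerD// ler_wpM2l// ge0_ler_powR ?nnegrE ?subr_ge0 ?lerDl ?lerDr.
Qed.

(** Each summand is made a p-th power by x ^ (p - 1) <= (1 + x) ^ p and p <= exp p; superadditivity
    of the p-th power, [powRD_ge], then merges the two. *)
Lemma osc_moment_constant (R : realType) (p W c K : R) : 1 <= p -> 0 <= W -> 0 < c -> 0 <= K ->
  4 `^ p * (W `^ (p - 1) * (1 + (K * p ^+ 2) `^ p)) +
    p * ((9 * p ^+ 2) `^ p * c `^ (1 - p)) <=
  ((4 * (1 + W) * (1 + K) + 9 * expR 1 * (1 + c^-1)) * p ^+ 2) `^ p.
Proof.
move=> p1 W0 c0 K0; have p0 : 0 < p by rewrite (lt_le_trans ltr01).
have p_ge0 := ltW p0.
have cV : 0 <= c^-1 by rewrite invr_ge0 ltW.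
have pp : 1 <= p ^+ 2 by rewrite exprn_ege1.
have pB1 (x : R) : 0 <= x -> x `^ (p - 1) <= (1 + x) `^ p.
  move=> x0; apply: (@le_trans _ _ ((1 + x) `^ (p - 1))).
    by apply: ge0_ler_powR; rewrite ?nnegrE ?subr_ge0 ?addr_ge0 ?lerDr.
  by rewrite ler_powR ?lerDl// gerBl.
have -> : c `^ (1 - p) = (c^-1) `^ (p - 1).
  by rewrite -powR_inv1 ?(ltW c0)// -powRrM mulN1r opprB.
have e1 : 0 <= expR 1 :> R by exact: expR_ge0.
have a0 : 0 <= 4 * (1 + W) * (1 + K) * p ^+ 2 by rewrite !mulr_ge0// addr_ge0.
have b0 : 0 <= 9 * expR 1 * (1 + c^-1) * p ^+ 2 by rewrite !mulr_ge0// addr_ge0.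
rewrite [X in _ <= X `^ _]mulrDl; apply: le_trans (powRD_ge p1 a0 b0).
have Kp0 : 0 <= K * p ^+ 2 by rewrite !mulr_ge0.
apply: lerD.
  have -> : 4 * (1 + W) * (1 + K) * p ^+ 2 = 4 * ((1 + W) * ((1 + K) * p ^+ 2)) by ring.
  have K1 : 0 <= (1 + K) * p ^+ 2 by rewrite !mulr_ge0// addr_ge0.
  have W1 : 0 <= 1 + W by rewrite addr_ge0.
  have WK1 : 0 <= (1 + W) * ((1 + K) * p ^+ 2) by rewrite mulr_ge0.
  rewrite (@powRM R _ _ p _ WK1)// (@powRM R _ _ p W1 K1) ler_wpM2l ?powR_ge0//.
  apply: ler_pM; rewrite ?powR_ge0 ?addr_ge0 ?powR_ge0 ?pB1//.
  have := powRD_ge p1 (ler01 : 0 <= 1 :> R) Kp0; rewrite powR1 => /le_trans; apply.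
  apply: ge0_ler_powR; rewrite ?nnegrE ?addr_ge0//.
  by rewrite mulrDl mul1r lerD2r.
have -> : 9 * expR 1 * (1 + c^-1) * p ^+ 2 = expR 1 * (9 * p ^+ 2 * (1 + c^-1)) by ring.
have n0 : 0 <= 9 * p ^+ 2 by rewrite !mulr_ge0.
have n1 : 0 <= 1 + c^-1 by rewrite addr_ge0.
rewrite (@powRM R _ _ p e1 (mulr_ge0 n0 n1)) (@powRM R _ _ p n0 n1).
apply: ler_pM => //; first by rewrite mulr_ge0 ?powR_ge0.
  by rewrite -expRM mul1r (le_trans _ (expR_ge1Dx p))// lerDr.
by rewrite ler_wpM2l ?powR_ge0 ?pB1.
Qed.

Section oscillation_spectral_gap.
Local Open Scope ereal_scope.
Context {R : realType} {d : nat} {disp : measure_display} {Omega : measurableType disp}.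
Variables (P : probability Omega R) (A : Rd R d -> Omega -> R).
Hypotheses (mA : jointly_measurable A) (d0 : (0 < d)%N).
Variable weight : R -> R.
Hypothesis weight_ge0 : (forall l : R, 0 <= l -> 0 <= weight l)%R.
Hypothesis mweight : measurable_fun (`[0%R, +oo[ : set R) weight.
Hypothesis MSG : osc_MSG P A weight.

(** [spectral_gap_moment] with k = 4 e^4 p ^ 2 and r = q I, where I is the expectation of
    [multiscale_pow]. Both the p-th power of the variance and E (S ^ p) are at most W ^ (p - 1) I,
    so everything is a multiple of I. *)
Lemma osc_MSG_moment (W p : R) (X : Omega -> R) D :
  \int[lebesgue_measure]_(l in `[0%R, +oo[) (weight l)%:E = W%:E ->
  (1 <= p)%R -> field_measurable A setT X -> is_osc_field P A X D ->
  centered_moment P (2 * p) X <=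
  (((4 * (1 + W) * (1 + 4 * expR 4) + 9 * expR 1 * (1 + ((2 / d%:R) ^+ d)^-1)) * p ^+ 2) `^ p)%:E *
  \int[P]_w multiscale_pow p weight D w.
Proof.
move=> intW p1 fX oD; have p0 : (0 < p)%R by rewrite (lt_le_trans ltr01).
have mX : measurable_fun setT X by exact: field_measurable_fun fX.
set MP := multiscale_pow p weight D; set S := multiscale weight D.
pose c : R := ((2 / d%:R) ^+ d)%R; rewrite -/c.
have c0 : (0 < c)%R by rewrite exprn_gt0// divr_gt0// ltr0n.
have W0 : (0 <= W)%R.
  rewrite -lee_fin -intW; apply: integral_ge0 => l /=; rewrite in_itv/= andbT => l0.
  by rewrite lee_fin weight_ge0.
have mS : measurable_fun setT S by apply: measurable_multiscale => //; exact: oD.1.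
have S0 w : 0 <= S w by exact: multiscale_ge0.
have mMP : measurable_fun setT MP by exact: (measurable_multiscale_pow weight_ge0 mweight oD).
have MP0 w : 0 <= MP w.
  apply: integral_ge0 => l /=; rewrite in_itv/= andbT => l0.
  by rewrite mule_ge0 ?poweR_ge0// lee_fin mulr_ge0 ?powR_ge0 ?weight_ge0.
set I := \int[P]_w MP w.
have I0 : 0 <= I by exact: integral_ge0.
pose K : R := (4 * expR 4)%R.
have K0 : (0 <= K)%R by rewrite mulr_ge0 ?expR_ge0.
have Kp0 : (0 <= K * p ^+ 2)%R by rewrite mulr_ge0 ?sqr_ge0.
pose q : R := ((9 * p ^+ 2) `^ p * c `^ (1 - p))%R.
have q0 : (0 <= q)%R by rewrite mulr_ge0 ?powR_ge0.
have qI0 : 0 <= q%:E * I by rewrite mule_ge0 ?lee_fin.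
have Sp : \int[P]_w (S w) `^ p <= (W `^ (p - 1))%:E * I.
  have Wp0 : (0 <= W `^ (p - 1))%R by exact: powR_ge0.
  rewrite /I -ge0_integralZl_EFin//; apply: ae_ge0_le_integral => //.
  - by move=> w _; exact: poweR_ge0.
  - exact: (measurableT_comp (measurable_poweR p)).
  - by move=> w _; rewrite mule_ge0 ?lee_fin.
  - exact: emeasurable_funM.
  by apply: filterS (multiscale_osc_powR_le weight_ge0 mweight oD p1 intW) => w + _.
have Vp : 'V_P[X] `^ p <= (W `^ (p - 1))%:E * I.
  apply: (le_trans _ Sp); apply: (le_trans _ (probability_jensen_poweR P p1 mS S0)).
  by apply: le_poweR; [exact: ltW|exact: variance_ge0|exact: MSG].
apply: (le_trans (@spectral_gap_moment _ _ _ P X S p (K * p ^+ 2)%R (q%:E * I) mX mS S0 p1 Kp0 qI0 _)).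
  move=> e e0; set m := fine _.
  have bd w : (`|powtrunc e p (X w - m)| <= (e + e^-1) `^ (p / 2))%R.
    rewrite ger0_norm ?powtrunc_ge0//; apply: ge0_ler_powR.
    - by rewrite divr_ge0// ltW.
    - by rewrite nnegrE ltW// sqtrunc_gt0.
    - by rewrite nnegrE addr_ge0 ?invr_ge0 ?ltW.
    - exact: sqtrunc_ub.
  have mphi : measurable_fun setT (fun a : R => powtrunc e p (a - m)%R).
    by apply: (measurableT_comp (measurable_powtrunc p e0)); exact: measurable_funB.
  have mphiX : measurable_fun setT (fun w => powtrunc e p (X w - m)%R).
    exact: (measurableT_comp mphi mX).
  have fphiX : field_measurable A setT (fun w => powtrunc e p (X w - m)%R).
    exact: (measurableT_comp mphi fX).
  (* The spectral gap can be used for the truncated power only along with a jointly measurable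
     version of its oscillation; boundedness provides one. *)
  have [D' oD'] := osc_field_exists P mA d0 (powR_ge0 _ _) mphiX bd.
  apply: (le_trans (MSG fphiX oD')).
  have mU : measurable_fun setT (fun w => (sqtrunc e (X w - m) `^ (p - 1))%:E).
    apply/measurable_EFinP; apply: (measurableT_comp (measurable_powR _)).
    exact: measurable_sqtruncX.
  have mUS : measurable_fun setT (fun w => (sqtrunc e (X w - m) `^ (p - 1))%:E * S w).
    exact: emeasurable_funM.
  have US0 w : 0 <= (sqtrunc e (X w - m) `^ (p - 1))%:E * S w.
    by rewrite mule_ge0// lee_fin powR_ge0.
  have kUS0 w : 0 <= (K * p ^+ 2)%:E * ((sqtrunc e (X w - m) `^ (p - 1))%:E * S w).
    by rewrite mule_ge0 ?lee_fin.
  have mkUS : measurable_fun setT (fun w =>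
      (K * p ^+ 2)%:E * ((sqtrunc e (X w - m) `^ (p - 1))%:E * S w)).
    exact: emeasurable_funM.
  have qMP0 w : 0 <= q%:E * MP w by rewrite mule_ge0 ?lee_fin.
  have mqMP : measurable_fun setT (fun w => q%:E * MP w) by exact: emeasurable_funM.
  rewrite /I -(ge0_integralZl_EFin _ measurableT (fun w _ => US0 w) mUS Kp0).
  rewrite -(ge0_integralZl_EFin _ measurableT (fun w _ => MP0 w) mMP q0).
  rewrite -(ge0_integralD _ measurableT (fun w _ => kUS0 w) mkUS (fun w _ => qMP0 w) mqMP).
  have mD' : measurable_fun setT (multiscale weight D').
    by apply: measurable_multiscale => //; exact: oD'.1.
  apply: (ae_ge0_le_integral measurableT _ mD' _ (emeasurable_funD mkUS mqMP)).
  - by move=> w _; exact: multiscale_ge0.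
  - by move=> w _; apply: adde_ge0.
  apply: filterS (multiscale_osc_powtrunc_le d0 weight_ge0 mweight mX oD p1 e0 oD') => w + _.
  by [].
apply: (@le_trans _ _ ((4 `^ p)%:E * ((W `^ (p - 1))%:E * I +
    ((K * p ^+ 2) `^ p)%:E * ((W `^ (p - 1))%:E * I)) + p%:E * (q%:E * I))).
  by rewrite leeD2r// lee_wpmul2l ?lee_fin ?powR_ge0// leeD// lee_wpmul2l ?lee_fin ?powR_ge0.
have a0 : (0 <= 4 `^ p :> R)%R by exact: powR_ge0.
have w0 : (0 <= W `^ (p - 1))%R by exact: powR_ge0.
have k0 : (0 <= (K * p ^+ 2) `^ p)%R by exact: powR_ge0.
rewrite (muleA ((K * p ^+ 2) `^ p)%:E) (muleA p%:E) -!EFinM.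
rewrite -ge0_muleDl ?lee_fin ?(mulr_ge0 k0 w0)// -EFinD muleA -EFinM.
rewrite -ge0_muleDl ?lee_fin ?(mulr_ge0 (ltW p0) q0)//; last first.
  by apply: (mulr_ge0 a0); apply: addr_ge0 => //; exact: mulr_ge0.
rewrite -EFinD lee_wpmul2r// lee_fin.
apply: le_trans (osc_moment_constant p1 W0 c0 K0).
by rewrite [(W `^ (p - 1) * (1 + _))%R]mulrDr mulr1 (mulrC ((K * p ^+ 2) `^ p)%R).
Qed.

End oscillation_spectral_gap.

Theorem proposition1p10 (R : realType) (d : nat) (d_gt0 : (0 < d)%N)
    (weight : R -> R)
    (weight_ge0 : forall l : R, 0 <= l -> 0 <= weight l)
    (weight_int : lebesgue_measure.-integrable `[0, +oo[ (EFin \o weight)) :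
  exists2 C : R, 0 < C &
  forall (disp : measure_display) (Omega : measurableType disp)
    (P : probability Omega R) (A : Rd R d -> Omega -> R),
    jointly_measurable A -> stationary P A ->
    (forall M : set (Rd R d -> R),
       open_Linfty M -> (forall w, M (A ^~ w)) -> fct_MSG P A M weight ->
       (forall (p : R) X G, 1 <= p -> fct_observable P A M X G ->
          (centered_moment P (2 * p) (fun w => X (A ^~ w)) <=
           ((C * p ^+ 2) `^ p)%:E *
           \int[P]_w (multiscale weight (fct_field G) w) `^ p)%E) /\
       (fct_MLSI P A M weight ->
        forall (p : R) X G, 1 <= p -> fct_observable P A M X G ->
          (centered_moment P (2 * p) (fun w => X (A ^~ w)) <=
           ((C * p) `^ p)%:E *
           \int[P]_w (multiscale weight (fct_field G) w) `^ p)%E)) /\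
    (osc_MSG P A weight ->
     forall (p : R) (X : Omega -> R) D,
       1 <= p -> field_measurable A setT X -> is_osc_field P A X D ->
       (centered_moment P (2 * p) X <=
        ((C * p ^+ 2) `^ p)%:E *
        \int[P]_w multiscale_pow p weight D w)%E).
Proof.
have mweight : measurable_fun (`[0, +oo[ : set R) weight.
  by apply/measurable_EFinP; exact: measurable_int weight_int.
pose W : R := fine (\int[lebesgue_measure]_(l in `[0%R, +oo[) (weight l)%:E)%E.
have intW : (\int[lebesgue_measure]_(l in `[0%R, +oo[) (weight l)%:E = W%:E)%E.
  by rewrite fineK//; exact: integrable_fin_num weight_int.
have W0 : 0 <= W.
  apply: fine_ge0; apply: integral_ge0 => l /=; rewrite in_itv/= andbT => l0.
  by rewrite lee_fin weight_ge0.
pose C := 4 * (1 + W) * (1 + 4 * expR 4) +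
  9 * expR 1 * (1 + ((2 / d%:R) ^+ d)^-1) : R.
have C0 : 0 <= C.
  have c0 : 0 <= ((2 / d%:R) ^+ d)^-1 :> R by rewrite invr_ge0 exprn_ge0// divr_ge0.
  have [E4 E1] := (expR_ge0 (4 : R), expR_ge0 (1 : R)).
  by apply: addr_ge0; apply: mulr_ge0; rewrite ?addr_ge0 ?mulr_ge0 ?addr_ge0.
have le_const (a b p : R) (x y : \bar R) : 0 <= a -> a <= b -> 1 <= p -> (0 <= x)%E ->
    (y <= (a `^ p)%:E * x)%E -> (y <= (b `^ p)%:E * x)%E.
  move=> a0 ab /(le_trans ler01) p0 x0 /le_trans; apply; rewrite lee_wpmul2r// lee_fin.
  by apply: ge0_ler_powR; rewrite ?nnegrE// (le_trans a0).
(* The 8 covers the functional derivative, where the logarithmic Sobolev case needs only 2, and [C]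
   covers the oscillation. *)
exists (8 + C) => [|disp Omega P A mA _]; first by rewrite ltr_wpDr.
split=> [M _ _ MSG|MSG p X D p1 fX oD].
  have I0 (p : R) G : (0 <= \int[P]_w multiscale weight (fct_field G) w `^ p)%E.
    by apply: integral_ge0 => w _; exact: poweR_ge0.
  split=> [p X G p1 obsX|MLSI p X G p1 obsX]; have p0 := le_trans ler01 p1.
    apply: le_const (fct_MSG_moment mA weight_ge0 mweight obsX MSG p1) => //.
      by rewrite mulr_ge0 ?sqr_ge0.
    by rewrite ler_wpM2r ?sqr_ge0// lerDl.
  apply: le_const (fct_MLSI_moment mA weight_ge0 mweight obsX MSG MLSI p1) => //.
    by rewrite mulr_ge0.
  by rewrite ler_wpM2r// (@le_trans _ _ 8) ?lerDl// ler_nat.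
have p0 := le_trans ler01 p1.
apply: le_const (osc_MSG_moment mA d_gt0 weight_ge0 mweight MSG intW p1 fX oD) => //.
- by rewrite mulr_ge0 ?sqr_ge0.
- by rewrite ler_wpM2r ?sqr_ge0// lerDr.
apply: integral_ge0 => w _; apply: integral_ge0 => l /=; rewrite in_itv/= andbT => l0.
by rewrite mule_ge0 ?poweR_ge0// lee_fin mulr_ge0 ?powR_ge0 ?weight_ge0.
Qed.
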